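(* Let $q$ be a power of a prime $p\ne3$. The unique conjugacy class $\mathcal{O}$ of elements of order three of $\mathrm{PSL}(2,q)$ is semisimple, and its subracks are the following; that is, every subrack of $\mathcal{O}$ is of one of the types (1)–(6), and conversely each of the listed types (for all admissible values of its parameters) occurs as a subrack of $\mathcal{O}$: (1) subracks of size one; (2) the subracks $\{y,y^{-1}\}$, where $y\in\mathcal{O}$; (3) if $q$ is odd or a power of $4$, subracks isomorphic to $(1\,2\,3)^{\mathbb{A}_4}$ or to $(1\,2\,3)^{\mathbb{A}_4}\cup(1\,3\,2)^{\mathbb{A}_4}$; (4) if $5\mid q^2-1$, subracks isomorphic to $(1\,2\,3)^{\mathbb{A}_5}$; (5) if $3\mid q-1$, subracks isomorphic to $A\rtimes_q\{z,z^{-1}\}\subseteq A\rtimes_qC_3$ or to $A\rtimes_q\{z\}$, where $z\in C_3\subseteq\mathbb{F}_q^{\times2}$ has order $3$; (6) subracks isomorphic to the class of elements of order $3$ in $\mathrm{PSL}(2,q_0)$, where $q_0>4$ and $q$ is a power of $q_0$.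
   Context: $\mathrm{PSL}(2,q)$ acts on the projective line $\mathbb{P}(1,q)$ over $\mathbb{F}_q$; a non-trivial conjugacy class is semisimple if its elements have two fixed points (split) or no fixed point (non-split) in $\mathbb{P}(1,q)$. $\mathbb{A}_n$ is the alternating group and $g^G$ the conjugacy class of $g$ in $G$. Let $\mathbb{F}_q^{\times2}$ be the group of squares in $\mathbb{F}_q^\times$. For a subgroup $C\le\mathbb{F}_q^{\times2}$ and a vector space $A$ over the smallest subfield of $\mathbb{F}_q$ containing $C$, $A\rtimes_qC$ denotes the semidirect product in which $C$ acts on $A$ by multiplication; for $S\subseteq C$, $A\rtimes_qS$ is the subset of pairs $(a,c)$ with $a\in A$, $c\in S$. In (5), $C_3$ is the subgroup of order $3$ of $\mathbb{F}_q^{\times 2}$, and $A$ is any such vector space with $1<|A|\le q$ (equivalently, up to isomorphism, a non-zero $\mathbb{F}_p(z)$-subspace of $\mathbb{F}_q$). A rack is a non-empty set $X$ with a binary operation $\triangleright$ such that every map $y\mapsto x\triangleright y$ is bijective and $x\triangleright(y\triangleright z)=(x\triangleright y)\triangleright(x\triangleright z)$. Groups and unions of conjugacy classes are racks via $g\triangleright h=ghg^{-1}$. A subrack is a non-empty subset closed under $\triangleright$. Isomorphic means isomorphic as racks. In (6), $q_0$ is a prime power. *)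

(* Defs.v *)
From HB Require Import structures.
From mathcomp Require Import all_boot all_order all_algebra all_fingroup.
From mathcomp Require Import all_solvable all_field all_character.

Set Implicit Arguments.
Unset Strict Implicit.
Unset Printing Implicit Defensive.

Import GRing.Theory.

Local Open Scope group_scope.

Section Racks.

Variable T : finType.
Implicit Types (op : T -> T -> T) (X Y : {set T}).

Definition is_rack op X : Prop :=
  [/\ X != set0,
      {in X, forall x, {in X &, injective (op x)} /\ op x @: X = X}
    & {in X & &, forall x y z, op x (op y z) = op (op x y) (op x z)}].

Definition subrack op X Y : Prop :=
  [/\ Y \subset X, Y != set0 & {in Y &, forall x y, op x y \in Y}].

Lemma subrack_is_rack op X Y : is_rack op X -> subrack op X Y -> is_rack op Y.
Proof.
case=> _ bijX distX [sYX Y0 clY]; split=> // [x Yx | x y z Yx Yy Yz].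
  have [injx _] := bijX x (subsetP sYX x Yx).
  have injY : {in Y &, injective (op x)}.
    by move=> y z Yy Yz; apply: injx; apply: (subsetP sYX).
  split=> //; apply/eqP; rewrite eqEcard card_in_imset // leqnn andbT.
  by apply/subsetP=> _ /imsetP[y Yy ->]; apply: clY.
by apply: distX; apply: (subsetP sYX).
Qed.

End Racks.

Definition rack_isomorphic (S T : finType) opS (X : {set S}) opT (Y : {set T}) :=
  exists f : S -> T,
    [/\ {in X &, injective f}, f @: X = Y
      & {in X &, forall x y, f (opS x y) = opT (f x) (f y)}].

(* Beware that MathComp's [h ^ g] is [g^-1 * h * g]. *)
Definition conj_op (gT : finGroupType) (g h : gT) : gT := g * h * g^-1.

Lemma conj_is_rack (gT : finGroupType) (X : {set gT}) :
  X != set0 -> {in X &, forall x y, conj_op x y \in X} ->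
  is_rack (@conj_op gT) X.
Proof.
move=> X0 clX; apply: (@subrack_is_rack _ _ setT).
  split=> [|x _|x y z _ _ _].
  - by apply/set0Pn; exists 1; rewrite inE.
  - have injx : injective (conj_op x) by move=> y z /mulIg/mulgI.
    split; first exact: in2W.
    by apply/eqP; rewrite eqEcard subsetT (card_imset _ injx) leqnn.
  - by rewrite /conj_op /= !invMg invgK !mulgA !mulgKV.
by split; rewrite ?subsetT.
Qed.

Notation "X ~=r Y" :=
  (rack_isomorphic (@conj_op _) X (@conj_op _) Y) (at level 70).

Definition occurs_in (gT hT : finGroupType) (X : {set gT}) (Y : {set hT}) :=
  exists2 Z : {set gT}, subrack (@conj_op gT) X Z & Z ~=r Y.

Section PSL2.

Variable F : finFieldType.

Definition SL2 : {set {'GL_2[F]}} := [set g | (\det (GLval g) == 1)%R].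

Fact SL2_group_set : group_set SL2.
Proof.
apply/group_setP; split=> [|g h]; rewrite !inE ?GL_1E ?det1 //.
by move=> /eqP detg /eqP deth; rewrite GL_ME det_mulmx detg deth mulr1.
Qed.
Canonical SL2_group := Group SL2_group_set.

Definition PSL2 : {set coset_of 'Z(SL2)} := SL2 / 'Z(SL2).
Canonical PSL2_group := Eval hnf in [group of PSL2].

Definition order3 : {set coset_of 'Z(SL2)} := [set x in PSL2 | #[x] == 3].

(* A point is the set of vectors of a line of F^2 (row vectors, on which
   matrices act on the right). *)
Definition proj_line : {set {set 'rV[F]_2}} :=
  [set rowg v | v : 'rV[F]_2 & v != 0%R].

Definition proj_act := (('MR (@GLrepr F 1))^* %% 'Z(SL2))%act.

(* [modact] is the identity away from the points fixed by 'Z(SL2); on lines it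
   is the expected action. *)
Fact det_transvection (i j : 'I_2) :
  i != j -> (\det (1%:M + delta_mx i j : 'M[F]_2) = 1)%R.
Proof.
wlog lt_ji : i j / j < i.
  move=> IH neq_ij; case: (ltngtP j i) => [lt_ji|lt_ij|eq_ij]; first exact: IH.
    by rewrite -det_tr linearD /= tr_scalar_mx trmx_delta IH // eq_sym.
  by case/eqP: neq_ij; apply: val_inj.
move=> neq_ij; rewrite det_trig.
  by rewrite big1 // => k _; rewrite !mxE eqxx; case: eqP => [->|_]; 
     rewrite ?(negPf neq_ij) addr0.
apply/is_trig_mxP=> k l lt_kl; rewrite !mxE -val_eqE /= (ltn_eqF lt_kl) add0r.
case: eqP => //= eq_ki; case: eqP => //= eq_lj.
by move: lt_kl; rewrite eq_ki eq_lj ltnNge ltnW.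
Qed.

Lemma SL2_center_scalar (g : {'GL_2[F]}) :
  g \in 'Z(SL2) -> exists2 a : F, a != 0%R & (GLval g = a%:M)%R.
Proof.
case/centerP=> _ cg.
have commE (i j : 'I_2) : i != j ->
    (delta_mx i j *m GLval g = GLval g *m delta_mx i j)%R.
  move/det_transvection; set M := (_ + _)%R => detM.
  have uM : (M \in unitmx)%R by rewrite unitmxE detM unitr1.
  pose h : {'GL_2[F]} := insubd (1 : {'GL_2[F]}) M.
  have hE : GLval h = M by rewrite /h val_insubd uM.
  have SLh : h \in SL2 by rewrite inE hE detM.
  have /(congr1 (@GLval 2 F)) := cg h SLh; rewrite !GL_MxE hE.
  by rewrite mulmxDl mulmxDr mul1mx mulmx1 => /addrI.
have dmE (G : 'M[F]_2) (i j k l : 'I_2) :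
    ((delta_mx i j *m G)%R k l = ((k == i)%:R * G j l)%R) *
    ((G *m delta_mx i j)%R k l = (G k i * (l == j)%:R)%R).
  split; rewrite mxE.
    rewrite (bigD1 j) //= big1 => [|r /negPf neq_r]; rewrite !mxE ?eqxx.
      by rewrite addr0 andbT.
    by rewrite neq_r andbF mul0r.
  rewrite (bigD1 i) //= big1 => [|r /negPf neq_r]; rewrite !mxE ?eqxx ?addr0 //.
  by rewrite neq_r mulr0.
have entryE (i j : 'I_2) : i != j ->
    (GLval g j i = 0 /\ GLval g j j = GLval g i i)%R.
  move=> /[dup] neq_ij /commE/matrixP eg; split.
    have := eg i i; rewrite !dmE eqxx mul1r => ->.
    by rewrite (negPf neq_ij) mulr0.
  by have := eg i j; rewrite !dmE !eqxx mul1r mulr1.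
have gE : (GLval g = (GLval g ord0 ord0)%:M)%R.
  apply/matrixP=> i j; rewrite [RHS]mxE; case: eqVneq => [->|neq_ij].
    by have [->|/entryE[_]] := eqVneq j ord0.
  by rewrite eq_sym in neq_ij; case: (entryE _ _ neq_ij).
exists (GLval g ord0 ord0) => //; apply/eqP=> g0.
by have := GL_unit g; rewrite gE g0 raddf0 unitr0.
Qed.

Lemma proj_actE (g : {'GL_2[F]}) (L : {set 'rV[F]_2}) :
    g \in SL2 -> L \in proj_line ->
  proj_act L (coset 'Z(SL2) g) = [set (v *m GLval g)%R | v in L].
Proof.
move=> SLg /imsetP[v _ ->{L}].
have actE (h : {'GL_2[F]}) (w : 'rV[F]_2) :
    (('MR (@GLrepr F 1))%act w h = w *m GLval h)%R.
  by rewrite /= mx_repr_actE ?inE.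
have nZg : g \in 'N('Z(SL2)).
  exact: (subsetP (normal_norm (center_normal SL2_group))).
have stabZ : rowg v \in 'Fix_(('MR (@GLrepr F 1))^*)('GL_2[F] :&: 'Z(SL2)).
  rewrite setTI; apply/afixP=> z /SL2_center_scalar[a a0 zE].
  apply/setP=> w; apply/imsetP/idP => [[u Lu ->]|Lw].
    by rewrite actE zE mul_mx_scalar mem_rowg scalemx_sub // -mem_rowg.
  exists (a^-1 *: w)%R; first by rewrite mem_rowg scalemx_sub // -mem_rowg.
  by rewrite actE zE mul_mx_scalar scalerA mulfV // scale1r.
rewrite /proj_act /= modactE //.
by apply: eq_imset => w; rewrite actE.
Qed.

Definition proj_fix (x : coset_of 'Z(SL2)) := 'Fix_(proj_line | proj_act)[x].

Definition split_class (C : {set coset_of 'Z(SL2)}) :=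
  {in C, forall x, #|proj_fix x| = 2}.

Definition nonsplit_class (C : {set coset_of 'Z(SL2)}) :=
  {in C, forall x, #|proj_fix x| = 0}.

Definition semisimple_class (C : {set coset_of 'Z(SL2)}) :=
  [/\ C \in classes PSL2, C != [set 1] & split_class C \/ nonsplit_class C].

End PSL2.

(* The cycle (1 2 3), with the points renumbered from 0. *)
Definition cycle123 n : {perm 'I_n.+3} :=
  let i k (lt_k : k < n.+3) := Ordinal lt_k in
  tperm (i 0%N isT) (i 1%N isT) * tperm (i 0%N isT) (i 2%N isT).

Section Subfield.

Variables (F : finFieldType) (C : {set {unit F}}).
Local Open Scope ring_scope.

Definition squares : {set {unit F}} := [set (u ^+ 2)%g | u : {unit F}].

Definition is_subfield (E : {set F}) :=
  [&& 1 \in E, [forall x in E, forall y in E, x - y \in E]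
    & [forall x in E, forall y in E, x / y \in E]].

Definition gen_subfield : {set F} :=
  \bigcap_(E : {set F} | is_subfield E && [forall c in C, val c \in E]) E.

Definition in_subfield : {pred F} := [pred x in gen_subfield].

Fact in_subfield_divring_closed : divring_closed in_subfield.
Proof.
have mem x : reflect
  (forall E : {set F}, is_subfield E && [forall c in C, val c \in E] -> x \in E)
  (x \in in_subfield) by rewrite inE; apply: bigcapP.
split=> [|x y /mem memx /mem memy|x y /mem memx /mem memy]; apply/mem => E PE.
- by case/andP: PE => /and3P[].
- case/andP: (PE) => /and3P[_ /forall_inP subE _] _.
  by move/forall_inP: (subE x (memx E PE)); apply; apply: memy.
- case/andP: (PE) => /and3P[_ _ /forall_inP divE] _.
  by move/forall_inP: (divE x (memx E PE)); apply; apply: memy.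
Qed.
HB.instance Definition _ :=
  GRing.isDivringClosed.Build F in_subfield in_subfield_divring_closed.

Record subfield : predArgType :=
  Subfield { subfield_val : F; _ : subfield_val \in in_subfield }.

HB.instance Definition _ := [isSub for subfield_val].
HB.instance Definition _ := [Finite of subfield by <:].
HB.instance Definition _ := [SubChoice_isSubIntegralDomain of subfield by <:].
HB.instance Definition _ := [SubIntegralDomain_isSubField of subfield by <:].

Fact unit_in_subfield (c : {unit F}) : c \in C -> val c \in in_subfield.
Proof.
move=> Cc; rewrite inE; apply/bigcapP=> E /andP[_ /forall_inP sCE].
exact: sCE.
Qed.

End Subfield.

Section SemidirectProduct.

Variables (F : finFieldType) (C : {group {unit F}}).
Variable A : finLmodType (subfield C).
Local Open Scope ring_scope.

Definition scalar_of (c : [subg C]) : subfield C :=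
  Subfield (unit_in_subfield (subgP c)).

Record sdprodq : predArgType := SDPair { sd_vec : A; sd_unit : [subg C] }.

Definition sd_pair (x : sdprodq) := (sd_vec x, sd_unit x).
Definition pair_sd (x : A * [subg C]) := SDPair x.1 x.2.
Fact sd_pairK : cancel sd_pair pair_sd. Proof. by case. Qed.
HB.instance Definition _ := Finite.copy sdprodq (can_type sd_pairK).

Definition sd_mul (x y : sdprodq) :=
  SDPair (sd_vec x + scalar_of (sd_unit x) *: sd_vec y)
         (sd_unit x * sd_unit y)%g.
Definition sd_one := SDPair 0 1%g.
Definition sd_inv (x : sdprodq) :=
  SDPair (- (scalar_of (sd_unit x)^-1%g *: sd_vec x)) (sd_unit x)^-1%g.

Fact scalar_ofM c d : scalar_of (c * d)%g = scalar_of c * scalar_of d.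
Proof. by apply: val_inj. Qed.

Fact scalar_of1 : scalar_of 1%g = 1.
Proof. by apply: val_inj. Qed.

Fact sd_mulA : associative sd_mul.
Proof.
case=> [a c] [b d] [e f]; rewrite /sd_mul /= mulgA scalar_ofM.
by rewrite scalerDr scalerA addrA.
Qed.

Fact sd_mul1 : left_id sd_one sd_mul.
Proof. by case=> a c; rewrite /sd_mul /= scalar_of1 scale1r add0r mul1g. Qed.

Fact sd_mulV : left_inverse sd_one sd_inv sd_mul.
Proof. by case=> a c; rewrite /sd_mul /= addNr mulVg. Qed.

HB.instance Definition _ :=
  Finite_isGroup.Build sdprodq sd_mulA sd_mul1 sd_mulV.

Definition sd_subset (S : {set {unit F}}) : {set sdprodq} :=
  [set x | sgval (sd_unit x) \in S].

End SemidirectProduct.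

(* Main.v *)
Require Import Defs.
From HB Require Import structures.
From mathcomp Require Import all_boot all_order all_algebra all_fingroup.
From mathcomp Require Import all_solvable all_field all_character.
From mathcomp Require Import ring zify.

Set Implicit Arguments.
Unset Strict Implicit.
Unset Printing Implicit Defensive.

(** Matrices of size two are handled as quadruples. An element of order three of
   [PSL2 F] has a unique lift of determinant 1 and trace -1: the cube of a lift
   is scalar, the lift is not, so by Cayley-Hamilton its trace is 1 or -1, and
   the sign can be chosen. Hence [order3 F] is isomorphic, as a rack, to the set
   [tri F] of matrices of trace -1 and determinant 1 under conjugation
   ([order3E], [psl_rack_iso]). Every [x] in [tri F] is conjugate in [SL2] to one
   companion matrix, because the norm form [s ^+ 2 - s * t + t ^+ 2] represents
   every element of [F] ([norm_form], [tri_conj]); so [order3 F] is a class. The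
   fixed points of [x] on the projective line correspond to the roots of
   [a ^+ 2 + a + 1] in [F], so the class is semisimple ([order3_semisimple]).

   Let [X] be a subrack of [tri F], and [G] the group of permutations of the
   projective line generated by [X].

   - If the elements of [X] commute, they are at most [y] and its inverse
     ([commuting_tri]).
   - If [G] fixes a point, then [X] consists of triangular matrices. They compose
     like pairs [(a, c)] of a semidirect product with [c] a cube root of unity,
     and closure under conjugation makes the set of the [a] a vector space over
     the field generated by the [c] ([borel_types]).
   - Otherwise, enlarge [F] to a field [E] over which every matrix of determinant
     one over [F] has an eigenvector. There is still no common fixed point,
     because a common eigenvector spans the kernel of a commutator of two
     elements of [X] and is thus defined over [F] ([fixed_descends]). Now every
     non-trivial element of [G] fixes one or two points. Let [G_P] be the
     stabilizer of [P], and [U_P] the group of those elements that are trivial or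
     fix only [P]. Counting fixed points gives the identity
     [\sum_P (#|G_P| - 1 + #|U_P| - 1) = 2 * (#|G| - 1)], in which all orbits
     have at least three points, as elements of order three generate [G]. Its
     solutions are few ([wild_or_tame]).
     - If all [U_P] are trivial, [G] has order 12, 24 or 60. Acting on an orbit
       of four points, respectively on its five Klein four-groups, it is the
       alternating group of degree 4 or 5; order 24 would give the symmetric
       group of degree 4, which elements of order three do not generate
       ([tame_rack]).
     - If some [U_P] is not trivial, the orbit of such a [P] has [#|U_P|.+1] points
       and [G_P] is large. In coordinates in which this orbit contains the points
       at infinity, 0 and 1, the translations of [G] form a set [A], the orbit is
       [A] with infinity, and the multipliers of [A] coming from [G_P] are so many
       that [A] is a subfield. Then [G] contains [SL2 A], and [X] is the image of
       [tri A]. The traces of products of elements of [X] lie in [F] and generate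
       [A] ([trace_subfield]), so that [#|F|] is a power of [#|A|].

   Conversely, a field of order [q0] embeds in [F] when [q] is a power of [q0]
   ([finField_embed]), and any [A] with at most [q] elements embeds linearly in
   [F] ([borel_exists]). In odd characteristic the matrix algebra contains
   quaternions, and the matrices [(- 1 + v) / 2], for [v] a vertex of the cube
   with coordinates 1 and -1, or of the dodecahedron that contains it, form
   subracks of [tri F]. The dodecahedron needs the golden ratio in [F], which
   exists when 5 divides [q ^ 2 - 1] ([golden_ratio]). The classification, already
   proved, says what these racks are: their cardinals leave one possibility. In
   characteristic 2 the rack [tri K] over the field [K] of four elements is the
   class of 3-cycles in the alternating group of degree 5 ([tri_card4]), which
   contains the 3-cycles of the alternating group of degree 4.
*)

Local Open Scope group_scope.

(** * Permutations and unipotent elements *)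

Section AbstractUn.
Variable T : finType.
Definition fixpts (g : {perm T}) := [set P | g P == P].
(** In [PSL2] these are the images of the unipotent elements that fix [P]. *)
Definition unip P (g : {perm T}) :=
  (g P == P) && ((g == 1%g) || (fixpts g \subset [set P])).
End AbstractUn.

(** * Solving the orbit equation *)

Fact orbit_weight (k a b : nat) : (0 < a)%N -> (0 < b)%N ->
  (k * (a.-1 + b.-1) + 2 * k = k * a + k * b)%N.
Proof. by case: a b => [|a] [|b] // _ _; rewrite !mulnS mulnDr /=; lia. Qed.

(** One orbit of [k] points with stabilizers of order [Q * m] and unipotent groups
   of order [Q] already accounts for nearly all of [2 * (g - 1)]; a second orbit
   with non-trivial stabilizers closes the equation. *)
Lemma wild_arith (g k Q m l e2 k2 Q2 rest : nat) :
  g = (k * (Q * m))%N -> k = (1 + l * Q)%N -> (3 <= k)%N -> (2 <= Q)%N ->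
  Q != 3%N -> (0 < m <= Q.-1)%N -> (k2 * e2)%N = g -> (2 <= e2)%N -> (0 < Q2)%N -> (3 <= k2)%N ->
  (k * ((Q * m).-1 + Q.-1) + (k2 * (e2.-1 + Q2.-1) + rest))%N = (2 * (g - 1))%N ->
  (rest = 0 \/ g <= 2 * rest)%N ->
  [/\ k = Q.+1, (4 <= Q)%N & (Q.-1 <= 2 * m)%N].
Proof.
move=> dg dk k3 Q22 Qn3 /andP[m0 mQ] dg2 e22 Q20 k23.
have Q0 : (0 < Q)%N by lia.
have Qm0 : (0 < Q * m)%N by rewrite muln_gt0 Q0.
have := orbit_weight k Qm0 Q0; rewrite -dg.
have := @orbit_weight k2 e2 Q2 (ltnW e22) Q20; rewrite dg2.
move: (k * _)%N (k2 * (_ + _))%N => V W eW eV eq rest0.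
have le1 : (k * 2 <= k * Q)%N by rewrite leq_mul2l Q22 orbT.
have le2 : (k2 * 2 <= g)%N by rewrite -dg2 leq_mul2l e22 orbT.
have le3 : (k2 * 1 <= k2 * Q2)%N by rewrite leq_mul2l Q20 orbT.
have r0 : rest = 0%N by case: rest0 => // rg; lia.
have Q21 : Q2 = 1%N.
  apply/eqP; rewrite eqn_leq Q20 andbT leqNgt; apply/negP => Q2g.
  have : (k2 * 2 <= k2 * Q2)%N by rewrite leq_mul2l Q2g orbT.
  by lia.
have ek2 : k2 = (2 + k * (Q - 2))%N.
  by rewrite mulnBr; move: eW; rewrite Q21 muln1; lia.
have {le1 le2 le3 r0 rest0 eq eW eV Q21 V W rest Q2 Q20} Q4 : (4 <= Q)%N.
  case: (Q =P 2%N) => [Qe|?]; last by lia.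
  by move: ek2; rewrite Qe; lia.
have [Q' eQ] : exists Q', Q = Q'.+2 by exists (Q - 2)%N; lia.
(* dividing the equation by [Q] leaves [D * e2 = (D + 2 * l) * m], where [D] is
   prime to [l]; so [D] divides [2 * m], which bounds [l] *)
pose D := (1 + l * Q')%N.
have eD : (D * e2 = (D + l * 2) * m)%N.
  have ekD : k = (D + l * 2)%N by rewrite dk /D eQ !mulnS; lia.
  have ek2D : k2 = (Q * D)%N.
    by rewrite ek2 dk /D eQ subSS subSS subn0; clear; nia.
  apply/eqP; rewrite -(eqn_pmul2l Q0) mulnA -ek2D dg2 dg -ekD; apply/eqP.
  by clear; nia.
have : (D %| l * (2 * m))%N.
  have : (D %| D * e2)%N by rewrite dvdn_mulr.
  by rewrite eD mulnDl (dvdn_addr _ (dvdn_mulr _ (dvdnn D))) mulnA.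
rewrite Gauss_dvdr; last by rewrite /D coprime_sym addnC mulnC /coprime gcdnMDl gcdn1.
case/dvdnP=> c ec.
have l0 : (0 < l)%N by case: (l) dk k3 => //; lia.
have c0 : (0 < c)%N by case: (c) ec m0 => //; lia.
have mQ' : (m <= Q'.+1)%N by lia.
have Q'2 : (2 <= Q')%N by lia.
have leD : (D <= 2 * m)%N by rewrite ec leq_pmull.
have lt3 : (l < 3)%N.
  rewrite ltnNge; apply/negP=> l3.
  have : (3 * Q' <= l * Q')%N by rewrite leq_mul2r l3 orbT.
  by rewrite /D in leD; lia.
have [l1|l2] : l = 1%N \/ l = 2%N by lia.
  by split=> //; [rewrite dk l1; lia | move: leD; rewrite /D l1; lia].
move: ec leD; rewrite /D l2; case: c c0 => [|[|c]] // _; first by lia.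
have : (2 * (1 + 2 * Q') <= c.+2 * (1 + 2 * Q'))%N by rewrite leq_mul2r.
by lia.
Qed.

Fact orbit_weight1 (k e : nat) : (0 < e)%N -> (k * e.-1 + k = k * e)%N.
Proof. by case: e => // e _; rewrite mulnS addnC. Qed.

(** Three orbits [k_i] with stabilizers of order [e_i] satisfy
   [1/e1 + 1/e2 + 1/e3 > 1], as for the rotation groups of the regular solids; one
   of the orders is a multiple of three, and the dihedral solutions are excluded
   by [3 <= k_i]. *)
Lemma tame_arith (g k1 k2 k3 e1 e2 e3 rest : nat) :
  (k1 * e1)%N = g -> (k2 * e2)%N = g -> (k3 * e3)%N = g ->
  (3 %| e1)%N -> (0 < e1)%N -> (2 <= e2)%N -> (2 <= e3)%N ->
  (3 <= k1)%N -> (3 <= k2)%N -> (3 <= k3)%N ->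
  (k1 * e1.-1 + (k2 * e2.-1 + (k3 * e3.-1 + rest)))%N = (2 * (g - 1))%N ->
  (rest = 0 \/ g <= 2 * rest)%N ->
  [/\ rest = 0, e1 = 3%N & (e2 = 2%N /\ e3 \in [:: 3; 4; 5]%N) \/ (e3 = 2%N /\ e2 \in [:: 3; 4; 5]%N)]%N.
Proof.
move=> d1 d2 d3 e1_3 e10 e22 e32 k13 k23 k33.
have b1 : (3 <= e1)%N by apply: dvdn_leq.
have := orbit_weight1 k1 e10; rewrite d1.
have := orbit_weight1 k2 (ltnW e22); rewrite d2.
have := orbit_weight1 k3 (ltnW e32); rewrite d3.
move: (k1 * _)%N (k2 * _)%N (k3 * _)%N => V1 V2 V3 s3 s2 s1 eq rest0.
have le k e c : (k * e = g -> c <= e -> c * k <= g)%N.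
  by move=> <- lec; rewrite mulnC leq_mul2l lec orbT.
have t1 := le _ _ _ d1 b1; have t2 := le _ _ _ d2 e22; have t3 := le _ _ _ d3 e32.
have r0 : rest = 0%N by case: rest0 => // rg; lia.
have sum : (k1 + k2 + k3 = g + 2)%N by lia.
have e13 : e1 = 3%N.
  case/dvdnP: e1_3 => c ec; have [c1|c2] := leqP c 1; first by lia.
  have u1 := le _ _ 6 d1 ltac:(lia).
  have [e2_3|e2_2] := leqP 3 e2; first by have := le _ _ _ d2 e2_3; lia.
  have [e3_3|e3_2] := leqP 3 e3; first by have := le _ _ _ d3 e3_3; lia.
  have ee2 : e2 = 2%N by lia.
  have ee3 : e3 = 2%N by lia.
  by subst e2 e3; lia.
split=> //; subst e1; move: d2 d3 e22 e32 k23 k33 sum.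
clear - d1 le k13.
wlog: k2 k3 e2 e3 / (e2 <= e3)%N => [IH d2 d3 e22 e32 k23 k33 sum | lee d2 d3 e22 e32 k23 k33 sum].
  have [le'|lt] := leqP e2 e3; first exact: (IH k2 k3).
  by case: (IH k3 k2 e3 e2) => //; lia.
left.
have [e2_3|e2_2] := leqP 3 e2.
  have := le _ _ _ d2 e2_3.
  have := le _ _ 3 d3 ltac:(lia).
  by lia.
have e2E : e2 = 2%N by lia.
subst e2; split=> //.
have e6 : (6 * k3 = g + 12)%N by lia.
have [e3_6|e3_6] := leqP 6 e3; first by have := le _ _ _ d3 e3_6; lia.
have: e3 \in [:: 2; 3; 4; 5]%N by rewrite !inE; lia.
rewrite !inE => /or4P[]/eqP ee; subst e3; rewrite ?eqxx ?orbT //; lia.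
Qed.

Fact tame_order (g k1 k2 k3 e : nat) : (0 < g)%N ->
  (k1 * 3 = g)%N -> (k2 * 2 = g)%N -> (k3 * e = g)%N -> e \in [:: 3; 4; 5]%N ->
  (k1 * 2 + (k2 * 1 + k3 * e.-1) = 2 * (g - 1))%N ->
  (e, g) \in [:: (3, 12); (4, 24); (5, 60)]%N.
Proof.
move=> g0 d1 d2 d3; rewrite !inE => /or3P[]/eqP ee; subst e => /= s1;
  rewrite !xpair_eqE /= ?orbF; lia.
Qed.

(** * Rack isomorphisms and 3-cycles *)

Section RackIso.
Variables (S T U : finType) (opS : S -> S -> S) (opT : T -> T -> T) (opU : U -> U -> U).

Lemma rack_iso_trans (X : {set S}) (Y : {set T}) (Z : {set U}) :
  rack_isomorphic opS X opT Y -> rack_isomorphic opT Y opU Z ->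
  rack_isomorphic opS X opU Z.
Proof.
move=> [f [injf fX fM]] [g [injg gY gM]]; exists (g \o f).
have fXY x : x \in X -> f x \in Y by move=> Xx; rewrite -fX imset_f.
split=> [x y Xx Xy /injg /injf|| x y Xx Xy] /=; first by apply; rewrite ?fXY.
  by rewrite imset_comp fX.
by rewrite fM // gM ?fXY.
Qed.

Lemma rack_iso_sym (X : {set S}) (Y : {set T}) (s0 : S) :
  {in X &, forall x y, opS x y \in X} ->
  rack_isomorphic opS X opT Y -> rack_isomorphic opT Y opS X.
Proof.
move=> clX [f [injf fX fM]].
pose g t := odflt s0 [pick s in X | f s == t].
have gP t : t \in Y -> g t \in X /\ f (g t) = t.
  rewrite -fX => /imsetP[x Xx ->]; rewrite /g; case: pickP => [y /andP[Xy /eqP]|/(_ x)] //.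
  by rewrite Xx eqxx.
have gK : {in X, cancel f g}.
  by move=> x Xx; have [Xg fg] := gP (f x) ltac:(by rewrite -fX imset_f); apply: injf.
exists g; split=> [s t Ys Yt e|| s t].
- by have [_ <-] := gP s Ys; have [_ <-] := gP t Yt; rewrite e.
- rewrite -fX -imset_comp -[RHS]imset_id; apply: eq_in_imset => x Xx /=.
  by rewrite gK.
rewrite -fX => /imsetP[x Xx ->] /imsetP[y Xy ->].
by rewrite -fM // !gK ?clX.
Qed.
End RackIso.

Lemma conj_opE (gT : finGroupType) (x y : gT) : conj_op x y = y ^ x^-1.
Proof. by rewrite /conj_op conjgE invgK mulgA. Qed.

Section Gen.
Variables (gT : finGroupType) (X : {set gT}).
Hypothesis clX : {in X &, forall x y, conj_op x y \in X}.

Lemma rack_norm : <<X>> \subset 'N(X).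
Proof.
rewrite gen_subG; apply/subsetP=> x Xx; rewrite -groupV inE.
by apply/subsetP=> _ /imsetP[y Xy ->]; rewrite -conj_opE clX.
Qed.

Lemma rack_conj x g : x \in X -> g \in <<X>> -> x ^ g \in X.
Proof. by move=> Xx Xg; rewrite memJ_norm ?(subsetP rack_norm). Qed.
End Gen.

Section ActSn.
Variables (aT : finGroupType) (rT : finType) (to : {action aT &-> rT}).
Variables (G : {group aT}) (S : {set rT}) (n : nat).
Hypotheses (actS : [acts G, on S | to]) (cardS : #|S| = n).

(** The action of [G] on [n] points, transported to the permutations of ['I_n].
   The enumeration [h] is part of the conclusion, so that faithfulness can be
   decided on the original points. *)
Lemma act_Sn : exists (f : aT -> {perm 'I_n}) (h : 'I_n -> rT),
  [/\ injective h, (forall i, h i \in S), (forall P, P \in S -> exists i, P = h i)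
    & {in G, forall g i, h (f g i) = to (h i) g}].
Proof.
subst n; pose h (i : 'I_#|S|) := enum_val i.
have hS i : h i \in S by apply: enum_valP.
have hP P : P \in S -> exists i, P = h i.
  by move=> SP; exists (enum_rank_in SP P); rewrite /h enum_rankK_in.
pose k g (i : 'I_#|S|) := enum_rank_in (hS i) (to (h i) g).
have hk g i : g \in G -> h (k g i) = to (h i) g.
  by move=> Gg; rewrite /h /k enum_rankK_in // (acts_act actS).
have inj_h : injective h by apply: enum_val_inj.
exists (fun g => insubd (1 : {perm _}) (finfun (k g))), h; split=> // g Gg i.
rewrite /insubd insubT /=; last by move=> ?; rewrite -pvalE ffunE hk.
apply/injectiveP=> i1 i2; rewrite !ffunE => /(congr1 h).
by rewrite !hk // => /act_inj/inj_h.
Qed.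
End ActSn.

Section Recognition.
Variables (gT : finGroupType) (X : {set gT}) (n : nat) (f : gT -> {perm 'I_n}).
Let G := <<X>>%G.
Hypothesis clX : {in X &, forall x y, conj_op x y \in X}.
Hypothesis X3 : {in X, forall x, x ^+ 3 = 1}.
Hypothesis fM : {in G &, {morph f : x y / x * y}}.
Hypothesis f_inj : {in G, forall g, f g = 1 -> g = 1}.

Let fm := Morphism fM.

Lemma cube1_even (s : {perm 'I_n}) : s ^+ 3 = 1 -> ~~ odd_perm s.
Proof.
move/(congr1 (@odd_perm _)); rewrite !expgS expg0 !odd_permM odd_perm1.
by case: odd_perm.
Qed.

(** Elements of order three are even, so a group that they generate acts by even
   permutations. *)
Lemma rack_image_Alt : f @: G \subset 'Alt_('I_n).
Proof.
have -> : f @: G = fm @* G by rewrite morphimEdom.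
rewrite morphim_gen ?subset_gen // gen_subG morphimEsub ?subset_gen //.
apply/subsetP=> _ /imsetP[x Xx ->]; rewrite Alt_even cube1_even //.
have Gx : x \in G by rewrite mem_gen.
by rewrite -morphX // X3 // morph1.
Qed.

Lemma f_injG : {in G &, injective f}.
Proof.
have inj_fm : 'injm fm.
  apply/subsetP=> g /morphpreP[Gg /set1P]; rewrite inE => /(f_inj Gg)->.
  exact: eqxx.
exact: (injmP inj_fm).
Qed.

Lemma rack_iso_image : X ~=r f @: X.
Proof.
have GX x : x \in X -> x \in G by apply: mem_gen.
exists f; split=> // [x y /GX Gx /GX Gy|x y /GX Gx /GX Gy]; first exact: f_injG.
rewrite /conj_op !fM ?groupM ?groupV //; congr (_ * _).
by rewrite -[f _]/(fm _) morphV.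
Qed.

Hypothesis cardG : #|G| = #|'Alt_('I_n)|.

Lemma rack_image_eq : f @: G = 'Alt_('I_n).
Proof.
apply/eqP; rewrite eqEcard rack_image_Alt card_in_imset ?cardG ?leqnn //.
exact: f_injG.
Qed.

Lemma rack_image_conj s t : s \in f @: X -> t \in 'Alt_('I_n) -> s ^ t \in f @: X.
Proof.
case/imsetP=> x Xx ->; rewrite -rack_image_eq => /imsetP[g Gg ->].
have Gx : x \in G by rewrite mem_gen.
rewrite -[f x]/(fm x) -[f g]/(fm g) -morphJ //; apply: imset_f.
exact: rack_conj.
Qed.

Lemma rack_image_class s : s \in f @: X -> s ^: 'Alt_('I_n) \subset f @: X.
Proof. by move=> Xs; apply/subsetP=> _ /imsetP[t At ->]; apply: rack_image_conj. Qed.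

Lemma rack_image_ord3 s : s \in f @: X -> s ^+ 3 = 1.
Proof.
case/imsetP=> x Xx ->; have Gx : x \in G by rewrite mem_gen.
by rewrite -[f x]/(fm x) -morphX // X3 // morph1.
Qed.

End Recognition.

Section Ord3.
Variable n : nat.
Let c := cycle123 n.
Let i0 : 'I_n.+3 := Ordinal (isT : (0 < n.+3)%N).
Let i1 : 'I_n.+3 := Ordinal (isT : (1 < n.+3)%N).
Let i2 : 'I_n.+3 := Ordinal (isT : (2 < n.+3)%N).

Lemma cycle123E : c = tperm i0 i1 * tperm i0 i2. Proof. by []. Qed.

Lemma cycle0 : c i0 = i1.
Proof. by rewrite cycle123E permM tpermL tpermD. Qed.
Lemma cycle1 : c i1 = i2.
Proof. by rewrite cycle123E permM tpermR tpermL. Qed.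
Lemma cycle2 : c i2 = i0.
Proof. by rewrite cycle123E permM [tperm i0 i1 _]tpermD // tpermR. Qed.
Lemma cycleD i : i \notin [:: i0; i1; i2] -> c i = i.
Proof.
rewrite !inE !negb_or => /and3P[n0 n1 n2].
by rewrite cycle123E permM !tpermD // eq_sym.
Qed.

Hypothesis n2 : (n <= 2)%N.

(** With at most five points there is room for one 3-cycle only. *)
Lemma ord3_moved (s : {perm 'I_n.+3}) : s ^+ 3 = 1 -> s != 1 ->
  exists a, [/\ uniq [:: a; s a; s (s a)], s (s (s a)) = a &
            forall j, j \notin [:: a; s a; s (s a)] -> s j = j].
Proof.
move=> s3 s1; have s3E j : s (s (s j)) = j.
  by rewrite -[RHS](perm1 j) -s3 !expgS expg0 mulg1 !permM.
have u j : s j != j -> uniq [:: j; s j; s (s j)].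
  move=> sj; rewrite /= !inE negb_or (inj_eq perm_inj) ![j == s j]eq_sym sj !andbT /=.
  by apply: contra sj => /eqP {1}->; rewrite s3E.
have [a sa] : exists a, s a != a.
  apply/existsP; rewrite -negb_forall; apply: contra s1 => /forallP sj.
  by apply/eqP/permP=> j; rewrite perm1; apply/eqP.
exists a; split=> // [|j nj]; first exact: u.
apply/eqP; apply: contraT => sj.
have : uniq ([:: j; s j; s (s j)] ++ [:: a; s a; s (s a)]).
  rewrite cat_uniq !u //= andbT orbF.
  have nj' k : k \notin [:: a; s a; s (s a)] -> s k \notin [:: a; s a; s (s a)].
    rewrite !inE !negb_or -[in X in _ -> [&& X, _ & _]](s3E a) !(inj_eq perm_inj).
    by case/and3P=> -> -> ->.
  have := nj' _ (nj' _ nj); have := nj' _ nj; move: nj.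
  rewrite !inE !negb_or => /and3P[a1 a2 a3] /and3P[b1 b2 b3] /and3P[c1 c2 c3].
  by rewrite ![a == _]eq_sym ![s a == _]eq_sym ![s (s a) == _]eq_sym a1 a2 a3 b1 b2 b3 c1 c2 c3.
move/card_uniqP; rewrite /= => e; have := max_card (mem ([:: j; s j; s (s j)] ++ [:: a; s a; s (s a)])).
by rewrite e card_ord; move: n2; case: (n) => [|[|[|]]].
Qed.

Lemma ord3_conj (s t : {perm 'I_n.+3}) : s ^+ 3 = 1 -> s != 1 ->
  (exists a, [/\ uniq [:: a; s a; s (s a)], s (s (s a)) = a,
     forall j, j \notin [:: a; s a; s (s a)] -> s j = j &
     [/\ t i0 = a, t i1 = s a & t i2 = s (s a)]]) -> s = c ^ t.
Proof.
move=> s3 s1 [a [_ s3a fixs [t0 t1 t2]]]; apply/permP=> j.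
rewrite -[j](permKV t) permJ; move: (t^-1 j) => {}j.
have [|nj] := boolP (j \in [:: i0; i1; i2]).
  rewrite !inE => /or3P[]/eqP->; rewrite ?cycle0 ?cycle1 ?cycle2 ?t0 ?t1 ?t2 //.
rewrite cycleD // fixs // -t2 -t1 -t0 !inE !(inj_eq perm_inj).
by move: nj; rewrite !inE.
Qed.

Lemma trans_triple (A : {group {perm 'I_n.+3}}) a b d : uniq [:: a; b; d] ->
  [transitive^3 A, on setT | 'P] ->
  exists2 t, t \in A & [/\ t i0 = a, t i1 = b & t i2 = d].
Proof.
move=> u tr.
have d1 : [tuple i0; i1; i2] \in 3.-dtuple([set: 'I_n.+3]).
  by rewrite inE; apply/subsetP=> j; rewrite inE.
have d2 : [tuple a; b; d] \in 3.-dtuple([set: 'I_n.+3]).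
  by rewrite inE u; apply/subsetP=> j; rewrite inE.
have [t At /(congr1 val) /= [-> -> ->]] := atransP2 tr d1 d2.
by exists t.
Qed.

Lemma cycle123_Alt : c \in 'Alt_('I_n.+3).
Proof. by rewrite Alt_even cycle123E odd_permM !odd_tperm. Qed.

Lemma order_cycle123 : #[c] = 3.
Proof.
apply: nt_prime_order => //; last first.
  by apply/eqP=> /permP/(_ i0); rewrite cycle0 perm1 => /(congr1 val).
apply/permP=> i; rewrite permX perm1 /=.
have [|ni] := boolP (i \in [:: i0; i1; i2]); last by rewrite !(cycleD ni).
by rewrite !inE => /or3P[]/eqP->; do 3!rewrite ?cycle0 ?cycle1 ?cycle2.
Qed.

Lemma cycle123_tperm : c ^ tperm i0 i1 = c^-1.
Proof. by rewrite conjgE cycle123E invMg !tpermV !mulgA tperm2 mul1g. Qed.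

End Ord3.

Lemma ord3_Alt5 (s : {perm 'I_5}) : s ^+ 3 = 1 -> s != 1 ->
  s \in cycle123 2 ^: 'Alt_('I_5).
Proof.
move=> s3 s1; have [a [u s3a fixs]] := ord3_moved (leqnn 2) s3 s1.
have tr := Alt_trans 'I_5; rewrite card_ord in tr.
have [t At [t0 t1 t2]] := trans_triple u tr.
apply/imsetP; exists t => //; apply: (@ord3_conj 2) => //.
by exists a.
Qed.

Lemma ord3_Alt4 (s : {perm 'I_4}) : s ^+ 3 = 1 -> s != 1 ->
  s \in (cycle123 1 ^: 'Alt_('I_4)) :|: ((cycle123 1)^-1 ^: 'Alt_('I_4)).
Proof.
move=> s3 s1; have [a [u s3a fixs]] := ord3_moved (isT : (1 <= 2)%N) s3 s1.
have := Sym_trans 'I_4; rewrite card_ord => /(ntransitive_weak (isT : (3 <= 4)%N)) tr.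
have [t _ [t0 t1 t2]] := trans_triple u tr.
have es : s = cycle123 1 ^ t by apply: ord3_conj => //; exists a.
rewrite inE; have [odt|evt] := boolP (odd_perm t); last first.
  by apply/orP; left; rewrite es memJ_class // Alt_even.
apply/orP; right; rewrite -cycle123_tperm.
set τ := tperm _ _; rewrite es -[t](mulKg τ) [τ^-1]tpermV conjgM memJ_class //.
by rewrite Alt_even odd_permM odt odd_tperm.
Qed.

(** Conjugation by an odd permutation is an automorphism of the alternating group
   that exchanges the two classes of 3-cycles. *)
Lemma class_inv_iso :
  (cycle123 1)^-1 ^: 'Alt_('I_4) ~=r cycle123 1 ^: 'Alt_('I_4).
Proof.
have [τ Jτ] : exists τ : {perm 'I_4}, cycle123 1 ^ τ = (cycle123 1)^-1.
  by eexists; apply: cycle123_tperm.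
exists (conjg^~ τ); split=> [x y _ _ /conjg_inj //||x y _ _]; last first.
  by rewrite /conj_op !conjMg conjVg.
have nA t : (t \in 'Alt_('I_4)) = (t ^ τ \in 'Alt_('I_4)).
  by rewrite !Alt_even odd_permJ.
apply/setP=> y; apply/imsetP/imsetP => -[t At ->].
  case/imsetP: At => u Au ->; exists (u ^ τ); rewrite -?nA //.
  by rewrite conjJg conjVg Jτ invgK.
exists ((cycle123 1)^-1 ^ (t ^ τ^-1)).
  by rewrite memJ_class // nA conjgKV.
by rewrite conjJg conjgKV conjVg Jτ invgK.
Qed.

Section RecSmall.
Variables (gT : finGroupType) (X : {set gT}).
Hypothesis clX : {in X &, forall x y, conj_op x y \in X}.
Hypothesis X3 : {in X, forall x, x ^+ 3 = 1}.
Hypothesis X1 : {in X, forall x, x != 1}.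
Hypothesis X0 : X != set0.

(** The image of [X] is stable under conjugation by the whole alternating group, so
   it is a union of its classes of elements of order three. *)
Lemma rec_Alt5 (f : gT -> {perm 'I_5}) : {in <<X>> &, {morph f : x y / x * y}} ->
  {in <<X>>, forall g, f g = 1 -> g = 1} -> #|<<X>>| = 60 ->
  X ~=r cycle123 2 ^: 'Alt_('I_5).
Proof.
move=> fM finj cX.
have cA : #|<<X>>%G| = #|'Alt_('I_5)|.
  have : (2 * #|'Alt_('I_5)| = 120)%N by rewrite card_Alt card_ord.
  by rewrite cX; lia.
suff -> : cycle123 2 ^: 'Alt_('I_5) = f @: X by apply: rack_iso_image fM finj.
have fX1 s : s \in f @: X -> s != 1.
  case/imsetP=> x Xx ->; apply: contra (X1 Xx) => /eqP/finj->//.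
  exact: mem_gen.
have sub s : s \in f @: X -> s \in cycle123 2 ^: 'Alt_('I_5).
  by move=> Xs; apply: ord3_Alt5 (fX1 s Xs); apply: rack_image_ord3 fM _ Xs.
apply/eqP; rewrite eqEsubset; apply/andP; split; last exact/subsetP.
have [x Xx] := set0Pn _ X0; have Xs := imset_f f Xx.
have /imsetP[t At es] := sub _ Xs.
rewrite -(class_eqP (_ : f x \in cycle123 2 ^: 'Alt_('I_5))) ?sub //.
exact: rack_image_class clX X3 fM finj cA _ Xs.
Qed.

Lemma rec_Alt4 (f : gT -> {perm 'I_4}) : {in <<X>> &, {morph f : x y / x * y}} ->
  {in <<X>>, forall g, f g = 1 -> g = 1} -> #|<<X>>| = 12 ->
  X ~=r cycle123 1 ^: 'Alt_('I_4) \/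
  X ~=r (cycle123 1 ^: 'Alt_('I_4)) :|: ((cycle123 1)^-1 ^: 'Alt_('I_4)).
Proof.
move=> fM finj cX.
have cA : #|<<X>>%G| = #|'Alt_('I_4)|.
  have : (2 * #|'Alt_('I_4)| = 24)%N by rewrite card_Alt card_ord.
  by rewrite cX; lia.
have iso := rack_iso_image fM finj.
have fX1 s : s \in f @: X -> s != 1.
  case/imsetP=> x Xx ->; apply: contra (X1 Xx) => /eqP/finj->//.
  exact: mem_gen.
have sub s : s \in f @: X ->
    s \in (cycle123 1 ^: 'Alt_('I_4)) :|: ((cycle123 1)^-1 ^: 'Alt_('I_4)).
  by move=> Xs; apply: ord3_Alt4 (fX1 s Xs); apply: rack_image_ord3 fM _ Xs.
have cls s a : s \in f @: X -> s \in a ^: 'Alt_('I_4) ->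
    a ^: 'Alt_('I_4) \subset f @: X.
  move=> Xs sa; rewrite -(class_eqP sa).
  exact: rack_image_class clX X3 fM finj cA _ Xs.
have [x Xx] := set0Pn _ X0; have Xs := imset_f f Xx.
have [n1|[s1 /setIP[X1s c1s]]] := set_0Vmem (f @: X :&: (cycle123 1 ^: 'Alt_('I_4))).
  left; apply: rack_iso_trans class_inv_iso; suff <- : f @: X = (cycle123 1)^-1 ^: 'Alt_('I_4) by [].
  have sub2 t : t \in f @: X -> t \in (cycle123 1)^-1 ^: 'Alt_('I_4).
    move=> Xt; have := sub t Xt; rewrite inE => /orP[c1t|//].
    by have := in_set0 t; rewrite -n1 inE Xt c1t.
  apply/eqP; rewrite eqEsubset; apply/andP; split; first exact/subsetP.
  exact: cls _ _ Xs (sub2 _ Xs).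
have [n2|[s2 /setIP[X2s c2s]]] := set_0Vmem (f @: X :&: ((cycle123 1)^-1 ^: 'Alt_('I_4))).
  left; suff <- : f @: X = cycle123 1 ^: 'Alt_('I_4) by [].
  apply/eqP; rewrite eqEsubset; apply/andP; split; last exact: cls _ _ X1s c1s.
  apply/subsetP=> t Xt; have := sub t Xt; rewrite inE => /orP[//|c2t].
  by have := in_set0 t; rewrite -n2 inE Xt c2t.
right; suff <- : f @: X = (cycle123 1 ^: 'Alt_('I_4)) :|: ((cycle123 1)^-1 ^: 'Alt_('I_4)) by [].
apply/eqP; rewrite eqEsubset; apply/andP; split; first exact/subsetP.
by rewrite subUset (cls _ _ X1s c1s) (cls _ _ X2s c2s).
Qed.
End RecSmall.

(** * Groups in which non-trivial elements fix one or two points *)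

Section Counting.
Variables (T : finType) (G : {group {perm T}}) (X : {set {perm T}}) (p : nat).
Hypotheses (defG : <<X>> = G) (p_pr : prime p) (p_neq3 : p != 3).
Hypothesis X3 : {in X, forall x, x ^+ 3 = 1}.
Hypothesis fix_gt0 : {in G, forall g, (0 < #|fixpts g|)%N}.
Hypothesis fix_le2 : {in G, forall g, g != 1 -> (#|fixpts g| <= 2)%N}.
Hypothesis unM : forall P, {in G &, forall g h, unip P g -> unip P h -> unip P (g * h)}.
Hypothesis un_exp : forall P, {in G, forall g, unip P g -> g ^+ p = 1}.
Hypothesis irrX : forall P, exists2 x : {perm T}, x \in X & x P != P.
Variable P0 : T.

Implicit Types (P R : T) (g h : {perm T}) (S : {set T}).

Definition stab P := 'C_G[P | 'P].
Definition unip_set P := [set g in G | unip P g].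
Definition orb P := orbit 'P G P.

Lemma stbP P g : reflect (g \in G /\ g P = P) (g \in stab P).
Proof.
rewrite inE; apply: (iffP andP) => -[Gg] H; split=> //.
  by move/astab1P: H.
by apply/astab1P.
Qed.

Fact uset_group_set P : group_set (unip_set P).
Proof.
apply/group_setP; split=> [|g h].
  by rewrite inE group1 /unip perm1 !eqxx.
by rewrite !inE => /andP[Gg ug] /andP[Gh uh]; rewrite groupM //= unM.
Qed.
Canonical uset_group P := Group (uset_group_set P).

Lemma uset_sub P : unip_set P \subset stab P.
Proof.
by apply/subsetP=> g; rewrite inE => /andP[Gg /andP[/eqP gP _]]; apply/stbP.
Qed.

Lemma un_fix P R g : unip P g -> g R = R -> R != P -> g = 1.
Proof.
case/andP=> _ /orP[/eqP //|/subsetP/(_ R)]; rewrite !inE => H gR.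
by rewrite H // gR.
Qed.

(** A non-trivial [g] either has two fixed points and belongs to no [unip_set P], or has
   one fixed point [P] and belongs to [unip_set P] only. *)
Lemma sum_fix_un g : g \in G^# -> (#|fixpts g| + #|[set P | unip P g]| = 2)%N.
Proof.
case/setD1P=> g1 Gg; have := fix_gt0 Gg; have := fix_le2 Gg g1.
case e: #|fixpts g| => [|[|[|]]] // _ _.
  have /eqP/cards1P[P fP] := e; rewrite (_ : [set _ | _] = [set P]) ?cards1 //.
  apply/setP=> R; rewrite !inE /unip (negPf g1) fP /=.
  apply/andP/eqP => [[+ _]|->]; last first.
    by have: P \in fixpts g; [rewrite fP set11 | rewrite inE => ->].
  by move=> gR; have: R \in fixpts g; [rewrite inE | rewrite fP inE => /eqP].
rewrite (_ : [set _ | _] = set0) ?cards0 //; apply/setP=> R.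
rewrite !inE /unip (negPf g1) /=; apply/negP=> /andP[_ /subset_leq_card].
by rewrite e cards1.
Qed.

Definition weight P := (#|stab P|.-1 + #|unip_set P|.-1)%N.

(** Double counting: by [sum_fix_un] each non-trivial element is counted twice. *)
Lemma weight_sum : (\sum_P weight P = 2 * (#|G| - 1))%N.
Proof.
have D1 (A : {group {perm T}}) : A \subset G ->
    #|A|.-1 = (\sum_(g in G^#) (g \in A))%N.
  move=> sAG; rewrite -big_mkcondr /= sum1dep_card (cardsD1 1) group1 /=.
  apply: eq_card => g; rewrite !inE andbAC; apply/esym/andb_idr.
  by case/andP=> _ /(subsetP sAG).
rewrite (eq_bigr (fun P => \sum_(g in G^#) ((g \in stab P) + (g \in unip_set P))))%N; last first.
  move=> P _; rewrite big_split /= -!D1 ?subsetIl //.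
  exact: subset_trans (uset_sub P) (subsetIl _ _).
rewrite exchange_big /= (eq_bigr (fun=> 2)); last first.
  move=> g G1g; rewrite -(sum_fix_un G1g) big_split /= -!big_mkcond !sum1dep_card.
  have /setD1P[_ Gg] := G1g.
  congr (_ + _)%N; apply: eq_card => P; rewrite [RHS]inE in_set.
    by apply/stbP/eqP => [[]|].
  by rewrite inE Gg.
by rewrite sum_nat_const mulnC (cardsD1 1 G) group1 addKn.
Qed.

Lemma stbJ P g : g \in G -> stab (g P) = stab P :^ g.
Proof.
move=> Gg; apply/setP=> h; rewrite mem_conjg.
have GJ : (h ^ g^-1 \in G) = (h \in G) by rewrite groupJr ?groupV.
have fJ : ((h ^ g^-1) P == P) = (h (g P) == g P).
  by rewrite conjgE invgK !permM -(inj_eq (@perm_inj _ g)) permKV.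
apply/stbP/stbP=> -[Gh /eqP hP]; split; try (by [rewrite GJ | rewrite -GJ]); apply/eqP.
  by rewrite fJ.
by rewrite -fJ.
Qed.

Lemma unJ P g h : unip (g P) h = unip P (h ^ g^-1).
Proof.
have fJ : fixpts (h ^ g^-1) = g @^-1: fixpts h.
  apply/setP=> R; rewrite !inE conjgE invgK !permM.
  by rewrite -(inj_eq (@perm_inj _ g)) permKV.
have eP : ((h ^ g^-1) P == P) = (h (g P) == g P).
  by rewrite conjgE invgK !permM -(inj_eq (@perm_inj _ g)) permKV.
rewrite /unip fJ eP; congr (_ && (_ || _)); first by rewrite conjg_eq1.
apply/subsetP/subsetP => H R; last first.
  have := H (g^-1 R); rewrite !inE permKV => {H}H /H /eqP <-.
  by rewrite permKV.
by rewrite !inE => hR; have := H (g R); rewrite !inE => /(_ hR)/eqP/perm_inj->.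
Qed.

Lemma usetJ P g : g \in G -> unip_set (g P) = unip_set P :^ g.
Proof.
by move=> Gg; apply/setP=> h; rewrite mem_conjg !inE groupJr ?groupV // unJ.
Qed.

Lemma orbP P R : reflect (exists2 g, g \in G & R = g P) (R \in orb P).
Proof. by apply: (iffP orbitP) => -[g Gg e]; exists g. Qed.

Lemma weight_orb P R : R \in orb P ->
  (#|stab R| = #|stab P|) * (#|unip_set R| = #|unip_set P|).
Proof. by case/orbP=> g Gg ->; rewrite stbJ ?usetJ ?cardJg. Qed.

Lemma orb_stb P : (#|orb P| * #|stab P| = #|G|)%N.
Proof. exact: card_orbit_stab. Qed.

Lemma orb_refl P : P \in orb P.
Proof. exact: orbit_refl. Qed.

Lemma orb_G P R g : g \in G -> (g R \in orb P) = (R \in orb P).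
Proof.
move=> Gg; apply/orbP/orbP => -[h Gh e]; last by exists (h * g); rewrite ?groupM // permM -e.
by exists (h * g^-1); rewrite ?groupM ?groupV // permM -e permK.
Qed.

Definition Gstable (S : {set T}) := {in G & S, forall g R, g R \in S}.

Lemma orb_sub S P : Gstable S -> P \in S -> orb P \subset S.
Proof. by move=> GS SP; apply/subsetP=> _ /orbP[g Gg ->]; apply: GS. Qed.

Lemma stable_orbD S P : Gstable S -> Gstable (S :\: orb P).
Proof.
by move=> GS g R Gg /setDP[SR nOR]; rewrite !inE orb_G // nOR GS.
Qed.

(** The weight is constant on orbits, so the sum splits off one orbit at a time. *)
Lemma weight_split_orbit S P : Gstable S -> P \in S ->
  (\sum_(R in S) weight R =
   #|orb P| * weight P + \sum_(R in S :\: orb P) weight R)%N.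
Proof.
move=> GS SP; rewrite (big_setID (orb P)) /= (setIidPr (orb_sub GS SP)).
congr (_ + _)%N; rewrite -sum_nat_const; apply: eq_bigr => R OR.
by rewrite /weight !(weight_orb OR).
Qed.

Lemma orb_ge3 P : (3 <= #|orb P|)%N.
Proof.
have [x Xx xP] := irrX P; have Gx : x \in G by rewrite -defG mem_gen.
have x3 := X3 Xx.
have x3P : x (x (x P)) = P.
  by rewrite -[RHS](perm1 P) -x3 !expgS expg0 mulg1 !permM.
have OxP : x P \in orb P by rewrite orb_G ?orb_refl.
have OxxP : x (x P) \in orb P by rewrite orb_G.
apply/card_gt2P; exists P, (x P), (x (x P)); rewrite orb_refl OxP OxxP.
split=> //; split; first by rewrite eq_sym.
  by rewrite (inj_eq perm_inj) eq_sym.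
by apply: contra xP => /eqP {1}<-; rewrite x3P.
Qed.

Definition special := [set P | stab P != 1].

Lemma special_stable : Gstable special.
Proof. by move=> g R Gg; rewrite !inE stbJ // conjsg_eq1. Qed.

Lemma special_gt1 P : P \in special -> (1 < #|stab P|)%N.
Proof. by rewrite inE trivg_card_le1 -ltnNge. Qed.

Lemma weight_special S : (\sum_(R in S) weight R = \sum_(R in S :&: special) weight R)%N.
Proof.
rewrite (big_setID special) /= -[RHS]addn0; congr (_ + _)%N.
apply: big1 => R; rewrite !inE negbK => /andP[/eqP s1 _].
have := uset_sub R; rewrite s1 => /subset_leq_card.
by rewrite /weight s1 cards1 /=; case: #|unip_set R| => [|[]].
Qed.

Lemma usetJ_free P R u : R != P -> u \in unip_set P -> u R = R -> u = 1.
Proof. by move=> nRP; rewrite inE => /andP[_ uu] uR; apply: un_fix uu uR nRP. Qed.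

(** [unip_set P] acts freely on the points of the orbit other than [P]. *)
Lemma orb_wild P : exists l, #|orb P| = (1 + l * #|unip_set P|)%N.
Proof.
have acts_U : [acts unip_set P, on orb P :\ P | 'P].
  apply/actsP=> u Uu R; rewrite !inE /= apermE.
  have [Gu uP] : u \in G /\ u P = P by apply/stbP/(subsetP (uset_sub P)).
  by rewrite orb_G // -{1}uP (inj_eq perm_inj).
have := acts_sum_card_orbit acts_U; rewrite (cardsD1 P (orb P)) orb_refl /= => <-.
exists #|orbit 'P (unip_set P) @: (orb P :\ P)|.
rewrite -sum_nat_const; congr (_ + _)%N; apply: eq_bigr => _ /imsetP[R /setD1P[nRP _] ->].
rewrite card_orbit (_ : 'C_(unip_set P)[R | 'P] = 1) ?indexg1 //.
apply/trivgP/subsetP=> u /setIP[Uu /astab1P uR]; rewrite inE.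
by rewrite (usetJ_free nRP Uu uR).
Qed.

(** The stabilizer acts by conjugation on the non-trivial elements of [unip_set P], and
   the centralizer of such an element is contained in [unip_set P]. *)
Lemma stb_wild P : unip_set P != 1 -> exists2 m,
  #|stab P| = (#|unip_set P| * m)%N & (0 < m <= #|unip_set P|.-1)%N.
Proof.
move=> U1; exists #|stab P : unip_set P|; first by rewrite Lagrange ?uset_sub.
rewrite indexg_gt0 /=.
have [u Uu u1] := trivgPn _ U1.
have sU : u ^: stab P \subset (unip_set P)^#.
  apply/subsetP=> _ /imsetP[g /stbP[Gg gP] ->].
  rewrite !inE conjg_eq1 u1 groupJr //.
  move: Uu; rewrite inE => /andP[Gu uu]; rewrite Gu /= -{1}gP unJ -conjgM mulgV conjg1 //.
have -> : #|unip_set P|.-1 = #|(unip_set P)^#|.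
  by rewrite (cardsD1 1 (unip_set P)) group1.
apply: leq_trans (subset_leq_card sU); rewrite -index_cent1.
rewrite -(leq_pmul2l (cardG_gt0 (uset_group P))) Lagrange ?uset_sub //.
rewrite -(Lagrange (subsetIl (stab P) 'C[u])) leq_pmul2r ?indexg_gt0 //.
(* an element commuting with [u] fixes a second point only if it is trivial *)
apply/subset_leq_card/subsetP=> g /setIP[/stbP[Gg gP] /cent1P cgu].
rewrite inE Gg /unip gP eqxx /=; have [//|g1 /=] := eqVneq g 1.
apply/subsetP=> R; rewrite !inE => /eqP gR; apply: contraT => nRP.
have uP : u P = P by have /stbP[] := subsetP (uset_sub P) u Uu.
have guR : g (u R) = u R by rewrite -permM -cgu permM gR.
have nuR : u R != R by apply: contraNneq u1 => /(usetJ_free nRP Uu)->.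
have nuP : u R != P by rewrite -{1}uP (inj_eq perm_inj).
have : (2 < #|fixpts g|)%N.
  apply/card_gt2P; exists P, R, (u R); rewrite !inE gP gR guR !eqxx.
  by split=> //; rewrite eq_sym nRP eq_sym nuR nuP.
by rewrite ltnNge fix_le2.
Qed.

(** [unip_set P] has exponent dividing [p], which is not three. *)
Lemma uset_n3 P : #|unip_set P| != 3%N.
Proof.
apply/eqP=> U3; have /trivgPn[u Uu u1] : unip_set P != 1.
  by rewrite trivg_card1 U3.
case/eqP: u1; have ou3 : u ^+ 3 = 1 by rewrite -U3 expg_cardG.
have oup : u ^+ p = 1 by move: Uu; rewrite inE => /andP[/un_exp H /H].
apply/eqP; rewrite -order_eq1 -dvdn1 -(_ : gcdn 3 p = 1%N).
  by rewrite dvdn_gcd !order_dvdn ou3 oup !eqxx.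
by apply/eqP; rewrite -/(coprime _ _) prime_coprime // dvdn_prime2 // eq_sym.
Qed.

(** Every further orbit with non-trivial stabilizers contributes at least [#|G| / 2]
   to the sum, so that few such orbits fit in [2 * (#|G| - 1)]. *)
Lemma sum_special S : Gstable S ->
  (\sum_(R in S) weight R = 0 /\ S :&: special = set0)%N \/
  (exists2 P, P \in S & P \in special) /\ (#|G| <= 2 * \sum_(R in S) weight R)%N.
Proof.
move=> GS; rewrite weight_special.
have [->|[P SsP]] := set_0Vmem (S :&: special).
  by left; rewrite big_set0.
have /setIP[SP sP] := SsP.
have GS' : Gstable (S :&: special).
  by move=> g R Gg /setIP[SR sR]; rewrite inE GS // special_stable.
right; split; first by exists P.
rewrite (weight_split_orbit GS' SsP) -(orb_stb P) mulnDr mulnCA.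
apply: leq_trans (leq_addr _ _); rewrite leq_mul2l; apply/orP; right.
by have := special_gt1 sP; rewrite /weight; lia.
Qed.

Theorem wild_or_tame :
  (exists P, [/\ #|orb P| = #|unip_set P|.+1, (4 <= #|unip_set P|)%N &
                 #|unip_set P| * (#|unip_set P|.-1) <= 2 * #|stab P|]%N)
  \/ (forall P, unip_set P = 1) /\
     exists (P1 P2 P3 : T) (e : nat),
     [/\ #|stab P1| = 3, #|stab P2| = 2, #|stab P3| = e,
         (e, #|G|) \in [:: (3, 12); (4, 24); (5, 60)]%N &
         special \subset orb P1 :|: orb P2 :|: orb P3].
Proof.
have GsT : Gstable [set: T] by move=> *; rewrite inE.
have s1 : (\sum_(R in [set: T]) weight R = 2 * (#|G| - 1))%N.
  by rewrite -weight_sum; apply: eq_bigl => R; rewrite inE.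
have [/exists_inP[P _ Uneq1]|/exists_inPn Ueq1] := boolP [exists P in T, unip_set P != 1].
  left; exists P; have [l kl] := orb_wild P; have [m em bm] := stb_wild Uneq1.
  have k3 := orb_ge3 P.
  have Q2 : (2 <= #|unip_set P|)%N by rewrite ltnNge -trivg_card_le1.
  rewrite (weight_split_orbit GsT (in_setT P)) in s1.
  have GsP := stable_orbD (P := P) GsT.
  have dg := orb_stb P; rewrite em in dg.
  have [[r0 _]|[[P2 sP2 /special_gt1 e22] _]] := sum_special GsP.
    have Qm0 : (0 < #|unip_set P| * m)%N by rewrite -em cardG_gt0.
    have := orbit_weight #|orb P| Qm0 (ltnW Q2); move: s1; rewrite r0 /weight em dg.
    have : (#|orb P| * #|unip_set P| <= #|orb P| * (#|unip_set P| * m))%N.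
      by rewrite leq_mul2l leq_pmulr ?orbT; case/andP: bm.
    by rewrite dg; lia.
  rewrite (weight_split_orbit GsP sP2) /weight em in s1.
  have rest : forall S, Gstable S -> let r := (\sum_(R in S) weight R)%N in (r = 0 \/ #|G| <= 2 * r)%N.
    by move=> S /sum_special[[-> _]|[_ ?]]; [left | right].
  have [e1 Q4 Qm] := wild_arith (esym dg) kl k3 Q2 (uset_n3 P) bm (orb_stb P2) e22
    (cardG_gt0 (uset_group P2)) (orb_ge3 P2) s1 (rest _ (stable_orbD GsP)).
  split=> //; rewrite em mulnCA leq_mul2l; apply/orP; right; exact: Qm.
have {}Ueq1 P : unip_set P = 1.
  by apply/eqP; rewrite -[_ == _]negbK; apply/negP; apply/negP; apply: Ueq1.
right; split=> //.
have wE P : weight P = #|stab P|.-1 by rewrite /weight Ueq1 cards1 addn0.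
have [x Xx xP0] := irrX P0.
have Gx : x \in G by rewrite -defG mem_gen.
have /card_gt0P[P1] := fix_gt0 Gx; rewrite inE => /eqP xP1.
have e1_3 : (3 %| #|stab P1|)%N.
  rewrite -(_ : #[x] = 3); first by apply: order_dvdG; apply/stbP.
  apply: nt_prime_order => //; first exact: X3.
  by apply: contraNneq xP0 => ->; rewrite perm1.
rewrite (weight_split_orbit GsT (in_setT P1)) wE in s1.
have Gs1 := stable_orbD (P := P1) GsT; have d1 := orb_stb P1.
have o1 := orbit_weight1 #|orb P1| (cardG_gt0 (stab P1)); rewrite d1 in o1.
have kP P : (0 < #|orb P|)%N by apply: leq_trans (orb_ge3 P).
have [[r0 _]|[[P2 sP2 /special_gt1 e22] _]] := sum_special Gs1.
  by move: s1 (kP P1); rewrite r0; have := orb_ge3 P1; have := cardG_gt0 G; lia.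
rewrite (weight_split_orbit Gs1 sP2) wE in s1.
have Gs2 := stable_orbD (P := P2) Gs1; have d2 := orb_stb P2.
have o2 := orbit_weight1 #|orb P2| (cardG_gt0 (stab P2)); rewrite d2 in o2.
have [[r0 _]|[[P3 sP3 /special_gt1 e32] _]] := sum_special Gs2.
  by move: s1; rewrite r0; have := orb_ge3 P1; have := orb_ge3 P2; lia.
rewrite (weight_split_orbit Gs2 sP3) wE in s1.
have Gs3 := stable_orbD (P := P3) Gs2; have d3 := orb_stb P3.
have := sum_special Gs3.
have := @tame_arith _ _ _ _ _ _ _ _ d1 d2 d3 e1_3 (cardG_gt0 _) e22 e32
  (orb_ge3 P1) (orb_ge3 P2) (orb_ge3 P3) s1.
set rest := (\sum_(R in _) _)%N => arith r0.
have [|rest0 e13 e23] := arith.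
  by case: r0 => [[-> _]|[_ ?]]; [left | right].
have sub : special \subset orb P1 :|: orb P2 :|: orb P3.
  case: r0 => [[_ /setP sub]|[_]]; last by rewrite rest0 leqNgt cardG_gt0.
  apply/subsetP=> R sR; have := sub R.
  by rewrite !inE (_ : _ != 1); [rewrite !andbT; case: (R \in orb P1) (R \in orb P2) (R \in orb P3) => [] [] [] | move: sR; rewrite inE].
have [e1E d1E] : #|stab P1| = 3 /\ (#|orb P1| * 3 = #|G|)%N by rewrite -e13.
move: s1; rewrite -/rest rest0 e13 addn0 => s1.
case: e23 => -[e2 e3].
  exists P1, P2, P3, #|stab P3|; split=> //.
  have d2E : (#|orb P2| * 2 = #|G|)%N by rewrite -e2.
  by apply: (tame_order (cardG_gt0 G) d1E d2E d3 e3); rewrite e2 in s1.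
exists P1, P3, P2, #|stab P2|; split=> //; last by rewrite setUAC.
have d3E : (#|orb P3| * 2 = #|G|)%N by rewrite -e2.
apply: (tame_order (cardG_gt0 G) d1E d3E d2 e3).
by rewrite e2 in s1; rewrite (addnC (#|orb P3| * 1)%N).
Qed.

Hypothesis clX : {in X &, forall x y, conj_op x y \in X}.
Hypothesis un_comm : forall P, {in G &, forall g h : {perm T},
  g P = P -> h P = P -> unip P [~ g, h]}.
Hypothesis tame : forall P, unip_set P = 1.

Lemma un_tame P g : g \in G -> unip P g -> g = 1.
Proof.
by move=> Gg ug; apply/set1P; rewrite -[[set 1]]/(1 : {set _}) -(tame P) inE Gg.
Qed.

Lemma fix_eq2 g : g \in G -> g != 1 -> #|fixpts g| = 2.
Proof.
move=> Gg g1; have := sum_fix_un (_ : g \in G^#); rewrite !inE Gg g1 => /(_ isT).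
rewrite (_ : [set P | _] = set0) ?cards0 ?addn0 //.
apply/setP=> P; rewrite !inE; apply/negP=> /(un_tame Gg) ge.
by rewrite ge eqxx in g1.
Qed.

(** If all [unip_set P] are trivial then commutators of [stab R] are trivial, hence its
   elements permute the two fixed points of each other: they share both. *)
Lemma partner R : R \in special ->
  exists2 R', R' != R & {in stab R, forall g, g != 1 -> fixpts g = [set R; R']}.
Proof.
rewrite inE => /trivgPn[g0 /stbP[Gg0 g0R] g01].
have f2 := fix_eq2 Gg0 g01.
have [R' nR' fg0] : exists2 R', R' != R & fixpts g0 = [set R; R'].
  have /cards2P[a [b [nab fab]]] : #|fixpts g0| == 2 by rewrite f2.
  have : R \in fixpts g0 by rewrite inE g0R.
  rewrite fab !inE => /orP[]/eqP->; first by exists b; rewrite // eq_sym.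
  by exists a => //; rewrite setUC.
exists R' => // g /stbP[Gg gR] g1; apply/esym/eqP.
rewrite eqEcard fix_eq2 // cards2 eq_sym nR' andbT.
have cgg : g0 * g = g * g0.
  apply/commgP/eqP; apply: (@un_tame R); last exact: un_comm.
  by rewrite groupR.
apply/subsetP=> Q; rewrite !inE => /orP[]/eqP->; first by rewrite gR.
have : g R' \in fixpts g0.
  have : R' \in fixpts g0 by rewrite fg0 !inE eqxx orbT.
  by rewrite !inE -!permM -cgg permM => /eqP->.
rewrite fg0 !inE => /orP[]// /eqP e; case/eqP: nR'; apply: (@perm_inj _ g).
by rewrite e gR.
Qed.

Lemma X_neq0 : X != set0.
Proof. by have [x Xx _] := irrX P0; apply/set0Pn; exists x. Qed.

Hypothesis X_neq1 : {in X, forall x, x != 1}.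

Lemma card_fib (A B : finType) (h : A -> B) (D : {set A}) k :
  (forall a, a \in D -> #|[set b in D | h b == h a]| = k) ->
  #|D| = (k * #|h @: D|)%N.
Proof.
move=> hk; rewrite -sum1_card (partition_big_imset h) /= mulnC -sum_nat_const.
apply: eq_bigr => _ /imsetP[a Da ->]; rewrite -(hk a Da) -sum1_card.
by apply: eq_bigl => b; rewrite inE.
Qed.

(** The action on the orbit of [P1], which has four points, is faithful because
   non-trivial elements fix at most two points. *)
Lemma tetrahedral P1 : #|stab P1| = 3 -> #|G| = 12 ->
  X ~=r cycle123 1 ^: 'Alt_('I_4) \/
  X ~=r (cycle123 1 ^: 'Alt_('I_4)) :|: ((cycle123 1)^-1 ^: 'Alt_('I_4)).
Proof.
move=> e1 g12; have k4 : #|orb P1| = 4.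
  by have := orb_stb P1; rewrite e1 g12; lia.
have [f [h [inj_h hS hP fE]]] := @act_Sn _ _ _ _ _ _ (acts_orbit 'P P1 (subsetT G)) k4.
have fM : {in <<X>> &, {morph f : x y / x * y}}.
  rewrite defG => x y Gx Gy /=; apply/permP=> i; apply: inj_h.
  by rewrite permM !fE ?groupM // actM.
apply: rec_Alt4 clX X3 X_neq1 X_neq0 _ fM _ _; last by rewrite defG.
rewrite defG => g Gg fg1; apply: contraTeq isT => /(fix_le2 Gg).
rewrite leqNgt; case/negP; apply: leq_trans (_ : #|orb P1| <= _)%N; first by rewrite k4.
apply/subset_leq_card/subsetP=> Q /hP[i ->]; rewrite inE.
by rewrite -[g _]/('P%act (h i) g) -fE // fg1 perm1.
Qed.

(** The six points with stabilizers of order four fall into three pairs with a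
   common stabilizer (the axes of the octahedron). Elements of order three
   generate [G], so [G] permutes the three pairs evenly, and [stab P3] fixes each
   pair. Its three non-trivial elements then all exchange the points [Q], [Q'] of
   another pair, so that the quotient of two of them has too many fixed points. *)
Lemma not_octahedral P1 P2 P3 : #|stab P1| = 3 -> #|stab P2| = 2 -> #|stab P3| = 4 ->
  #|G| = 24 -> special \subset orb P1 :|: orb P2 :|: orb P3 -> False.
Proof.
move=> e1 e2 e3 g24 sub.
have k6 : #|orb P3| = 6 by have := orb_stb P3; rewrite e3 g24; lia.
have sp3 Q : Q \in orb P3 -> Q \in special.
  by move=> OQ; rewrite inE trivg_card1 (weight_orb OQ) e3.
(* the pair of points fixed by the stabilizer of [Q] *)
pose ax Q := [set R | stab Q \subset stab R].
have axP Q : Q \in orb P3 -> exists2 Q', Q' != Q &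
    [/\ Q' \in orb P3, ax Q = [set Q; Q'], stab Q' = stab Q &
     {in stab Q, forall g, g != 1 -> fixpts g = [set Q; Q']}].
  move=> OQ; have [Q' nQ' fQ] := partner (sp3 Q OQ); exists Q' => //.
  have cQ : #|stab Q| = 4 by rewrite (weight_orb OQ).
  have /trivgPn[g0 sg0 g01] : stab Q != 1 by rewrite trivg_card1 cQ.
  have sQ' : stab Q \subset stab Q'.
    apply/subsetP=> g sg; have [Gg gQ] := stbP _ _ sg.
    apply/stbP; split=> //; have [->|g1] := eqVneq g 1; first by rewrite perm1.
    have : Q' \in fixpts g by rewrite fQ // !inE eqxx orbT.
    by rewrite inE => /eqP.
  have OQ' : Q' \in orb P3.
    have : Q' \in special.
      rewrite inE; apply/trivgPn; exists g0 => //; exact: subsetP sg0.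
    have := subset_leq_card sQ'; rewrite cQ => le4.
    move/(subsetP sub); rewrite !inE => /orP[/orP[]|] // O; move: le4.
      by rewrite (weight_orb O) e1.
    by rewrite (weight_orb O) e2.
  have eQ : stab Q' = stab Q.
    by apply/esym/eqP; rewrite eqEcard sQ' (weight_orb OQ') cQ e3.
  split=> //; apply/setP=> R; rewrite !inE; apply/idP/orP=> [sR|].
    have /stbP[_ /eqP] := subsetP sR _ sg0.
    by move=> gR; have : R \in fixpts g0; [rewrite inE | rewrite fQ // !inE => /orP].
  by case=> /eqP->; rewrite ?eQ.
have axG Q g : g \in G -> ax (g Q) = 'P^*%act (ax Q) g.
  move=> Gg; apply/setP=> R; rewrite /= /setact.
  apply/idP/imsetP=> [|[R0]]; rewrite !inE; last first.
    by move=> sR ->; rewrite /= /aperm !stbJ // conjSg.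
  move=> sR; exists (g^-1 R); last by rewrite /= /aperm permKV.
  by rewrite inE stbJ ?groupV // -sub_conjg -stbJ.
have k3 : #|ax @: orb P3| = 3.
  suff: (6 = 2 * #|ax @: orb P3|)%N by lia.
  rewrite -k6; apply: card_fib => Q OQ; have [Q' nQ' [OQ' axQ eQ fQ]] := axP Q OQ.
  rewrite (_ : [set _ in _ | _] = [set Q; Q']) ?cards2 1?eq_sym ?nQ' //.
  apply/setP=> R; rewrite [LHS]inE -axQ; apply/andP/idP=> [[OR /eqP <-]|].
    by rewrite inE.
  move=> RQ; have := RQ; rewrite axQ in_set2 => /orP[]/eqP->; first by split=> //; rewrite axQ.
  by split=> //; rewrite /ax eQ -axQ.
have actA : [acts G, on ax @: orb P3 | 'P^*].
  apply/actsP=> g Gg A; apply/imsetP/imsetP=> -[Q OQ].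
    move=> e; exists (g^-1 Q); first by rewrite orb_G ?groupV.
    by rewrite axG ?groupV // -e actK.
  by move=> ->; exists (g Q); [rewrite orb_G | rewrite axG].
have [f [h [inj_h hS hP fE]]] := @act_Sn _ _ _ _ _ _ actA k3.
have fM : {in <<X>> &, {morph f : x y / x * y}}.
  rewrite defG => x y Gx Gy /=; apply/permP=> i; apply: inj_h.
  by rewrite permM !fE ?groupM // actM.
have f3 g : g \in G -> f g ^+ 3 = 1.
  move=> Gg; have cA : #|'Alt_('I_3)| = 3.
    have : (2 * #|'Alt_('I_3)| = 6)%N by rewrite card_Alt card_ord.
    by lia.
  have fA : f g \in 'Alt_('I_3).
    by apply: (subsetP (rack_image_Alt X3 fM)); rewrite /= defG imset_f.
  by have := expg_cardG fA; rewrite cA.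
(* the elements of the stabilizer of [P3] fix all three pairs *)
have f4 g : g \in stab P3 -> f g = 1.
  move=> sg; have Gg : g \in G by case/stbP: sg.
  pose fm := Morphism fM.
  have Xg : g \in <<X>> by rewrite defG.
  have f4 : f g ^+ 4 = 1.
    by rewrite -[f g]/(fm g) -morphX // -e3 expg_cardG // morph1.
  by move: f4; rewrite expgS f3 // mulg1.
have O3 := orb_refl P3; have [P3' nP3' [OP3' ax3 eP3 fP3]] := axP P3 O3.
have [Q OQ nQ] : exists2 Q, Q \in orb P3 & Q \notin ax P3.
  apply/subsetPn; apply: contraL isT => /subset_leq_card.
  by rewrite ax3 cards2 k6 eq_sym nP3'.
have [Q' nQ' [OQ' axQ eQ fQ]] := axP Q OQ.
have gQ g : g \in (stab P3)^# -> g Q = Q'.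
  case/setD1P=> g1 sg; have [Gg gP3] := stbP _ _ sg.
  have [i axi] := hP (ax Q) (imset_f _ OQ).
  have : ax (g Q) = ax Q by rewrite axG // axi -fE // f4 // perm1.
  have : g Q \in ax (g Q) by rewrite inE.
  move=> + e; rewrite e axQ !inE => /orP[/eqP gQ|/eqP //].
  have : Q \in fixpts g by rewrite inE gQ.
  by rewrite fP3 // -ax3 (negPf nQ).
have /card_gt1P[s [t [ss tt nst]]] : (1 < #|(stab P3)^#|)%N.
  by move: e3; rewrite (cardsD1 1) group1 => -[]; rewrite add0n => ->.
case/negP: nst; rewrite eq_mulgV1; apply: contraT => st1.
have sst : s * t^-1 \in stab P3.
  by rewrite groupM ?groupV //; [case/setD1P: ss | case/setD1P: tt].
have : Q \in fixpts (s * t^-1).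
  by rewrite inE permM gQ // -(gQ t) // permK.
by rewrite fP3 // -ax3 (negPf nQ).
Qed.

(** The 15 involutions have centralizers of order four, and an involution in such a
   centralizer has the same centralizer. So there are five of these Klein
   four-groups, on which [G] acts by conjugation. The rest of the proof shows that
   this action is faithful. An element of order three in the kernel would put all
   of [X], hence [G], in the kernel, while the involutions are conjugate. *)
Lemma icosahedral P1 P2 P3 : #|stab P1| = 3 -> #|stab P2| = 2 -> #|stab P3| = 5 ->
  #|G| = 60 -> special \subset orb P1 :|: orb P2 :|: orb P3 ->
  X ~=r cycle123 2 ^: 'Alt_('I_5).
Proof.
move=> e1 e2 e3 g60 sub.
have stb_special g P : g \in G -> g != 1 -> g P = P -> P \in special.
  by move=> Gg g1 gP; rewrite inE; apply/trivgPn; exists g => //; apply/stbP.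
have special_cases P : P \in special -> [\/ P \in orb P1, P \in orb P2 | P \in orb P3].
  by move/(subsetP sub); rewrite !inE => /orP[/orP[]|]; [constructor 1|constructor 2|constructor 3].
have ord g : g \in G -> g != 1 -> [\/ #[g] = 2, #[g] = 3 | #[g] = 5].
  move=> Gg g1; have /card_gt0P[P] := fix_gt0 Gg; rewrite inE => /eqP gP.
  have dvd : #[g] %| #|stab P| by apply: order_dvdG; apply/stbP.
  have o1 : #[g] != 1%N by rewrite order_eq1.
  have dp r : prime r -> #[g] %| r -> #[g] = r.
    by move=> pr /(primeP pr).2/orP[|/eqP //]; rewrite (negPf o1).
  case: (special_cases P (stb_special g P Gg g1 gP)) => O;
    move: dvd; rewrite (weight_orb O) ?e1 ?e2 ?e3.
  - by move/(dp 3 isT); constructor 2.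
  - by move/(dp 2 isT); constructor 1.
  - by move/(dp 5 isT); constructor 3.
pose I := [set s in G | #[s] == 2].
have IP s : s \in I -> [/\ s \in G, #[s] = 2 & s != 1].
  rewrite inE => /andP[Gs /eqP os]; split=> //.
  by rewrite -order_eq1 os.
have Ifix s P : s \in I -> s P = P -> P \in orb P2 /\ stab P = [set 1; s].
  move=> Is sP; have [Gs os s1] := IP s Is.
  have ss : s \in stab P by apply/stbP.
  have dvd : 2 %| #|stab P| by rewrite -os; apply: order_dvdG.
  have O : P \in orb P2.
    case: (special_cases P (stb_special s P Gs s1 sP)) => // O; move: dvd;
      by rewrite (weight_orb O) ?e1 ?e3.
  split=> //; apply/esym/eqP; rewrite eqEcard (weight_orb O) e2 cards2 eq_sym s1 andbT.
  by apply/subsetP=> t; rewrite in_set2 => /orP[]/eqP->; rewrite ?group1.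
have Istb P : P \in orb P2 -> exists2 s, s \in I & s P = P.
  move=> O; have := (weight_orb O).1; rewrite e2 => sP2.
  have d2 : 2 %| #|stab P| by rewrite sP2.
  have [s ss os] := Cauchy (isT : prime 2) d2.
  by have [Gs sP] := stbP _ _ ss; exists s => //; rewrite inE Gs os.
have k2 : #|orb P2| = 30 by have := orb_stb P2; rewrite e2 g60; lia.
have Iconj s t : s \in I -> t \in I -> exists2 g, g \in G & t = s ^ g.
  move=> Is It; have [Gs os s1] := IP s Is; have [Gt ot t1] := IP t It.
  have /card_gt0P[P] := fix_gt0 Gs; rewrite inE => /eqP sP.
  have /card_gt0P[R] := fix_gt0 Gt; rewrite inE => /eqP tR.
  have [OP eP] := Ifix s P Is sP; have [OR eR] := Ifix t R It tR.
  have [g Gg eg] : exists2 g, g \in G & R = g P.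
    have /orbP[a Ga ea] := OP; have /orbP[b Gb eb] := OR.
    by exists (a^-1 * b); rewrite ?groupM ?groupV // permM ea permK.
  exists g => //; have : t \in stab R by rewrite eR !inE eqxx orbT.
  rewrite eg stbJ // mem_conjg eP !inE => /orP[]/eqP e.
    by case/eqP: t1; apply/eqP; rewrite -(conjg_eq1 t g^-1) e.
  by rewrite -e conjgKV.
have cI : #|I| = 15.
  pose σ P := odflt 1 [pick s in I | s P == P].
  have σP P : P \in orb P2 -> σ P \in I /\ σ P P = P.
    move=> /Istb[s Is sP]; rewrite /σ; case: pickP => [t /andP[It /eqP]|/(_ s)] //.
    by rewrite Is sP eqxx.
  have -> : I = σ @: orb P2.
    apply/setP=> s; apply/idP/imsetP=> [Is|[P OP ->]]; last by have [] := σP P OP.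
    have [Gs os s1] := IP s Is.
    have /card_gt0P[P] := fix_gt0 Gs; rewrite inE => /eqP sP.
    have [OP eP] := Ifix s P Is sP; exists P => //.
    have [It tP] := σP P OP; have [Gt _ t1] := IP _ It.
    have : σ P \in stab P by apply/stbP.
    by rewrite eP !inE (negPf t1) /= => /eqP.
  apply/eqP; rewrite -(eqn_pmul2l (isT : 0 < 2)%N); apply/eqP/esym.
  rewrite -[(2 * 15)%N]/30 -k2; apply: card_fib => P OP; have [It tP] := σP P OP.
  have [Gt _ t1] := IP _ It; rewrite -(fix_eq2 Gt t1).
  apply: eq_card => R; rewrite !inE; apply/andP/eqP => [[OR /eqP <-]|tR].
    by have [] := σP R OR.
  have [OR eR] := Ifix _ R It tR; split=> //.
  have [Is sR] := σP R OR; have [Gs _ s1] := IP _ Is.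
  have : σ R \in stab R by apply/stbP.
  by rewrite eR !inE (negPf s1).
have Icent s : s \in I -> #|'C_G[s]| = 4.
  move=> Is; have [Gs _ _] := IP s Is.
  have : s ^: G = I.
    apply/setP=> t; apply/imsetP/idP=> [[g Gg ->]|/(Iconj s t Is)[g Gg ->]]; last by exists g.
    by move: Is; rewrite !inE orderJ => /andP[_ ->]; rewrite groupJ.
  move/(congr1 (fun A : {set _} => #|A|)); rewrite cI -index_cent1 => idx.
  apply/eqP; rewrite -(eqn_pmul2r (isT : 0 < 15)%N) -[X in _ == X]/60 -g60 -idx.
  by rewrite (Lagrange (subsetIl G 'C[s])).
pose V s := 'C_G[s].
have Vinv s t : s \in I -> t \in V s -> t != 1 -> t \in I /\ V t = V s.
  move=> Is Vt t1; have [Gt _] := setIP Vt.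
  have ot : #[t] = 2.
    have : #[t] %| 4 by rewrite -(Icent s Is); apply: order_dvdG.
    by case: (ord t Gt t1) => ->.
  have It : t \in I by rewrite inE Gt ot.
  split=> //; apply/esym/eqP; rewrite eqEcard !Icent // leqnn andbT.
  have abV : abelian (V s).
    by apply: (@card_p2group_abelian _ 2) => //; exact: Icent Is.
  apply/subsetP=> u Vu; rewrite inE; have [Gu _] := setIP Vu; rewrite Gu.
  by apply/cent1P; apply: (centsP abV).
have VI s : s \in I -> s \in V s.
  by move=> Is; have [Gs _ _] := IP s Is; rewrite inE Gs cent1id.
have cV : #|V @: I| = 5.
  apply/eqP; rewrite -(eqn_pmul2l (isT : 0 < 3)%N); apply/eqP/esym.
  rewrite -[(3 * 5)%N]/15 -cI; apply: card_fib => s Is.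
  have : #|V s| = 4 by apply: Icent.
  rewrite (cardsD1 1) group1 => -[]; rewrite add0n => <-.
  apply: eq_card => t; rewrite in_setD1 in_set.
  apply/andP/andP=> [[It /eqP eV]|[t1 Vt]].
    by have [_ _ t1] := IP t It; split=> //; rewrite -eV VI.
  by have [It ->] := Vinv s t Is Vt t1.
have VJ s g : g \in G -> V (s ^ g) = V s :^ g.
  by move=> Gg; rewrite /V conjIg conjGid // cent1J.
have IJ s g : s \in I -> g \in G -> s ^ g \in I.
  by rewrite !inE orderJ => /andP[Gs ->] Gg; rewrite groupJ.
have actV : [acts G, on V @: I | 'Js].
  apply/actsP=> g Gg A; apply/imsetP/imsetP=> -[s Is].
    move=> e; exists (s ^ g^-1); first by rewrite IJ ?groupV.
    by rewrite VJ ?groupV // -e /= conjsgK.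
  by move=> ->; exists (s ^ g); [rewrite IJ | rewrite VJ].
have [f [h [inj_h hS hP fE]]] := @act_Sn _ _ _ _ _ _ actV cV.
have fM : {in <<X>> &, {morph f : x y / x * y}}.
  rewrite defG => x y Gx Gy /=; apply/permP=> i; apply: inj_h.
  by rewrite permM !fE ?groupM // actM.
apply: rec_Alt5 clX X3 X_neq1 X_neq0 _ fM _ _; last by rewrite defG.
rewrite defG => g Gg fg1.
have nV s : s \in I -> V s :^ g = V s.
  move=> Is; have [i ei] := hP (V s) (imset_f _ Is).
  by rewrite ei -[_ :^ _]/('Js%act (h i) g) -fE // fg1 perm1.
apply: contraTeq isT => g1.
have [s Is] : exists s, s \in I by apply/card_gt0P; rewrite cI.
have [t It nVt] : exists2 t, t \in I & V t != V s.
  have : ~~ (V @: I \subset [set V s]).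
    by apply: contraL isT => /subset_leq_card; rewrite cV cards1.
  by case/subsetPn=> _ /imsetP[t It ->]; rewrite inE => ?; exists t.
(* an element of order 2 or 5 fixing all five groups centralizes a
   non-trivial element of each *)
have cent r : prime r -> r != 3 -> #[g] = r -> g \in V s /\ g \in V t.
  move=> pr rn3 og; suff aux u : u \in I -> g \in V u by split; apply: aux.
  move=> Iu; have actg : [acts <[g]>, on (V u)^# | 'J].
    by rewrite astabsJ normD1 cycle_subG inE nV.
  have pg : r.-group <[g]> by rewrite /pgroup -orderE og pnat_id.
  have c3 : #|(V u)^#| = 3.
    have := Icent u Iu; rewrite -/(V u) (cardsD1 1) group1 => -[].
    by rewrite add0n.
  have := pgroup_fix_mod pg actg; rewrite c3 afixJ.
  have [->|[v]] := set_0Vmem ((V u)^# :&: 'C(<[g]>)).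
    rewrite cards0 mod0n => /eqP; rewrite -/(_ %| _) dvdn_prime2 //.
    by rewrite (negPf rn3).
  rewrite cent_cycle => /setIP[/setD1P[v1 Vv] cgv] _.
  have [_ <-] := Vinv u v Iu Vv v1.
  by rewrite inE Gg cent1C.
have Vg s' : s' \in I -> g \in V s' -> #[g] = 2 /\ V g = V s'.
  move=> Is' Vg; have [Ig eg] := Vinv s' g Is' Vg g1.
  by have [_ og _] := IP g Ig.
case: (ord g Gg g1) => og.
- have [gs gt] := cent 2 isT isT og.
  by case/eqP: nVt; have [_ <-] := Vg s Is gs; have [_ <-] := Vg t It gt.
- pose K := 'C_G(V @: I | 'Js).
  have KP k : reflect (k \in G /\ {in I, forall u, V u :^ k = V u}) (k \in K).
    rewrite inE; apply: (iffP andP) => -[Gk].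
      by move/astabP=> H; split=> // u Iu; apply: H; apply: imset_f.
    by move=> H; split=> //; apply/astabP=> _ /imsetP[u Iu ->]; apply: H.
  have KJ k a : k \in K -> a \in G -> k ^ a \in K.
    move=> /KP[Gk H] Ga; apply/KP; split=> [|u Iu]; first exact: groupJ.
    rewrite conjgE !conjsgM -VJ ?groupV // H ?IJ ?groupV //.
    by rewrite -VJ // conjgKV.
  have Kg : g \in K by apply/KP.
  have orb3 k R : k \in G -> k != 1 -> #[k] = 3 -> k R = R -> R \in orb P1 /\ stab R = <[k]>.
    move=> Gk k1 ok kR; have sk : k \in stab R by apply/stbP.
    have dvd : 3 %| #|stab R| by rewrite -ok; apply: order_dvdG.
    have O : R \in orb P1.
      case: (special_cases R (stb_special k R Gk k1 kR)) => // O; move: dvd;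
        by rewrite (weight_orb O) ?e2 ?e3.
    split=> //; apply/esym/eqP; rewrite eqEcard cycle_subG sk -orderE ok.
    by rewrite (weight_orb O) e1.
  have sXK : X \subset K.
    apply/subsetP=> x Xx; have Gx : x \in G by rewrite -defG mem_gen.
    have ox : #[x] = 3 by apply: nt_prime_order (X3 Xx) (X_neq1 Xx).
    have /card_gt0P[R] := fix_gt0 Gx; rewrite inE => /eqP xR.
    have /card_gt0P[Q] := fix_gt0 Gg; rewrite inE => /eqP gQ.
    have [OR eR] := orb3 x R Gx (X_neq1 Xx) ox xR.
    have [OQ eQ] := orb3 g Q Gg g1 og gQ.
    have [a Ga ea] : exists2 a, a \in G & R = a Q.
      have /orbP[a Ga ea] := OQ; have /orbP[b Gb eb] := OR.
      by exists (a^-1 * b); rewrite ?groupM ?groupV // permM ea permK.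
    have : x \in stab R by apply/stbP.
    rewrite ea stbJ // mem_conjg eQ => /cycleP[i ei].
    by rewrite -(conjgKV a x) ei; apply: KJ => //; apply: groupX.
  have sGK : G \subset K by rewrite -defG gen_subG.
  have [k Gk ek] := Iconj s t Is It.
  have /KP[_ /(_ s Is)] := subsetP sGK k Gk.
  by rewrite -VJ // -ek => e; rewrite e eqxx in nVt.
have [gs _] := cent 5 isT isT og.
by have [og2 _] := Vg s Is gs; rewrite og2 in og.
Qed.

Theorem tame_rack :
  (#|G| = 12 /\ (X ~=r cycle123 1 ^: 'Alt_('I_4) \/
    X ~=r (cycle123 1 ^: 'Alt_('I_4)) :|: ((cycle123 1)^-1 ^: 'Alt_('I_4)))) \/
  (#|G| = 60 /\ X ~=r cycle123 2 ^: 'Alt_('I_5)).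
Proof.
have [[P [_ + _]]|[_ [P1 [P2 [P3 [e [e1 e2 e3 eg sub]]]]]]] := wild_or_tame.
  by rewrite tame cards1.
move: eg e3; rewrite !inE !xpair_eqE => /or3P[]/andP[/eqP-> /eqP g_ e3].
- by left; split=> //; apply: tetrahedral e1 g_.
- by case: (not_octahedral e1 e2 e3 g_ sub).
by right; split=> //; apply: icosahedral e1 e2 e3 g_ sub.
Qed.
End Counting.

Import GRing.Theory.
Local Open Scope ring_scope.

(** * Matrices of size two and the projective line *)

Section Quad.
Variable F : finFieldType.

(** Quadruples [(a, b, c, d)], for the rows [(a, b)] and [(c, d)], make products of
   matrices compute, so that identities between entries are left to [ring]. *)
Definition m2 := (F * F * F * F)%type.
Implicit Types (x y z : m2) (v w : F * F) (P : option F).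

Definition mul2 x y : m2 :=
  let: (a, b, c, d) := x in let: (a', b', c', d') := y in
  (a * a' + b * c', a * b' + b * d', c * a' + d * c', c * b' + d * d').
(** The adjugate; it is the inverse in determinant 1. *)
Definition inv2 x : m2 := let: (a, b, c, d) := x in (d, - b, - c, a).
Definition one2 : m2 := (1, 0, 0, 1).
Definition scal2 (s : F) x : m2 :=
  let: (a, b, c, d) := x in (s * a, s * b, s * c, s * d).
Definition det2 x : F := let: (a, b, c, d) := x in a * d - b * c.
Definition tr2 x : F := let: (a, b, c, d) := x in a + d.
(** Vectors are rows, on which matrices act from the right. *)
Definition vmul v x : F * F :=
  let: (a, b, c, d) := x in (v.1 * a + v.2 * c, v.1 * b + v.2 * d).
Definition vscale (s : F) v : F * F := (s * v.1, s * v.2).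
Definition cross v w : F := v.1 * w.2 - v.2 * w.1.
Definition op2 x y := mul2 (mul2 x y) (inv2 x).
(** By Cayley-Hamilton these are the matrices with [x ^+ 2 + x + 1 = 0] and
   determinant 1, the lifts of the elements of order three of [PSL2]. *)
Definition tri : {set m2} := [set x | (tr2 x == -1) && (det2 x == 1)].

Lemma mul2A x y z : mul2 x (mul2 y z) = mul2 (mul2 x y) z.
Proof.
case: x y z => [[[a b] c] d] [[[a' b'] c'] d'] [[[e f] g] h].
by rewrite /mul2; congr (_, _, _, _); ring.
Qed.
Lemma det2M x y : det2 (mul2 x y) = det2 x * det2 y.
Proof. by case: x y => [[[a b] c] d] [[[a' b'] c'] d'] /=; ring. Qed.
Lemma det2V x : det2 (inv2 x) = det2 x.
Proof. by case: x => [[[a b] c] d] /=; ring. Qed.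
Lemma det21 : det2 one2 = 1. Proof. by rewrite /=; ring. Qed.
Lemma mul21 x : mul2 x one2 = x.
Proof. by case: x => [[[a b] c] d] /=; congr (_, _, _, _); ring. Qed.
Lemma mul12 x : mul2 one2 x = x.
Proof. by case: x => [[[a b] c] d] /=; congr (_, _, _, _); ring. Qed.
Lemma scal2M s x y : mul2 (scal2 s x) y = scal2 s (mul2 x y).
Proof.
by case: x y => [[[a b] c] d] [[[a' b'] c'] d'] /=; congr (_, _, _, _); ring.
Qed.
Lemma mul2V x : mul2 x (inv2 x) = scal2 (det2 x) one2.
Proof. by case: x => [[[a b] c] d] /=; congr (_, _, _, _); ring. Qed.
Lemma mulV2 x : mul2 (inv2 x) x = scal2 (det2 x) one2.
Proof. by case: x => [[[a b] c] d] /=; congr (_, _, _, _); ring. Qed.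
Lemma scal12 x : scal2 1 x = x.
Proof. by case: x => [[[a b] c] d] /=; congr (_, _, _, _); ring. Qed.
Lemma scal2A s t x : scal2 s (scal2 t x) = scal2 (s * t) x.
Proof. by case: x => [[[a b] c] d] /=; congr (_, _, _, _); ring. Qed.
Lemma vmulM v x y : vmul v (mul2 x y) = vmul (vmul v x) y.
Proof.
by case: x y => [[[a b] c] d] [[[a' b'] c'] d'] /=; congr (_, _); ring.
Qed.
Lemma vmulZ s v x : vmul (vscale s v) x = vscale s (vmul v x).
Proof. by case: x => [[[a b] c] d] /=; congr (_, _) => /=; ring. Qed.
Lemma vmulZr s v x : vmul v (scal2 s x) = vscale s (vmul v x).
Proof. by case: x => [[[a b] c] d] /=; congr (_, _) => /=; ring. Qed.
Lemma vmul1 v : vmul v one2 = v.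
Proof. by case: v => a b /=; congr (_, _); ring. Qed.
Lemma vscA s t v : vscale s (vscale t v) = vscale (s * t) v.
Proof. by case: v => a b; rewrite /vscale /=; congr (_, _); ring. Qed.
Lemma vsc1 v : vscale 1 v = v.
Proof. by case: v => a b; rewrite /vscale /=; congr (_, _); ring. Qed.
Lemma crsM v w x : cross (vmul v x) (vmul w x) = det2 x * cross v w.
Proof.
by case: x v w => [[[a b] c] d] [? ?] [? ?]; rewrite /cross /=; ring.
Qed.
Lemma vmul_eq0 v x : det2 x != 0 -> vmul v x = (0, 0) -> v = (0, 0).
Proof.
move=> dx /(congr1 (vmul ^~ (inv2 x))); rewrite -vmulM mul2V vmulZr vmul1.
case: (inv2 x) => [[[a b] c] d]; case: v => u w; rewrite /vscale /=.
rewrite !mul0r addr0 => -[/eqP + /eqP]; rewrite !mulf_eq0 (negPf dx) /=.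
by move=> /eqP-> /eqP->.
Qed.

(** The projective line is [option F]: [Some z] is the line of [(1, z)], and [None]
   that of [(0, 1)]. *)
Definition pt P : F * F := if P is Some z then (1, z) else (0, 1).
Definition cls v : option F := if v.1 == 0 then None else Some (v.2 / v.1).
Definition act2 P x := cls (vmul (pt P) x).

Lemma pt_neq0 P : pt P <> (0, 0).
Proof. by case: P => [a|] [] /eqP; rewrite ?oner_eq0 // => _ /eqP; rewrite oner_eq0. Qed.
Lemma clsK P : cls (pt P) = P.
Proof. by case: P => [a|]; rewrite /cls /= ?eqxx // oner_eq0 divr1. Qed.
Lemma clsE v : v <> (0, 0) -> exists2 s, s != 0 & v = vscale s (pt (cls v)).
Proof.
case: v => u w nz; rewrite /cls /=; case: eqVneq => [u0|u0].
  exists w; last by rewrite u0 /vscale /=; congr (_, _); ring.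
  by apply/eqP=> w0; apply: nz; rewrite u0 w0.
by exists u => //; rewrite /vscale /= mulr1 mulrC divfK.
Qed.
Lemma clsZ s v : s != 0 -> cls (vscale s v) = cls v.
Proof.
move=> s0; rewrite /cls /= mulf_eq0 (negPf s0) /=; case: eqVneq => // u0.
by congr Some; field; rewrite u0.
Qed.
Lemma act2M P x y : det2 x != 0 -> act2 P (mul2 x y) = act2 (act2 P x) y.
Proof.
move=> dx; rewrite /act2 vmulM.
have [s s0 {1}->] : exists2 s, s != 0 &
    vmul (pt P) x = vscale s (pt (cls (vmul (pt P) x))).
  by apply: clsE => /(vmul_eq0 dx); apply: pt_neq0.
by rewrite vmulZ clsZ.
Qed.
Lemma act2Z s P x : s != 0 -> act2 P (scal2 s x) = act2 P x.
Proof. by move=> s0; rewrite /act2 vmulZr clsZ. Qed.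
Lemma act21 P : act2 P one2 = P.
Proof. by rewrite /act2 vmul1 clsK. Qed.
Lemma act2K x : det2 x != 0 -> cancel (act2 ^~ x) (act2 ^~ (inv2 x)).
Proof. by move=> dx P; rewrite /= -act2M // mul2V act2Z // act21. Qed.

(** The default value serves singular matrices only. *)
Definition rho x : {perm option F} :=
  insubd (1%g : {perm option F}) [ffun P => act2 P x].
Lemma rhoE x P : det2 x != 0 -> rho x P = act2 P x.
Proof.
move=> dx; rewrite /rho /insubd insubT /=.
  apply/injectiveP=> Q R; rewrite !ffunE; exact: (can_inj (act2K dx)).
by move=> injx; rewrite -pvalE ffunE.
Qed.
Lemma rhoM x y : det2 x != 0 -> det2 y != 0 -> rho (mul2 x y) = (rho x * rho y)%g.
Proof.
by move=> dx dy; apply/permP=> P; rewrite permM !rhoE ?det2M ?mulf_neq0 ?act2M.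
Qed.
Lemma rho_scal s x : s != 0 -> det2 x != 0 -> rho (scal2 s x) = rho x.
Proof.
move=> s0 dx; apply/permP=> P; rewrite !rhoE ?act2Z //.
by move: dx; case: x => [[[a b] c] d] /= dx;
  rewrite (_ : _ - _ = s * s * (a * d - b * c)) ?mulf_neq0 //; ring.
Qed.
Lemma rho1 : rho one2 = 1%g.
Proof. by apply/permP=> P; rewrite rhoE ?det21 ?oner_eq0 // act21 perm1. Qed.
Lemma rhoV x : det2 x != 0 -> rho (inv2 x) = ((rho x)^-1)%g.
Proof.
move=> dx; apply/eqP; rewrite eq_mulgV1 invgK -rhoM ?det2V // mulV2.
by rewrite rho_scal ?rho1 ?det21 ?oner_eq0.
Qed.

End Quad.

(** * Fixed points are eigenvectors *)

Section Eigen.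
Variable F : finFieldType.
Implicit Types (x y z : m2 F) (v w : F * F) (P R : option F) (a b : F).

Definition eigen P a x := vmul (pt P) x = vscale a (pt P).

Lemma eig_fix P a x : det2 x != 0 -> eigen P a x -> rho x P = P.
Proof.
move=> dx Ex; rewrite rhoE // /act2 Ex clsZ ?clsK //.
apply: contra_neq dx => a0; move: Ex; rewrite /eigen a0.
case: x => [[[α β] γ] δ]; case: P => [z|]; rewrite /vscale /=.
  rewrite !mul0r !mul1r => -[/eqP + /eqP].
  by rewrite !addr_eq0 => /eqP-> /eqP->; ring.
by rewrite !mul0r !add0r !mul1r => -[-> ->]; ring.
Qed.

Lemma fix_eig P x : det2 x != 0 -> rho x P = P -> exists a, eigen P a x.
Proof.
move=> dx; rewrite rhoE // /act2 => fixP.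
have [|s _ e] := @clsE _ (vmul (pt P) x); last by exists s; rewrite /eigen {1}e fixP.
by move/(vmul_eq0 dx); apply: pt_neq0.
Qed.

Lemma crs_pt P R : P != R -> cross (pt P) (pt R) != 0.
Proof.
case: P R => [u|] [v|] //; rewrite /cross /= ?mul0r ?mul1r ?mulr1 ?mulr0 ?subr0.
- by move=> neq; rewrite subr_eq0 eq_sym; apply: contra_neq neq => ->.
- by rewrite oner_eq0.
- by rewrite sub0r oppr_eq0 oner_eq0.
Qed.

Lemma eig_mul P R a b x : P != R -> eigen P a x -> eigen R b x -> a * b = det2 x.
Proof.
move=> /crs_pt nz EP ER; apply: (mulIf nz); rewrite -crsM EP ER /cross /vscale /=; ring.
Qed.

Lemma eig_char P a x : eigen P a x -> a ^+ 2 - tr2 x * a + det2 x = 0.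
Proof.
case: x => [[[α β] γ] δ]; rewrite /eigen /vscale; case: P => [z|] /= [].
  rewrite !mul1r => h1 h2.
  have -> : α = a - z * γ by rewrite -[RHS]addr0 -(subrr (a * 1)) -{1}h1; ring.
  have -> : β = a * z - z * δ by rewrite -h2; ring.
  by ring.
by rewrite !mul0r !add0r !mul1r mulr0 mulr1 => -> ->; ring.
Qed.

Lemma char_eig a x : det2 x != 0 -> a ^+ 2 - tr2 x * a + det2 x = 0 ->
  exists P, eigen P a x.
Proof.
move=> dx Ha.
have key v : v <> (0, 0) -> vmul v x = vscale a v -> exists P, eigen P a x.
  case/clsE=> s s0 ev; rewrite {1 2}ev vmulZ => e; exists (cls v).
  have := congr1 (vscale s^-1) e; rewrite !vscA mulVf // vsc1 /eigen => ->.
  by congr (vscale _ _); field.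
case: x dx Ha key => [[[α β] γ] δ] /= dx Ha key.
have Ha' : (α - a) * (δ - a) = β * γ.
  by apply/eqP; rewrite -subr_eq0 -[0]Ha; apply/eqP; ring.
case: (eqVneq γ 0) => [g0|g0]; last first.
  apply: (key (γ, a - α)) => [[] /eqP|]; first by rewrite (negPf g0).
  rewrite /vscale /=; congr (_, _); first ring.
  by rewrite mulrC -Ha'; ring.
have {Ha' dx Ha} /eqP := Ha'; rewrite {}g0 in key *; rewrite mulr0 mulf_eq0 !subr_eq0 => /orP[]/eqP e.
  case: (eqVneq (δ - a, - β) (0, 0)) => [[d0 /eqP]|/eqP nz].
    rewrite oppr_eq0 => /eqP b0; exists None; rewrite /eigen /vscale /=.
    by move/eqP: d0; rewrite subr_eq0 => /eqP->; congr (_, _); ring.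
  by apply: (key _ nz); rewrite /vscale /= e; congr (_, _); ring.
exists None; rewrite /eigen /vscale /= e; congr (_, _); ring.
Qed.

Lemma eig_scalar P R a x : P != R -> eigen P a x -> eigen R a x -> x = scal2 a (one2 F).
Proof.
move=> /crs_pt; rewrite /eigen; move: (pt P) (pt R) => [v1 v2] [w1 w2].
case: x => [[[α β] γ] δ]; rewrite /vscale /cross /= => nz [e1 e2] [f1 f2].
have k s : (v1 * w2 - v2 * w1) * s = 0 -> s = 0.
  by move/eqP; rewrite mulf_eq0 (negPf nz) => /eqP.
congr (_, _, _, _); apply/eqP; rewrite -subr_eq0; apply/eqP; apply: k.
- rewrite (_ : _ * _ = w2 * (v1 * α + v2 * γ) - v2 * (w1 * α + w2 * γ)
      - a * (v1 * w2 - v2 * w1)); last ring.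
  by rewrite e1 f1; ring.
- rewrite (_ : _ * _ = w2 * (v1 * β + v2 * δ) - v2 * (w1 * β + w2 * δ)
      ); last ring.
  by rewrite e2 f2; ring.
- rewrite (_ : _ * _ = v1 * (w1 * α + w2 * γ) - w1 * (v1 * α + v2 * γ)
      ); last ring.
  by rewrite e1 f1; ring.
- rewrite (_ : _ * _ = v1 * (w1 * β + w2 * δ) - w1 * (v1 * β + v2 * δ)
      - a * (v1 * w2 - v2 * w1)); last ring.
  by rewrite e2 f2; ring.
Qed.

Lemma rho_scalar1 a : a != 0 -> rho (scal2 a (one2 F)) = 1%g.
Proof. by move=> a0; rewrite rho_scal ?rho1 ?det21 ?oner_eq0. Qed.

Lemma det1_neq0 x : det2 x = 1 -> det2 x != 0.
Proof. by move->; apply: oner_neq0. Qed.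

Lemma eig_neq0 P a x : det2 x != 0 -> eigen P a x -> a != 0.
Proof.
move=> dx /eig_char; apply: contra_eq_neq => ->.
by rewrite expr0n mulr0 subr0 add0r.
Qed.

(** The eigenvalue at another fixed point is [a^-1], and there is one unless
   [a^-1 = a]. *)
Lemma unE P a x : det2 x = 1 -> eigen P a x -> unip P (rho x) = (a ^+ 2 == 1).
Proof.
move=> dx1 Ex; have dx := det1_neq0 dx1; have a0 := eig_neq0 dx Ex.
have neqP R b : eigen R b x -> b != a -> P != R.
  move=> ER; apply: contra_neq => ePR; move: ER; rewrite -ePR /eigen Ex.
  by case: (P) => [z|]; rewrite /vscale /= => -[]; rewrite !mulr1 ?mulr0.
rewrite /unip (eig_fix dx Ex) eqxx /=; apply/idP/eqP => [|a2]; last first.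
  have [//|nx1] := eqVneq (rho x) 1%g.
  apply/subsetP=> R; rewrite !inE => /eqP fixR.
  have [b ER] := fix_eig dx fixR.
  apply: contraNT nx1; rewrite eq_sym => neqPR.
  have := eig_mul neqPR Ex ER; rewrite dx1 -a2 => /(mulfI a0) eb.
  by move: ER; rewrite eb => /(eig_scalar neqPR Ex)->; rewrite rho_scalar1.
move=> H; apply/eqP; apply: contraLR H => a2.
have nab : a^-1 != a by apply: contra_neq a2 => e; rewrite expr2 -{1}e mulVf.
have [|R ER] := @char_eig a^-1 x dx.
  have := eig_char Ex; rewrite dx1 => /(congr1 (fun t => t * a^-1 ^+ 2)).
  by rewrite mul0r => <-; field.
have neqPR := neqP _ _ ER nab.
apply/norP; split; last first.
  apply/negP=> /subsetP/(_ R); rewrite !inE (eig_fix dx ER) eq_sym => /(_ (eqxx _)).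
  by rewrite (negPf neqPR).
apply/negP=> /eqP x1.
have [S PS] : exists S, (S != P) && (S != R).
  have : (0 < #|~: [set P; R]|)%N.
    by rewrite cardsCs setCK cards2 neqPR card_option subn_gt0 ltnS finNzRing_gt1.
  by case/card_gt0P=> S; rewrite !inE negb_or; exists S.
case/andP: PS => SP SR.
have fixS : rho x S = S by rewrite x1 perm1.
have [c ES] := fix_eig dx fixS.
have := eig_mul SP ES Ex; have := eig_mul SR ES ER; rewrite dx1 => <-.
move=> e; case/eqP: nab; apply: mulfI (esym e).
exact: eig_neq0 ES.
Qed.

Definition SLperm : {set {perm option F}} :=
  [set rho x | x in [set x : m2 F | det2 x == 1]].

Lemma SLpermP g : reflect (exists2 x, det2 x = 1 & g = rho x) (g \in SLperm).
Proof.
apply: (iffP imsetP) => -[x]; first by rewrite inE => /eqP dx ->; exists x.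
by move=> dx ->; exists x => //; rewrite inE dx.
Qed.

Lemma mem_SLperm x : det2 x = 1 -> rho x \in SLperm.
Proof. by move=> dx; apply/SLpermP; exists x. Qed.

Fact SLperm_group_set : group_set SLperm.
Proof.
apply/group_setP; split; first by rewrite -(rho1 F) mem_SLperm // det21.
move=> _ _ /SLpermP[x dx ->] /SLpermP[y dy ->].
by rewrite -rhoM ?det1_neq0 // mem_SLperm // det2M dx dy mulr1.
Qed.
Canonical SLperm_group := Group SLperm_group_set.

Lemma SLperm_fix_eig g P : g \in SLperm -> g P = P ->
  exists x a, [/\ det2 x = 1, g = rho x & eigen P a x].
Proof.
case/SLpermP=> x dx -> fixP; have [a Ea] := fix_eig (det1_neq0 dx) fixP.
by exists x, a.
Qed.

Lemma un_mul P g h : g \in SLperm -> h \in SLperm ->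
  unip P g -> unip P h -> unip P (g * h)%g.
Proof.
move=> SLg SLh ug uh.
have [/eqP gP _] := andP ug; have [/eqP hP _] := andP uh.
have [x [a [dx defg Ex]]] := SLperm_fix_eig SLg gP.
have [y [b [dy defh Ey]]] := SLperm_fix_eig SLh hP.
move: ug uh; rewrite defg defh (unE dx Ex) (unE dy Ey) => /eqP a2 /eqP b2.
rewrite -rhoM ?det1_neq0 // (@unE _ (a * b)) ?det2M ?dx ?dy ?mulr1 //.
  by rewrite exprMn a2 b2 mulr1.
by rewrite /eigen vmulM Ex vmulZ Ey vscA.
Qed.

Lemma eigV P a x : det2 x = 1 -> eigen P a x -> eigen P a^-1 (inv2 x).
Proof.
move=> dx Ex; have a0 := eig_neq0 (det1_neq0 dx) Ex.
have := congr1 (fun v => vscale a^-1 (vmul v (inv2 x))) Ex.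
by rewrite /= -vmulM mul2V dx scal12 vmul1 !vmulZ vscA mulVf // vsc1.
Qed.

Lemma eigM P a b x y : eigen P a x -> eigen P b y -> eigen P (a * b) (mul2 x y).
Proof. by move=> Ex Ey; rewrite /eigen vmulM Ex vmulZ Ey vscA. Qed.

(** The eigenvalues at a common fixed point multiply, so that of a commutator is 1. *)
Lemma un_commg P g h : g \in SLperm -> h \in SLperm ->
  g P = P -> h P = P -> unip P [~ g, h]%g.
Proof.
move=> SLg SLh gP hP.
have [x [a [dx defg Ex]]] := SLperm_fix_eig SLg gP.
have [y [b [dy defh Ey]]] := SLperm_fix_eig SLh hP.
have a0 := eig_neq0 (det1_neq0 dx) Ex; have b0 := eig_neq0 (det1_neq0 dy) Ey.
have Ec := eigM (eigM (eigV dx Ex) (eigV dy Ey)) (eigM Ex Ey).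
rewrite commgEl conjgE defg defh !mulgA -!rhoV ?det1_neq0 //.
rewrite -mulgA -!rhoM ?det2M ?det2V ?dx ?dy ?mulr1 ?oner_eq0 //.
rewrite (unE _ Ec) ?det2M ?det2V ?dx ?dy ?mulr1 //.
by apply/eqP; field; rewrite a0 b0.
Qed.

(** Two of three eigenvectors would have the same eigenvalue. *)
Lemma SLperm_fix_le2 g : g \in SLperm -> g != 1%g -> (#|fixpts g| <= 2)%N.
Proof.
case/SLpermP=> x dx -> nx1; rewrite leqNgt; apply: contra nx1.
case/card_gt2P=> P [Q [R [[+ + +] [nPQ nQR nRP]]]]; rewrite !inE.
move=> /eqP/(fix_eig (det1_neq0 dx))[a EP] /eqP/(fix_eig (det1_neq0 dx))[b EQ].
move=> /eqP/(fix_eig (det1_neq0 dx))[c ER].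
have a0 := eig_neq0 (det1_neq0 dx) EP.
have e1 := eig_mul nPQ EP EQ; rewrite eq_sym in nRP.
have e2 := eig_mul nRP EP ER; have ebc : b = c by apply: (mulfI a0); rewrite e1.
rewrite -ebc in ER; rewrite (eig_scalar nQR EQ ER) rho_scalar1 //.
exact: eig_neq0 (det1_neq0 dx) EQ.
Qed.

Section Char.
Variables (p : nat) (charFp : p \in [pchar F]).

Lemma un_expp P g : g \in SLperm -> unip P g -> (g ^+ p = 1)%g.
Proof.
move=> SLg ug; have [/eqP gP _] := andP ug.
have [x [a [dx defg Ex]]] := SLperm_fix_eig SLg gP.
move: ug; rewrite defg (unE dx Ex) => /eqP a2.
have a0 : a != 0 := eig_neq0 (det1_neq0 dx) Ex.
have tx : tr2 x = a + a.
  have := eig_char Ex; rewrite dx a2 => e; apply: (mulIf a0).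
  rewrite mulrDl -expr2 a2; apply/eqP; rewrite -subr_eq0 -oppr_eq0 -[0]e.
  by apply/eqP; ring.
(* As [(x - a) ^+ 2 = 0], the n-th power of [x] is [a ^+ n.-1] times [n x - (n - 1) a]. *)
pose z (n : nat) : m2 F := let: (α, β, γ, δ) := x in
  (n%:R * α - (n%:R - 1) * a, n%:R * β, n%:R * γ, n%:R * δ - (n%:R - 1) * a).
have xE : let: (α, β, γ, δ) := x in δ = a + a - α /\ β * γ = α * (a + a - α) - a ^+ 2.
  move: dx tx a2; case: (x) => [[[α β] γ] δ] /= dx tx a2.
  by split; rewrite ?a2 -?dx -tx; ring.
have dz n : det2 (z n) = 1.
  rewrite /z; move: xE; case: (x) => [[[α β] γ] δ] /= [-> ebc].
  rewrite (_ : _ * β * _ = n%:R * n%:R * (β * γ)); last by ring.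
  by rewrite ebc; transitivity (a ^+ 2); first ring.
have zS n : mul2 (z n) x = scal2 a (z n.+1).
  rewrite /z; move: xE; case: (x) => [[[α β] γ] δ] /= [-> ebc].
  rewrite -[n.+1]addn1 natrD; congr (_, _, _, _); try ring.
    by rewrite -!mulrA ebc; ring.
  by rewrite (_ : _ * γ * β = n%:R * (β * γ)); [rewrite ebc; ring | ring].
have gz n : (g ^+ n)%g = rho (z n).
  elim: n => [|n IHn].
    rewrite expg0 -(rho_scalar1 a0); congr rho; rewrite /z /=.
    by case: (x) => [[[α β] γ] δ] /=; congr (_, _, _, _); ring.
  rewrite expgSr IHn defg -rhoM ?dz ?dx ?oner_eq0 // zS rho_scal ?dz ?oner_eq0 //.
rewrite -defg gz -(rho_scalar1 a0); congr rho; rewrite /z.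
by rewrite (pcharf0 charFp); case: (x) => [[[α β] γ] δ] /=; congr (_, _, _, _); ring.
Qed.

Lemma eigX P a x n : det2 x = 1 -> eigen P a x ->
  exists y, [/\ det2 y = 1, (rho x ^+ n)%g = rho y & eigen P (a ^+ n) y].
Proof.
move=> dx Ex; elim: n => [|n [y [dy e Ey]]].
  exists (one2 F); rewrite det21 expg0 rho1; split=> //.
  by rewrite /eigen vmul1 expr0 vsc1.
exists (mul2 y x); rewrite det2M dx dy mulr1 expgSr e exprSr.
by rewrite rhoM ?dx ?dy ?oner_eq0 //; split=> //; apply: eigM.
Qed.

Lemma expp_un P g : g \in SLperm -> g P = P -> (g ^+ p = 1)%g -> unip P g.
Proof.
move=> SLg gP gp; have [x [a [dx defg Ex]]] := SLperm_fix_eig SLg gP.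
have [y [dy e Ey]] := eigX p dx Ex.
have : unip P (rho y) by rewrite -e -defg gp /unip perm1 !eqxx.
rewrite (unE dy Ey) defg (unE dx Ex) -exprM mulnC exprM.
rewrite -[1 in X in X -> _](pFrobenius_aut1 charFp) -[_ ^+ p](pFrobenius_autE charFp).
by move/eqP/fmorph_inj->.
Qed.
End Char.
End Eigen.

(** * The class of matrices of trace -1 and determinant 1 *)

Section TwoSquares.
Variable F : finFieldType.
Implicit Types a b c s t : F.

(** A quadratic form [a * x ^+ 2] takes each value at most twice, and 0 only once. *)
Lemma card_squares a : a != 0 -> (#|F| < 2 * #|[set (a * x ^+ 2)%R | x : F]|)%N.
Proof.
move=> a0; set S := [set _ | x : F].
have S0 : 0 \in S by apply/imsetP; exists 0; rewrite // expr0n mulr0.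
have -> : #|F| = (\sum_(s in S) #|[set x | (a * x ^+ 2 == s)%R]|)%N.
  rewrite -sum1_card (partition_big_imset (fun x => a * x ^+ 2)) /=.
  apply: eq_big => [s|s _]; last by rewrite -sum1_card; apply: eq_bigl => x; rewrite inE.
  by apply/imsetP/imsetP=> -[x _ ->]; exists x.
rewrite (bigD1 0) //= (_ : [set x | _] = [set 0]); last first.
  by apply/setP=> x; rewrite !inE mulf_eq0 (negPf a0) expf_eq0.
rewrite cards1 (cardsD1 0 S) S0 mulnDr -addn1 addnAC leq_add //.
rewrite [leqRHS]mulnC -sum_nat_const big_mkcond [leqRHS]big_mkcond /=.
apply: leq_sum => s _; rewrite !inE andbC; case: ifP => // /andP[_ /imsetP[x _ ->]].
apply: leq_trans (_ : #|[set x; - x]| <= 2)%N; last by rewrite cards2; case: eqP.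
apply/subset_leq_card/subsetP=> y; rewrite !inE (inj_eq (mulfI a0)).
by rewrite eqf_sqr.
Qed.

(** The values of [a * s ^+ 2] and of [c - b * t ^+ 2] both fill more than half of
   [F], so they meet. *)
Lemma two_squares a b c : a != 0 -> b != 0 ->
  exists s t, a * s ^+ 2 + b * t ^+ 2 = c.
Proof.
move=> a0 b0; pose S1 := [set a * x ^+ 2 | x : F]; pose S2 := [set b * x ^+ 2 | x : F].
have cS2 : #|[set c - x | x in S2]| = #|S2|.
  by apply: card_imset => x y /addrI/oppr_inj.
have [disj|[s /setIP[/imsetP[x _ ->] /imsetP[_ /imsetP[y _ ->] e]]]] :=
    set_0Vmem (S1 :&: [set c - x | x in S2]); last first.
  by exists x, y; rewrite e subrK.
have := max_card (mem (S1 :|: [set c - x | x in S2])).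
rewrite cardsU disj cards0 subn0 cS2 leqNgt; case/negP.
have := card_squares a0; have := card_squares b0; rewrite -/S1 -/S2.
by move: #|S1| #|S2| #|F| => m n k; lia.
Qed.

(** Completing the square reduces this to [two_squares], except in characteristic 2
   where [s ^+ 2 + t ^+ 2] is the value at [(s + t, 0)]. *)
Lemma norm_form c : 3%:R != 0 :> F -> exists s t, s ^+ 2 - s * t + t ^+ 2 = c.
Proof.
move=> n3; have [F2|F2] := eqVneq (2%:R : F) 0.
  have [s [t e]] := two_squares c (oner_neq0 F) (oner_neq0 F).
  exists (s + t), 0; rewrite -e.
  by transitivity (s ^+ 2 + t ^+ 2 + 2%:R * (s * t)); [ring | rewrite F2; ring].
have [s [t e]] := two_squares (4%:R * c) (oner_neq0 F) n3.
have n4 : 4%:R != 0 :> F by rewrite (_ : 4%:R = 2%:R * 2%:R) ?mulf_neq0 //; ring.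
exists ((s + t) / 2%:R), t; apply: (mulfI n4); rewrite -e; field; exact: F2.
Qed.
End TwoSquares.

Section Tri.
Variable F : finFieldType.
Hypothesis F3 : 3%:R != 0 :> F.
Implicit Types x y z M : m2 F.

Lemma triP x : reflect (tr2 x = -1 /\ det2 x = 1) (x \in tri F).
Proof. by rewrite inE; apply: (iffP andP) => -[/eqP ? /eqP]. Qed.

Lemma tri_bc a b c d : (a, b, c, d) \in tri F -> d = -1 - a /\ b * c = - a ^+ 2 - a - 1.
Proof.
case/triP=> /= tx dx; have dE : d = -1 - a by rewrite -tx; ring.
by split=> //; rewrite -[X in _ - _ - X]dx dE; ring.
Qed.

Lemma tri_CH x v : x \in tri F ->
  vmul (vmul v x) x = (- (vmul v x).1 - v.1, - (vmul v x).2 - v.2).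
Proof.
case: x v => [[[a b] c] d] [s t] /tri_bc[-> bc] /=; congr (_, _).
  by transitivity (s * (a ^+ 2 + b * c) - t * c); [ring | rewrite bc; ring].
by transitivity (t * ((1 + a) ^+ 2 + b * c) - s * b); [ring | rewrite bc; ring].
Qed.

(** The rows of [M] are [w] and [w x], for a vector [w] with [cross w (w x) = 1]. Over
   a cyclic vector [v], this determinant is [cross v (v x)] times the norm form of
   the coordinates of [w] in the basis [v], [v x]. *)
Lemma tri_companion x : x \in tri F ->
  exists2 M, det2 M = 1 & mul2 M x = mul2 (0, 1, -1, -1) M.
Proof.
move=> Tx; have CH v := tri_CH v Tx.
have [v kv] : exists v : F * F, cross v (vmul v x) != 0.
  case: x Tx {CH} => [[[a b] c] d] /tri_bc[-> bc].
  have [b0|b0] := eqVneq b 0; last by exists (1, 0); rewrite /cross /= !mul1r !mul0r !addr0 subr0.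
  have [c0|c0] := eqVneq c 0; last first.
    by exists (0, 1); rewrite /cross /= !mul0r !mul1r !add0r oppr_eq0.
  exists (1, 1); rewrite /cross /= b0 c0 !mul1r addr0 add0r.
  apply: contra F3 => /eqP e; have ea : a + a = -1.
    by apply/eqP; rewrite -subr_eq0 -oppr_eq0 -[0]e; apply/eqP; ring.
  move: bc; rewrite b0 mul0r => bc; apply/eqP.
  transitivity (- (4%:R * (- a ^+ 2 - a - 1)) - (a + a + 1) ^+ 2); first by ring.
  by rewrite -bc ea; ring.
have [s [t st]] := norm_form (cross v (vmul v x))^-1 F3.
pose u := vmul v x; pose w := (s * v.1 + t * u.1, s * v.2 + t * u.2).
have wx : vmul w x = (s * u.1 + t * (- u.1 - v.1), s * u.2 + t * (- u.2 - v.2)).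
  transitivity (s * u.1 + t * (vmul u x).1, s * u.2 + t * (vmul u x).2).
    by rewrite /w /u; case: (x) => [[[a b] c] d] /=; congr (_, _); ring.
  by rewrite /u CH.
have dw : cross w (vmul w x) = 1.
  rewrite wx; transitivity ((s ^+ 2 - s * t + t ^+ 2) * cross v u); last by rewrite st mulVf.
  by rewrite /cross /w /=; ring.
exists (w.1, w.2, (vmul w x).1, (vmul w x).2); first by rewrite -dw /cross /=; ring.
have eM : mul2 (w.1, w.2, (vmul w x).1, (vmul w x).2) x =
  ((vmul w x).1, (vmul w x).2, (vmul (vmul w x) x).1, (vmul (vmul w x) x).2).
  by case: (x) => [[[a b] c] d].
by rewrite eM CH /=; congr (_, _, _, _); ring.
Qed.

Lemma tri_conj x y : x \in tri F -> y \in tri F ->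
  exists2 M, det2 M = 1 & mul2 M x = mul2 y M.
Proof.
case/tri_companion=> M dM eM /tri_companion[N dN eN].
exists (mul2 (inv2 N) M); first by rewrite det2M det2V dN dM mulr1.
rewrite -mul2A eM mul2A mul2A; congr (mul2 _ M).
have := congr1 (fun z => mul2 (inv2 N) (mul2 z (inv2 N))) eN.
rewrite -!mul2A mul2V dN scal12 mul21 => <-.
by rewrite !mul2A mulV2 dN scal12 mul12.
Qed.

Lemma tri_cube x : x \in tri F -> mul2 x (mul2 x x) = one2 F.
Proof.
case: x => [[[a b] c] d] /tri_bc[-> bc] /=; rewrite /one2; congr (_, _, _, _).
- transitivity (a ^+ 3 + (b * c) * (a - 1)); [ring | rewrite bc; ring].
- transitivity (b * (a ^+ 2 + a + 1 + b * c)); [ring | rewrite bc; ring].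
- transitivity (c * (a ^+ 2 + a + 1 + b * c)); [ring | rewrite bc; ring].
- transitivity ((-1 - a) ^+ 3 + (b * c) * (-2%:R - a)); [ring | rewrite bc; ring].
Qed.

(** A matrix that fixes all points has the same eigenvalue everywhere. *)
Lemma rho_eq1 x : det2 x = 1 -> rho x = 1%g -> exists2 a, a ^+ 2 = 1 & x = scal2 a (one2 F).
Proof.
move=> dx x1; have fx P : rho x P = P by rewrite x1 perm1.
have [a Ea] := fix_eig (det1_neq0 dx) (fx None).
have [b Eb] := fix_eig (det1_neq0 dx) (fx (Some 0)).
have a2 : a ^+ 2 = 1.
  by apply/eqP; rewrite -(unE dx Ea) x1 /unip perm1 !eqxx.
exists a => //; apply: (@eig_scalar _ None (Some 0)) => //.
have a0 := eig_neq0 (det1_neq0 dx) Ea.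
suff -> : a = b by [].
by apply: (mulfI a0); rewrite -expr2 a2 (eig_mul _ Ea Eb) ?dx.
Qed.

Lemma tri_not_scalar a : scal2 a (one2 F) \in tri F -> False.
Proof.
case/triP=> /=; rewrite mulr1 => ta da; case/negP: F3; apply/eqP.
transitivity (4%:R * (a * a - a * 0 * (a * 0)) - (a + a) * (a + a)); last by ring.
by rewrite ta da; ring.
Qed.

Lemma rho_tri_inj : {in tri F &, injective (@rho F)}.
Proof.
move=> x y Tx Ty e; have [tx dx] := triP _ Tx; have [ty dy] := triP _ Ty.
have := @rho_eq1 (mul2 x (inv2 y)); rewrite det2M det2V dx dy mulr1 => /(_ erefl).
rewrite rhoM ?rhoV ?det2V ?det1_neq0 // e mulgV => /(_ erefl)[a a2 eq].
have ex : x = scal2 a y.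
  by rewrite -[x]mul21 -(scal12 (one2 F)) -dy -mulV2 mul2A eq scal2M mul12.
have a1 : a = 1.
  apply: oppr_inj; rewrite -[RHS]tx ex -[- a]mulrN1 -ty.
  by case: (y) => [[[? ?] ?] ?] /=; ring.
by rewrite ex a1 scal12.
Qed.

Lemma rho_tri3 x : x \in tri F -> (rho x ^+ 3 = 1)%g.
Proof.
move=> Tx; have [_ dx] := triP _ Tx.
rewrite !expgS expg0 mulg1 -!rhoM ?det2M ?dx ?mulr1 ?oner_eq0 //.
by rewrite tri_cube // rho1.
Qed.

Lemma rho_tri_neq1 x : x \in tri F -> rho x != 1%g.
Proof.
move=> Tx; have [_ dx] := triP _ Tx; apply/eqP=> /(rho_eq1 dx)[a _ ex].
by apply: (@tri_not_scalar a); rewrite -ex.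
Qed.

Lemma tr2_op x y : det2 x = 1 -> tr2 (op2 x y) = tr2 y.
Proof.
case: x y => [[[a b] c] d] [[[a' b'] c'] d'] /= dx.
by transitivity ((a * d - b * c) * (a' + d')); [ring | rewrite dx mul1r].
Qed.

Lemma det2_op x y : det2 x = 1 -> det2 (op2 x y) = det2 y.
Proof. by move=> dx; rewrite /op2 !det2M det2V dx mulr1 mul1r. Qed.

Lemma op2_tri x y : det2 x = 1 -> y \in tri F -> op2 x y \in tri F.
Proof. by move=> dx /triP[ty dy]; apply/triP; rewrite tr2_op ?det2_op. Qed.

Lemma rho_op x y : det2 x = 1 -> det2 y = 1 -> rho (op2 x y) = conj_op (rho x) (rho y).
Proof.
by move=> dx dy; rewrite /op2 /conj_op !rhoM ?rhoV ?det2M ?det2V ?dx ?dy ?mulr1 ?oner_eq0.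
Qed.

Lemma rho_rack_iso (X : {set m2 F}) : X \subset tri F ->
  rack_isomorphic (@op2 F) X (@conj_op _) [set rho x | x in X].
Proof.
move=> sX; exists (@rho F); split=> // [x y Xx Xy|x y Xx Xy].
  by apply: rho_tri_inj; apply: (subsetP sX).
by apply: rho_op; [case/triP: (subsetP sX x Xx) | case/triP: (subsetP sX y Xy)].
Qed.
End Tri.

(** * Wild case: recovering a subfield *)

Section Transvections.
Variable E : finFieldType.
Implicit Types (b c z : E) (x y : m2 E) (P : option E).

Definition upper b : m2 E := (1, b, 0, 1).
Definition lower c : m2 E := (1, 0, c, 1).

Lemma det_upper b : det2 (upper b) = 1. Proof. by rewrite /=; ring. Qed.
Lemma det_lower c : det2 (lower c) = 1. Proof. by rewrite /=; ring. Qed.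

Lemma upperD b b' : mul2 (upper b) (upper b') = upper (b + b').
Proof. by rewrite /mul2 /upper; congr (_, _, _, _); ring. Qed.

Lemma rho_None x : det2 x != 0 -> rho x None = let: (a, b, c, d) := x in cls (c, d).
Proof.
move=> dx; rewrite rhoE // /act2; case: (x) => [[[a b] c] d] /=.
by congr cls; congr (_, _); ring.
Qed.
Lemma rho_Some x z : det2 x != 0 ->
  rho x (Some z) = let: (a, b, c, d) := x in cls (a + z * c, b + z * d).
Proof.
move=> dx; rewrite rhoE // /act2; case: (x) => [[[a b] c] d] /=.
by congr cls; congr (_, _); ring.
Qed.

Lemma rho_upper b z : rho (upper b) (Some z) = Some (z + b).
Proof.
rewrite rho_Some ?det_upper ?oner_eq0 //= /cls /= mulr0 addr0 oner_eq0.
by rewrite divr1 mulr1 addrC.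
Qed.

Lemma un_upper g : g \in SLperm E -> unip None g -> exists b, g = rho (upper b).
Proof.
move=> SLg ug; have [/eqP gP _] := andP ug.
have [x [a [dx eg Ex]]] := SLperm_fix_eig SLg gP.
move: ug; rewrite eg (unE dx Ex) => /eqP a2 {eg}.
have a0 := eig_neq0 (det1_neq0 dx) Ex.
case: x dx Ex => [[[α β] γ] δ] dx; rewrite /eigen /vscale /= => -[].
rewrite !mul0r !add0r !mul1r mulr0 mulr1 => g0 da; subst γ δ.
move: dx; rewrite /= mulr0 subr0 => dx; exists (β / a).
have -> : (α, β, 0, a) = scal2 a (upper (β / a)).
  rewrite /=; congr (_, _, _, _).
  - by apply: (mulIf a0); rewrite dx mulr1 -expr2 a2.
  - by rewrite mulrC divfK.
  - by rewrite mulr0.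
  by rewrite mulr1.
by rewrite rho_scal // det_upper oner_eq0.
Qed.

Lemma un_lower g : g \in SLperm E -> unip (Some 0) g -> exists c, g = rho (lower c).
Proof.
move=> SLg ug; have [/eqP gP _] := andP ug.
have [x [a [dx eg Ex]]] := SLperm_fix_eig SLg gP.
move: ug; rewrite eg (unE dx Ex) => /eqP a2 {eg}.
have a0 := eig_neq0 (det1_neq0 dx) Ex.
case: x dx Ex => [[[α β] γ] δ] dx; rewrite /eigen /vscale /= => -[].
rewrite !mul0r !addr0 !mul1r mulr1 mulr0 => da b0; subst β α.
move: dx; rewrite /= mul0r subr0 => dx; exists (γ / a).
have -> : (a, 0, γ, δ) = scal2 a (lower (γ / a)).
  rewrite /=; congr (_, _, _, _).
  - by rewrite mulr1.
  - by rewrite mulr0.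
  - by rewrite mulrC divfK.
  by apply: (mulfI a0); rewrite dx mulr1 -expr2 a2.
by rewrite rho_scal // det_lower oner_eq0.
Qed.

Lemma upper_un b : unip None (rho (upper b)).
Proof.
rewrite (@unE _ _ 1) ?det_upper ?expr1n //.
by rewrite /eigen /vscale /=; congr (_, _); ring.
Qed.

Lemma upper_inj : injective (fun b => rho (upper b)).
Proof.
move=> b b' /(congr1 (fun g : {perm option E} => g (Some 0))).
by rewrite !rho_upper !add0r => -[].
Qed.

Lemma lower_inj : injective (fun c => rho (lower c)).
Proof.
move=> b b' /(congr1 (fun g : {perm option E} => g None)).
rewrite !rho_None ?det_lower ?oner_eq0 //= /cls /=.
case: eqVneq => [->|b0]; case: eqVneq => [->|b'0] // [].
by rewrite !div1r => /invr_inj.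
Qed.

(** An explicit factorization into transvections; [SL2_transv0] reduces the case of a
   zero lower left entry to this one. *)
Lemma SL2_transv a b c d : c != 0 -> a * d - b * c = 1 ->
  (a, b, c, d) = mul2 (mul2 (upper ((a - 1) / c)) (lower c)) (upper ((d - 1) / c)).
Proof.
move=> c0 dx; have -> : b = (a * d - 1) / c by rewrite -dx; field.
by rewrite /=; congr (_, _, _, _); field.
Qed.

Lemma SL2_transv0 a b d : (a, b, 0, d) = mul2 (lower (-1)) (a, b, a, b + d).
Proof. by rewrite /=; congr (_, _, _, _); ring. Qed.

Lemma upperJ a b d b' : a * d = 1 ->
  (rho (upper b') ^ rho (a, b, 0, d) = rho (upper (d ^+ 2 * b')%R))%g.
Proof.
move=> ad; have dx : det2 (a, b, 0, d) = 1 by rewrite /= mulr0 subr0.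
rewrite conjgE -rhoV ?det1_neq0 // mulgA -!rhoM ?det2M ?det2V ?dx ?det_upper ?mulr1 ?oner_eq0 //.
congr rho; rewrite /=; congr (_, _, _, _); try ring.
- by transitivity (a * d); first ring.
- by transitivity (a * d); first ring.
Qed.
End Transvections.

Fact half_lt Q n : (Q.-1 <= 2 * n)%N -> (2 <= Q)%N -> (Q < (true + n) + (true + n))%N.
Proof. by rewrite /=; lia. Qed.

(** In this section the coordinates are such that the orbit of infinity contains 0,
   and the translation by 1 belongs to [G]. *)
Section WildCore.
Variables (E : finFieldType) (X : {set m2 E}).
Hypothesis E3 : 3%:R != 0 :> E.
Hypothesis sX : X \subset tri E.
Hypothesis clX : {in X &, forall x y, op2 x y \in X}.
Hypothesis X0 : X != set0.
Let rX := [set rho x | x in X].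
Let G := <<rX>>%G.
Let Q := #|unip_set G None|.
Hypothesis hOrb : #|orb G None| = Q.+1.
Hypothesis Q2 : (2 <= Q)%N.
Hypothesis hStb : (Q * Q.-1 <= 2 * #|stab G None|)%N.
Hypothesis O0 : Some 0 \in orb G None.
Hypothesis G1 : rho (upper 1) \in G.

Lemma X_det x : x \in X -> det2 x = 1.
Proof. by move/(subsetP sX)/triP=> []. Qed.

Lemma sGSL : G \subset SLperm E.
Proof.
rewrite gen_subG; apply/subsetP=> _ /imsetP[x Xx ->].
by apply: mem_SLperm; apply: X_det.
Qed.

Definition transl := [set b | rho (upper b) \in G].
Local Notation A := transl.

Lemma card_wA : #|A| = Q.
Proof.
rewrite -(card_imset _ (@upper_inj E)) /Q; apply: eq_card => g; rewrite [RHS]inE.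
apply/imsetP/andP => [[b + ->]|[Gg ug]]; first by rewrite inE upper_un.
have [b eg] := un_upper (subsetP sGSL g Gg) ug.
by exists b => //; rewrite inE -eg.
Qed.

Lemma transl_add a b : a \in A -> b \in A -> a + b \in A.
Proof.
rewrite !inE => Ga Gb; rewrite -upperD rhoM ?det_upper ?oner_eq0 //.
exact: groupM.
Qed.

Lemma transl_0 : 0 \in A.
Proof. by rewrite inE (_ : upper 0 = one2 E) // rho1 group1. Qed.

Lemma transl_1 : 1 \in A. Proof. by rewrite inE. Qed.

Lemma transl_opp a : a \in A -> - a \in A.
Proof.
rewrite !inE => Ga; rewrite (_ : upper (- a) = inv2 (upper a)).
  by rewrite rhoV ?det_upper ?oner_eq0 // groupV.
by rewrite /=; congr (_, _, _, _); ring.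
Qed.

Definition inW P := if P is Some z then z \in A else true.

(** The translations by [A] move 0 through [A]; the orbit has no room for more. *)
Lemma orb_wA : orb G None = [set P | inW P].
Proof.
apply/esym/eqP; rewrite eqEcard hOrb; apply/andP; split.
  apply/subsetP=> -[z|]; rewrite inE /=; last by rewrite orb_refl.
  by rewrite inE => Gz; rewrite -[z]add0r -rho_upper orb_G.
have -> : [set P | inW P] = None |: [set Some z | z in A].
  apply/setP=> -[z|]; rewrite !inE //=; apply/idP/imsetP=> [Az|[y Ay [->]] //].
  by exists z.
rewrite cardsU1 card_imset ?card_wA; last by move=> ? ? [].
by case: imsetP => // -[].
Qed.

Lemma G_W g P : g \in G -> inW P -> inW (g P).
Proof.
move=> Gg WP; have : P \in orb G None by rewrite orb_wA inE.
by rewrite -(orb_G None P Gg) orb_wA inE.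
Qed.

Definition mults := [set r | [forall a in A, r * a \in A]].
Local Notation R := mults.

Lemma wRP r : reflect {in A, forall a, r * a \in A} (r \in R).
Proof. by rewrite inE; apply: forall_inP. Qed.

Lemma mults_sub : R \subset A.
Proof. by apply/subsetP=> r /wRP/(_ 1 transl_1); rewrite mulr1. Qed.

(** A matrix of [stab G None] maps [z] to [d ^+ 2 * z + b * d], and [d ^+ 2]
   multiplies [A] into itself. Elements with the same [d ^+ 2] differ by a translation. *)
Lemma mults_card : (Q.-1 <= 2 * #|R :\ 0%R|)%N.
Proof.
pose unS P : E := if P is Some z then z else 0.
(* the factor [d ^+ 2], read off from the images of 0 and 1 *)
pose lam (g : {perm option E}) := unS (g (Some 1)) - unS (g (Some 0)).
have stbE g : g \in stab G None -> exists a b d, [/\ a * d = 1, g = rho (a, b, 0, d) & lam g = d ^+ 2].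
  case/stbP=> Gg gN; have [x [e [dx eg Ex]]] := SLperm_fix_eig (subsetP sGSL g Gg) gN.
  case: x dx Ex eg => [[[α β] γ] δ] dx; rewrite /eigen /vscale /= => -[].
  rewrite !mul0r !add0r !mul1r mulr0 mulr1 => g0 da eg; subst γ.
  have ad : α * δ = 1 by move: dx; rewrite /= mulr0 subr0.
  have a0 : α != 0 by apply: contra_eq_neq ad => ->; rewrite mul0r eq_sym oner_eq0.
  exists α, β, δ; split=> //.
  rewrite /lam eg !rho_Some ?dx ?oner_eq0 // /cls /= !mulr0 !addr0 (negPf a0) /=.
  have -> : δ = α^-1 by apply: (mulfI a0); rewrite ad mulfV.
  by field.
have lamR g : g \in stab G None -> lam g \in R :\ 0.
  move=> sg; have [Gg _] := stbP _ _ _ sg.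
  have [a [b [d [ad eg ->]]]] := stbE g sg.
  have d0 : d != 0 by apply: contra_eq_neq ad => ->; rewrite mulr0 eq_sym oner_eq0.
  rewrite !inE expf_eq0 (negPf d0) andbF /=; apply/forall_inP=> b' Ab'.
  by rewrite inE -(upperJ b b' ad) -eg groupJ //; move: Ab'; rewrite inE.
have fib g : g \in stab G None -> (#|[set h in stab G None | lam h == lam g]| <= Q)%N.
  move=> sg; rewrite /Q -(card_rcoset (unip_set G None) g); apply/subset_leq_card.
  apply/subsetP=> h; rewrite inE => /andP[sh /eqP elam]; rewrite mem_rcoset inE.
  have [Gg gN] := stbP _ _ _ sg; have [Gh hN] := stbP _ _ _ sh.
  rewrite groupM ?groupV //=.
  have [a [b [d [ad eg elg]]]] := stbE g sg; have [a' [b' [d' [ad' eh elh]]]] := stbE h sh.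
  have dg : det2 (a, b, 0, d) = 1 by rewrite /= mulr0 subr0.
  have dh : det2 (a', b', 0, d') = 1 by rewrite /= mulr0 subr0.
  rewrite eh eg -rhoV ?dg ?oner_eq0 // -rhoM ?det2V ?dg ?dh ?oner_eq0 //.
  rewrite (@unE _ _ (d' * a)) ?det2M ?det2V ?dg ?dh ?mulr1 //.
    by rewrite exprMn -elh elam elg -exprMn mulrC ad expr1n.
  by rewrite /eigen /vscale /=; congr (_, _); ring.
have Q0 : (0 < Q)%N by apply: ltnW.
rewrite -(leq_pmul2l Q0); apply: leq_trans hStb _; rewrite mulnCA leq_mul2l /=.
rewrite -sum1_card (partition_big_imset lam) /=.
apply: leq_trans (_ : \sum_(r in R :\ 0%R) Q <= _)%N; last by rewrite sum_nat_const mulnC.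
rewrite big_mkcond [leqRHS]big_mkcond /=; apply: leq_sum => r _.
case: ifP => [/imsetP[g sg ->]|_]; last by case: ifP.
rewrite lamR //; apply: leq_trans (fib g sg); rewrite -sum1_card.
by apply: eq_leq; apply: eq_bigl => h; rewrite inE.
Qed.

(** The multipliers form a subring [R] of [A] with more than half of its elements; a
   proper coset [a + R] would not fit. *)
Lemma mults_eq : R = A.
Proof.
apply/eqP; rewrite eqEsubset mults_sub; apply/subsetP=> a Aa; apply: contraT => nRa.
have R0 : 0 \in R by apply/wRP=> b _; rewrite mul0r transl_0.
have disj : R :&: [set a + r | r in R] = set0.
  apply/setP=> s; rewrite !inE; apply/negP=> /andP[/forall_inP Rs /imsetP[r Rr es]].
  case/negP: nRa; apply/wRP=> b Ab; rewrite (_ : a = s - r); last by rewrite es addrK.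
  by rewrite mulrBl transl_add ?transl_opp ?Rs //; apply: (wRP _ Rr).
have : (#|R :|: [set (a + r)%R | r in R]| <= #|A|)%N.
  apply/subset_leq_card; rewrite subUset mults_sub; apply/subsetP=> _ /imsetP[r Rr ->].
  by rewrite transl_add // (subsetP mults_sub).
rewrite cardsU disj cards0 subn0 card_imset; last exact: addrI.
rewrite card_wA; have := mults_card; rewrite (cardsD1 0 R) R0.
by move/half_lt/(_ Q2)/ltn_geF => ->.
Qed.

Lemma transl_mul a b : a \in A -> b \in A -> a * b \in A.
Proof. by rewrite -{1}mults_eq => /wRP; apply. Qed.

Lemma transl_inv a : a \in A -> a^-1 \in A.
Proof.
move=> Aa; have [->|a0] := eqVneq a 0; first by rewrite invr0 transl_0.
have : [set a * b | b in A] = A.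
  apply/eqP; rewrite eqEcard (card_imset _ (mulfI a0)) leqnn andbT.
  by apply/subsetP=> _ /imsetP[b Ab ->]; apply: transl_mul.
move/setP/(_ 1); rewrite transl_1 => /imsetP[b Ab e].
by rewrite -(mulr1 a^-1) e mulKf.
Qed.

Lemma transl_div a b : a \in A -> b \in A -> a / b \in A.
Proof. by move=> Aa Ab; apply: transl_mul => //; apply: transl_inv. Qed.

Lemma transl_sub a b : a \in A -> b \in A -> a - b \in A.
Proof. by move=> Aa Ab; apply: transl_add => //; apply: transl_opp. Qed.

Definition coeffs_in (A0 : {set E}) (x : m2 E) :=
  let: (a, b, c, d) := x in [&& a \in A0, b \in A0, c \in A0 & d \in A0].

(** [rho x] maps [A] with infinity to itself. Its values at infinity, 0, 1 and [d / c],
   together with the trace, determine the entries by operations in [A]. *)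
Lemma X_coeffs x : x \in X -> coeffs_in A x.
Proof.
move=> Xx; have [tx dx] := triP _ (subsetP sX x Xx).
have Gx : rho x \in G by apply: mem_gen; apply: imset_f.
have WN := G_W Gx (isT : inW None).
have W0 := @G_W _ (Some 0) Gx transl_0; have W1 := @G_W _ (Some 1) Gx transl_1.
have A1 := transl_1; have AN1 := transl_opp transl_1.
case: x {Xx} Gx tx dx WN W0 W1 => [[[a b] c] d] Gx /= tx dx.
rewrite !rho_Some ?rho_None /= ?dx ?oner_eq0 // !mul1r !mul0r !addr0 /cls /=.
have [c0|c0] := eqVneq c 0.
  subst c; move: dx; rewrite mulr0 subr0 addr0 => ad _.
  have a0 : a != 0 by apply: contra_eq_neq ad => ->; rewrite mul0r eq_sym oner_eq0.
  rewrite (negPf a0) /= => A_b A_bd.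
  have Aq : d / a \in A by rewrite (_ : _ / _ = (b + d) / a - b / a) ?transl_sub //; field.
  have d_a : d = a^-1 by apply: (mulfI a0); rewrite ad mulfV.
  have Aa : a \in A.
    rewrite (_ : a = -1 - (d / a)^-1) ?transl_sub ?transl_inv //.
    have e : a * (a + d) = - a by rewrite tx mulrN1.
    by rewrite d_a invfM !invrK -[LHS]opprK -e mulrDr ad; ring.
  have Ab : b \in A by rewrite -(divfK a0 b) transl_mul.
  by rewrite Aa Ab transl_0 d_a transl_inv.
move=> Ad _ _.
have := @G_W _ (Some (d / c)) Gx Ad.
rewrite rho_Some /= ?dx ?oner_eq0 // divfK // tx /cls /= oppr_eq0 oner_eq0 /=.
rewrite invrN1 mulrN1 => /transl_opp; rewrite opprK => Abd.
have dE : a = -1 - d by rewrite -tx; ring.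
have cb : c * (d / c + (b + d / c * d)) = -1.
  transitivity (d + b * c + d * d); first by field.
  have -> : b * c = a * d - 1 by rewrite -dx; ring.
  by rewrite dE; ring.
have A_d' : d / c + (b + d / c * d) \in A by apply: transl_add.
have Ac : c \in A.
  rewrite (_ : c = -1 / (d / c + (b + d / c * d))) ?transl_div //.
  rewrite -cb mulfK //; apply: contraTneq isT => e; move: cb.
  by rewrite e mulr0 => /eqP; rewrite eq_sym oppr_eq0 oner_eq0.
have A_d : d \in A by rewrite -(divfK c0 d) transl_mul.
have Ab : b \in A.
  by rewrite -(addrK (d / c * d) b); apply: transl_sub => //; apply: transl_mul.
by apply/and4P; split=> //; rewrite dE transl_sub.
Qed.

(** The stabilizers of 0 and infinity are conjugate in [G], so [G] contains as many
   lower as upper transvections; together they generate [SL2 A]. *)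
Lemma lower_G c : c \in A -> rho (lower c) \in G.
Proof.
pose B := [set c | rho (lower c) \in G].
suff -> : A = B by rewrite inE.
apply/esym/eqP; rewrite eqEcard; apply/andP; split.
  apply/subsetP=> d; rewrite inE => Gd.
  have := G_W Gd (isT : inW None).
  rewrite rho_None ?det_lower ?oner_eq0 //= /cls /=; case: eqVneq => [->|d0].
    by rewrite transl_0.
  by rewrite /= div1r => /transl_inv; rewrite invrK.
rewrite card_wA /Q -(weight_orb O0).2 -(card_imset (mem B) (@lower_inj E)).
apply/subset_leq_card/subsetP=> g; rewrite inE => /andP[Gg ug].
have [d eg] := un_lower (subsetP sGSL g Gg) ug.
by apply/imsetP; exists d; rewrite // inE -eg.
Qed.

Lemma SL2_G M : det2 M = 1 -> coeffs_in A M -> rho M \in G.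
Proof.
have upG b : b \in A -> rho (upper b) \in G by rewrite inE.
have main a b c d : det2 (a, b, c, d) = 1 -> c != 0 -> coeffs_in A (a, b, c, d) ->
    rho (a, b, c, d) \in G.
  move=> dM c0 /and4P[Aa Ab Ac Ad]; rewrite (SL2_transv c0 dM).
  rewrite !rhoM ?det2M ?det_upper ?det_lower ?mulr1 ?oner_eq0 //.
  by rewrite !groupM ?upG ?lower_G ?transl_div ?transl_sub ?transl_1.
case: M => [[[a b] c] d] dM oM; have [c0|c0] := eqVneq c 0; last exact: main.
subst c; have /and4P[Aa Ab Ac Ad] := oM.
have a0 : a != 0.
  by apply: contra_eq_neq dM => /= ->; rewrite mul0r mulr0 subr0 eq_sym oner_eq0.
have dM' : det2 (a, b, a, b + d) = 1 by rewrite -dM /=; ring.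
rewrite SL2_transv0 rhoM ?det_lower ?dM' ?oner_eq0 //.
rewrite groupM ?lower_G ?transl_opp ?transl_1 // main //.
by rewrite /coeffs_in Aa Ab transl_add.
Qed.

Lemma X_conj M x : det2 M = 1 -> coeffs_in A M -> x \in X -> op2 M x \in X.
Proof.
move=> dM oM Xx; have dx := X_det Xx; have GM := SL2_G dM oM.
have clrX : {in rX &, forall g h, conj_op g h \in rX}.
  move=> _ _ /imsetP[y Xy ->] /imsetP[z Xz ->].
  by rewrite -rho_op ?X_det // imset_f ?clX.
have : conj_op (rho M) (rho x) \in rX.
  by rewrite conj_opE rack_conj ?groupV ?imset_f.
rewrite -rho_op // => /imsetP[y Xy].
move/rho_tri_inj=> -> //; last exact: (subsetP sX).
by apply: op2_tri => //; apply: (subsetP sX).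
Qed.

Lemma transl_subfield : is_subfield A.
Proof.
apply/and3P; split; first exact: transl_1.
  by apply/forall_inP=> a Aa; apply/forall_inP=> b Ab; apply: transl_sub.
by apply/forall_inP=> a Aa; apply/forall_inP=> b Ab; apply: transl_div.
Qed.
End WildCore.

(** * Change of field and of coordinates *)

Section Map2.
Variables (K L : finFieldType) (f : {rmorphism K -> L}).
Implicit Types (x y : m2 K).

Definition map2 x : m2 L := let: (a, b, c, d) := x in (f a, f b, f c, f d).

Lemma map2M x y : map2 (mul2 x y) = mul2 (map2 x) (map2 y).
Proof.
by case: x y => [[[a b] c] d] [[[a' b'] c'] d'] /=; rewrite !rmorphD !rmorphM.
Qed.
Lemma map2V x : map2 (inv2 x) = inv2 (map2 x).
Proof. by case: x => [[[a b] c] d] /=; rewrite !rmorphN. Qed.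
Lemma map2_op x y : map2 (op2 x y) = op2 (map2 x) (map2 y).
Proof. by rewrite /op2 !map2M map2V. Qed.
Lemma det_map2 x : det2 (map2 x) = f (det2 x).
Proof. by case: x => [[[a b] c] d] /=; rewrite rmorphB !rmorphM. Qed.
Lemma tr_map2 x : tr2 (map2 x) = f (tr2 x).
Proof. by case: x => [[[a b] c] d] /=; rewrite rmorphD. Qed.
Lemma map2_inj : injective map2.
Proof.
move=> [[[a b] c] d] [[[a' b'] c'] d'] /=.
by case=> /fmorph_inj-> /fmorph_inj-> /fmorph_inj-> /fmorph_inj->.
Qed.
Lemma map2_tri x : (map2 x \in tri L) = (x \in tri K).
Proof.
rewrite !inE tr_map2 det_map2 -(rmorph1 f) -rmorphN.
by rewrite !(inj_eq (fmorph_inj f)).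
Qed.

Lemma map2_rack_iso (X : {set m2 K}) :
  rack_isomorphic (@op2 K) X (@op2 L) (map2 @: X).
Proof. by exists map2; split=> // [x y _ _|x y _ _]; [apply: map2_inj | apply: map2_op]. Qed.
End Map2.

Section SubfieldType.
Variables (E : finFieldType) (A : {set E}).
Hypothesis subA : is_subfield A.

Definition sf_units := [set u : {unit E} | val u \in A].
(** The type [subfield] of a set [C] of units is the subfield that [C] generates, so
   that a set [A] closed under the field operations becomes a field when [C] is
   the set of its units. *)
Definition subfield_type : finFieldType := subfield sf_units.

Definition sf_val : subfield_type -> E := @subfield_val E sf_units.
HB.instance Definition _ := GRing.RMorphism.copy sf_val (val : subfield_type -> E).

Lemma sf_gen : gen_subfield sf_units = A.
Proof.
have [A1 subr divr] := and3P subA.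
apply/eqP; rewrite eqEsubset; apply/andP; split.
  apply: bigcap_inf; rewrite subA /=; apply/forall_inP=> c; by rewrite inE.
apply/bigcapsP=> B /andP[/and3P[B1 subrB _] /forall_inP cB].
have B0 : 0 \in B by move/forall_inP: (forall_inP subrB 1 B1) => /(_ 1 B1); rewrite subrr.
apply/subsetP=> a Aa; have [->//|a0] := eqVneq a 0.
have ua : a \is a GRing.unit by rewrite unitfE.
have := cB (FinRing.unit E ua); rewrite inE /= => /(_ Aa).
by [].
Qed.

Lemma sf_valP k : sf_val k \in A.
Proof. by rewrite -sf_gen; case: k. Qed.

Lemma sf_mem a : a \in A -> exists k, sf_val k = a.
Proof. by rewrite -sf_gen => Aa; exists (@Subfield _ sf_units a Aa). Qed.

Lemma sf_inj : injective sf_val. Proof. exact: val_inj. Qed.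

Lemma card_sf : #|subfield_type| = #|A|.
Proof.
rewrite -(card_imset _ sf_inj); apply: eq_card => a.
apply/imsetP/idP => [[k _ ->]|/sf_mem[k <-]]; first exact: sf_valP.
by exists k.
Qed.

Lemma coeffs_sf x : coeffs_in A x -> exists y : m2 subfield_type, x = map2 sf_val y.
Proof.
case: x => [[[a b] c] d] /and4P[/sf_mem[a' <-] /sf_mem[b' <-] /sf_mem[c' <-] /sf_mem[d' <-]].
by exists (a', b', c', d').
Qed.

Lemma sf_coeffs y : coeffs_in A (map2 sf_val y).
Proof. by case: y => [[[a b] c] d]; rewrite /= !sf_valP. Qed.

(** [tri] is a single [SL2]-class over [A] too ([tri_conj]). *)
Lemma coeffs_tri (X : {set m2 E}) : 3%:R != 0 :> E -> X != set0 -> X \subset tri E ->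
  (forall x, x \in X -> coeffs_in A x) ->
  (forall M x, det2 M = 1 -> coeffs_in A M -> x \in X -> op2 M x \in X) ->
  X = map2 sf_val @: tri subfield_type.
Proof.
move=> E3 X0 sX oX cX; have K3 : 3%:R != 0 :> subfield_type.
  by rewrite -(fmorph_eq0 sf_val) rmorph_nat.
apply/eqP; rewrite eqEsubset; apply/andP; split; apply/subsetP=> x.
  move=> Xx; have [y e] := coeffs_sf (oX x Xx).
  by apply/imsetP; exists y; rewrite // -(map2_tri sf_val) -e (subsetP sX).
case/imsetP=> y Ty ->; have [z Xz] := set0Pn _ X0.
have [w ez] := coeffs_sf (oX z Xz).
have Tw : w \in tri subfield_type by rewrite -(map2_tri sf_val) -ez (subsetP sX).
have [M dM eM] := tri_conj K3 Tw Ty.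
have -> : y = op2 M w.
  by rewrite /op2 eM -mul2A mul2V dM scal12 mul21.
rewrite map2_op -ez; apply: cX => //; last exact: sf_coeffs.
by rewrite det_map2 dM rmorph1.
Qed.
End SubfieldType.

Section Conj2.
Variables (E : finFieldType) (N : m2 E).
Hypothesis dN : det2 N != 0.
Implicit Types (x y : m2 E).

Definition conj2 x := scal2 (det2 N)^-1 (mul2 (mul2 N x) (inv2 N)).

Lemma inv2M x y : inv2 (mul2 x y) = mul2 (inv2 y) (inv2 x).
Proof.
by case: x y => [[[a b] c] d] [[[a' b'] c'] d'] /=; congr (_, _, _, _); ring.
Qed.
Lemma inv2K : involutive (@inv2 E).
Proof. by case=> [[[a b] c] d] /=; rewrite !opprK. Qed.
Lemma inv2Z s x : inv2 (scal2 s x) = scal2 s (inv2 x).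
Proof. by case: x => [[[a b] c] d] /=; rewrite !mulrN. Qed.
Lemma scal2Mr s x y : mul2 x (scal2 s y) = scal2 s (mul2 x y).
Proof.
by case: x y => [[[a b] c] d] [[[a' b'] c'] d'] /=; congr (_, _, _, _); ring.
Qed.
Lemma det2Z s x : det2 (scal2 s x) = s ^+ 2 * det2 x.
Proof. by case: x => [[[a b] c] d] /=; ring. Qed.
Lemma tr2Z s x : tr2 (scal2 s x) = s * tr2 x.
Proof. by case: x => [[[a b] c] d] /=; ring. Qed.
Lemma tr2C x y : tr2 (mul2 x y) = tr2 (mul2 y x).
Proof. by case: x y => [[[a b] c] d] [[[a' b'] c'] d'] /=; ring. Qed.

Lemma conj2M x y : conj2 (mul2 x y) = mul2 (conj2 x) (conj2 y).
Proof.
rewrite /conj2 scal2M scal2Mr scal2A !mul2A -[mul2 (mul2 (mul2 N x) _) N]mul2A.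
by rewrite mulV2 scal2Mr !scal2M mul21 !scal2A divfK.
Qed.
Lemma conj2V x : conj2 (inv2 x) = inv2 (conj2 x).
Proof. by rewrite /conj2 inv2Z !inv2M inv2K mul2A. Qed.
Lemma conj2_op x y : conj2 (op2 x y) = op2 (conj2 x) (conj2 y).
Proof. by rewrite /op2 !conj2M conj2V. Qed.
Lemma det_conj2 x : det2 (conj2 x) = det2 x.
Proof. by rewrite /conj2 det2Z !det2M det2V; field. Qed.
Lemma tr_conj2 x : tr2 (conj2 x) = tr2 x.
Proof.
by rewrite /conj2 tr2Z tr2C mul2A mulV2 scal2M tr2Z mul12 mulKf.
Qed.
Lemma conj2_tri x : (conj2 x \in tri E) = (x \in tri E).
Proof. by rewrite !inE det_conj2 tr_conj2. Qed.
Lemma rho_conj2 x : det2 x != 0 -> rho (conj2 x) = (rho x ^ (rho N)^-1)%g.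
Proof.
move=> dx; rewrite /conj2 rho_scal ?invr_neq0 ?det2M ?det2V ?mulf_neq0 //.
by rewrite conjgE invgK !rhoM ?rhoV ?det2M ?det2V ?mulf_neq0 // mulgA.
Qed.
Lemma conj2_mulN x : mul2 (conj2 x) N = mul2 N x.
Proof.
by rewrite /conj2 scal2M -mul2A mulV2 scal2Mr mul21 scal2A mulVf // scal12.
Qed.
Lemma conj2_inj : injective conj2.
Proof.
move=> x y e; have := congr1 (fun z => scal2 (det2 N)^-1 (mul2 (inv2 N) (mul2 z N))) e.
by rewrite !conj2_mulN !mul2A mulV2 !scal2M !mul12 !scal2A mulVf // !scal12.
Qed.
End Conj2.

(** The rows of [N] represent [R] and [P], scaled so that their sum represents [S]. *)
Lemma three_points (E : finFieldType) (P R S : option E) :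
  P != R -> R != S -> S != P -> exists N : m2 E,
  [/\ det2 N != 0, rho N None = P, rho N (Some 0) = R & rho N (Some 1) = S].
Proof.
move=> /crs_pt PR /crs_pt RS /crs_pt SP.
pose α := cross (pt S) (pt R); pose β := cross (pt P) (pt S).
have α0 : α != 0 by move: RS; apply: contra; rewrite /α /cross => /eqP e; apply/eqP; 
  rewrite -[RHS]oppr0 -e; ring.
have β0 : β != 0 by move: SP; apply: contra; rewrite /β /cross => /eqP e; apply/eqP; 
  rewrite -[RHS]oppr0 -e; ring.
pose r1 := vscale β (pt R); pose r2 := vscale α (pt P).
have dN : det2 (r1.1, r1.2, r2.1, r2.2) != 0.
  have -> : det2 (r1.1, r1.2, r2.1, r2.2) = - (α * β * cross (pt P) (pt R)).
    by rewrite /r1 /r2 /vscale /cross /=; ring.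
  by rewrite oppr_eq0 !mulf_neq0.
exists (r1.1, r1.2, r2.1, r2.2); split=> //.
- by rewrite rho_None // -surjective_pairing clsZ // clsK.
- by rewrite rho_Some // !mul0r !addr0 -surjective_pairing clsZ // clsK.
rewrite rho_Some // !mul1r.
have -> : (r1.1 + r2.1, r1.2 + r2.2) = vscale (cross (pt P) (pt R)) (pt S).
  by rewrite /r1 /r2 /α /β /vscale /cross /=; congr (_, _); ring.
by rewrite clsZ // clsK.
Qed.

Section OrbConj.
Variables (T : finType) (G : {group {perm T}}) (b : {perm T}) (P : T).

Lemma orb_conj : orb (G :^ b)%G (b P) = b @: orb G P.
Proof.
apply/setP=> R; apply/orbP/imsetP => [[g]|[_ /orbP[g Gg ->] ->]].
  by rewrite mem_conjg => Gg ->; exists ((g ^ b^-1)%g P); 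
    [apply/orbP; exists (g ^ b^-1)%g | rewrite -[RHS]permJ conjgKV].
by exists (g ^ b)%g; rewrite ?memJ_conjg // permJ.
Qed.

Lemma uset_conj : unip_set (G :^ b)%G (b P) = unip_set G P :^ b.
Proof. by apply/setP=> g; rewrite mem_conjg !inE mem_conjg unJ. Qed.

Lemma stb_conj : stab (G :^ b)%G (b P) = stab G P :^ b.
Proof.
apply/setP=> g; rewrite mem_conjg; apply/stbP/stbP; rewrite /= mem_conjg => -[Gg].
  move=> gP; split=> //; apply: (@perm_inj _ b).
  by rewrite -permJ conjgKV.
by move=> gP; split=> //; rewrite -{1}(conjgKV b g) permJ gP.
Qed.
End OrbConj.

(** * Racks without common fixed point *)

Section Irreducible.
Variables (E : finFieldType) (p : nat) (X : {set m2 E}).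
Hypotheses (p_pr : prime p) (p_neq3 : p != 3%N) (charEp : p \in [pchar E]).
Hypothesis sX : X \subset tri E.
Hypothesis clX : {in X &, forall x y, op2 x y \in X}.
Let rX := [set rho x | x in X].
Let G := <<rX>>%G.
Hypothesis split : {in G, forall g, (0 < #|fixpts g|)%N}.
Hypothesis irrX : forall P, exists2 x, x \in X & rho x P != P.

Lemma char_3neq0 : 3%:R != 0 :> E.
Proof. by rewrite -(dvdn_pcharf charEp) dvdn_prime2. Qed.

Lemma irr_sGSL : G \subset SLperm E. Proof. exact: sGSL. Qed.

Lemma irr_rX3 : {in rX, forall g, (g ^+ 3 = 1)%g}.
Proof. by move=> _ /imsetP[x /(subsetP sX) Tx ->]; apply: rho_tri3. Qed.

Lemma irr_rX1 : {in rX, forall g, g != 1%g}.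
Proof.
by move=> _ /imsetP[x /(subsetP sX) Tx ->]; apply: rho_tri_neq1 => //; apply: char_3neq0.
Qed.

Lemma irr_clrX : {in rX &, forall g h, conj_op g h \in rX}.
Proof.
move=> _ _ /imsetP[x Xx ->] /imsetP[y Xy ->].
have [_ dx] := triP _ (subsetP sX x Xx); have [_ dy] := triP _ (subsetP sX y Xy).
by rewrite -rho_op // imset_f ?clX.
Qed.

Lemma irr_irr P : exists2 g : {perm option E}, g \in rX & g P != P.
Proof. by have [x Xx nx] := irrX P; exists (rho x); rewrite ?imset_f. Qed.

Lemma irr_le2 : {in G, forall g, g != 1%g -> (#|fixpts g| <= 2)%N}.
Proof. by move=> g /(subsetP irr_sGSL) SLg; apply: SLperm_fix_le2. Qed.

Lemma irr_unM P : {in G &, forall g h, unip P g -> unip P h -> unip P (g * h)%g}.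
Proof. by move=> g h /(subsetP irr_sGSL) SLg /(subsetP irr_sGSL) SLh; apply: un_mul. Qed.

Lemma irr_unX P : {in G, forall g, unip P g -> (g ^+ p = 1)%g}.
Proof. by move=> g /(subsetP irr_sGSL) SLg; apply: un_expp. Qed.

Lemma irr_comm P : {in G &, forall g h : {perm option E},
  g P = P -> h P = P -> unip P [~ g, h]%g}.
Proof. by move=> g h /(subsetP irr_sGSL) SLg /(subsetP irr_sGSL) SLh; apply: un_commg. Qed.

(** An element of order [p] has a fixed point [P], and then belongs to [unip_set G P]. *)
Lemma tame_coprime : (forall P, unip_set G P = 1%g) -> ~~ (p %| #|G|)%N.
Proof.
move=> tame; apply/negP=> /(Cauchy p_pr)[g Gg og].
have /card_gt0P[P] := split Gg; rewrite inE => /eqP gP.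
have gp : (g ^+ p = 1)%g by rewrite -og expg_order.
have : g \in unip_set G P by rewrite inE Gg (expp_un charEp) // (subsetP irr_sGSL).
by rewrite tame inE -order_eq1 og => /eqP p1; have := p_pr; rewrite p1.
Qed.

(** The coordinates are chosen with [P] at infinity, any other point [R] of its
   orbit at 0, and the image of [R] under a non-trivial [u] of [unip_set G P] at 1. *)
Lemma wild_subfield P : #|orb G P| = #|unip_set G P|.+1 -> (4 <= #|unip_set G P|)%N ->
  (#|unip_set G P| * (#|unip_set G P|.-1) <= 2 * #|stab G P|)%N ->
  exists (K : finFieldType) (f : {rmorphism K -> E}) (N : m2 E),
    [/\ (4 <= #|K|)%N, det2 N != 0 & conj2 N @: X = map2 f @: tri K].
Proof.
move=> kQ Q4 eQ.
have [u Uu u1] : exists2 u, u \in unip_set G P & u != 1%g.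
  have : ~~ (unip_set G P \subset [set 1%g]).
    by apply/negP=> /subset_leq_card; rewrite cards1 leqNgt (leq_trans _ Q4).
  by case/subsetPn=> u Uu; rewrite inE => u1; exists u.
have [R OR nRP] : exists2 R, R \in orb G P & R != P.
  have : ~~ (orb G P \subset [set P]).
    by apply/negP=> /subset_leq_card; rewrite cards1 kQ leqNgt ltnS (leq_trans _ Q4).
  by case/subsetPn=> R OR; rewrite inE => nR; exists R.
have [Gu uu] : u \in G /\ unip P u by move: Uu; rewrite inE => /andP[].
have [/eqP uP _] := andP uu.
have nuR : u R != R by apply: contra u1 => /eqP uR; rewrite (un_fix uu uR nRP).
have nuP : u R != P by rewrite -{1}uP (inj_eq perm_inj).
have [N [dN N0 N1 N2]] : exists N : m2 E,
    [/\ det2 N != 0, rho N None = P, rho N (Some 0) = R & rho N (Some 1) = u R].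
  by apply: three_points; rewrite // eq_sym.
pose b := ((rho N)^-1)%g; pose X' := conj2 N @: X.
have bP : b P = None by rewrite -N0 permK.
have bR : b R = Some 0 by rewrite -N1 permK.
have buR : b (u R) = Some 1 by rewrite -N2 permK.
have erX : [set rho x | x in X'] = rX :^ b.
  rewrite /X' -imset_comp /conjugate -imset_comp; apply: eq_in_imset => x Xx /=.
  by rewrite rho_conj2 ?(X_det sX Xx) ?oner_eq0.
have eG : <<[set rho x | x in X']>>%G = (G :^ b)%G.
  by apply: group_inj; rewrite /= erX genJ.
have sX' : X' \subset tri E.
  by apply/subsetP=> _ /imsetP[x Xx ->]; rewrite conj2_tri // (subsetP sX).
have clX' : {in X' &, forall x y, op2 x y \in X'}.
  by move=> _ _ /imsetP[x Xx ->] /imsetP[y Xy ->]; rewrite -conj2_op // imset_f ?clX.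
have X'0 : X' != set0.
  by have [x Xx _] := irrX None; apply/set0Pn; exists (conj2 N x); apply: imset_f.
have E3 := char_3neq0.
have cU : #|unip_set <<[set rho x | x in X']>>%G None| = #|unip_set G P|.
  by rewrite eG -bP uset_conj cardJg.
have hOrb : #|orb <<[set rho x | x in X']>>%G None| = #|unip_set <<[set rho x | x in X']>>%G None|.+1.
  by rewrite cU eG -bP orb_conj card_imset ?kQ //; apply: perm_inj.
have Q2 : (2 <= #|unip_set <<[set rho x | x in X']>>%G None|)%N by rewrite cU (leq_trans _ Q4).
have hStb : (#|unip_set <<[set rho x | x in X']>>%G None| * #|unip_set <<[set rho x | x in X']>>%G None|.-1
    <= 2 * #|stab <<[set rho x | x in X']>>%G None|)%N.
  by rewrite cU eG -bP stb_conj cardJg.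
have O0 : Some 0 \in orb <<[set rho x | x in X']>>%G None.
  by rewrite eG -bP -bR orb_conj imset_f.
have G1 : rho (upper 1) \in <<[set rho x | x in X']>>%G.
  have Gub : (u ^ b)%g \in <<[set rho x | x in X']>>%G by rewrite eG memJ_conjg.
  have uub : unip None (u ^ b)%g by rewrite -bP unJ conjgK.
  have [c ec] := un_upper (subsetP (sGSL sX') _ Gub) uub.
  suff <- : c = 1 by rewrite -ec.
  have := rho_upper c 0; rewrite -ec -bR permJ buR add0r.
  by case.
pose A := transl X'.
have subA : is_subfield A := transl_subfield sX' Q2 hStb G1.
exists (subfield_type A), (sf_val (A := A)), N; split=> //.
  by rewrite card_sf // (card_wA sX') cU.
apply: (coeffs_tri subA) => //.
  by move=> x Xx; apply: (X_coeffs sX' hOrb Q2 hStb O0 G1 Xx).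
by move=> M x dM oM Xx; apply: (X_conj sX' clX' hOrb Q2 hStb O0 G1).
Qed.

Theorem irreducible_rack :
  [\/ [/\ #|G| = 12%N, p != 2%N &
      rX ~=r cycle123 1 ^: 'Alt_('I_4) \/
      rX ~=r (cycle123 1 ^: 'Alt_('I_4)) :|: ((cycle123 1)^-1%g ^: 'Alt_('I_4))],
     [/\ #|G| = 60%N, p != 5%N & rX ~=r cycle123 2 ^: 'Alt_('I_5)] |
     exists (K : finFieldType) (f : {rmorphism K -> E}) (N : m2 E),
       [/\ (4 <= #|K|)%N, det2 N != 0 & conj2 N @: X = map2 f @: tri K]].
Proof.
have [[P [kQ Q4 eQ]]|[tame _]] := wild_or_tame (erefl : <<rX>> = G) p_pr p_neq3
    irr_rX3 split irr_le2 irr_unM irr_unX irr_irr None.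
  by constructor 3; apply: wild_subfield kQ Q4 eQ.
have cop := tame_coprime tame.
have [[c12 iso]|[c60 iso]] := tame_rack (erefl : <<rX>> = G) p_pr p_neq3
    irr_rX3 split irr_le2 irr_unM irr_unX irr_irr None irr_clrX irr_comm tame irr_rX1.
  by constructor 1; split=> //; apply: contraNneq cop => ->; rewrite c12.
by constructor 2; split=> //; apply: contraNneq cop => ->; rewrite c60.
Qed.
End Irreducible.

(** * Vector spaces given by a set and operations *)

Section Basis.
Variables (K : finFieldType) (V : finZmodType) (sc : K -> V -> V).
Hypotheses (scD : forall a, {morph sc a : u v / u + v})
  (scDl : forall a b v, sc (a + b) v = sc a v + sc b v)
  (scA : forall a b v, sc (a * b) v = sc a (sc b v)) (sc1 : forall v, sc 1 v = v).
Variable A : {set V}.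
Hypotheses (A0 : 0 \in A) (AD : {in A &, forall u v, u + v \in A})
  (AZ : forall a, {in A, forall v, sc a v \in A}).

(** The scalar multiplication is a plain function and the space a plain set, since
   the spaces of interest are subsets of a field with scalars in another type. *)
Lemma subspace_basis : exists (d : nat) (f : 'rV[K]_d -> V),
  [/\ {morph f : u v / u + v}, forall a u, f (a *: u) = sc a (f u),
      injective f & f @: [set: 'rV[K]_d] = A].
Proof.
have sc0 a : sc a 0 = 0 by apply: (addrI (sc a 0)); rewrite -scD !addr0.
have sc0l v : sc 0 v = 0 by apply: (addrI (sc 0 v)); rewrite -scDl !addr0.
have scN a v : sc a (- v) = - sc a v.
  by apply: (addrI (sc a v)); rewrite -scD !subrr sc0.
(* adjoin vectors one at a time to an independent family of [d] vectors *)
suff ind m : forall d (f : 'rV[K]_d -> V),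
    {morph f : u v / u + v} -> (forall a u, f (a *: u) = sc a (f u)) ->
    injective f -> f @: [set: 'rV[K]_d] \subset A ->
    (#|A| <= m + #|f @: [set: 'rV[K]_d]|)%N ->
  exists (d : nat) (f : 'rV[K]_d -> V),
  [/\ {morph f : u v / u + v}, forall a u, f (a *: u) = sc a (f u),
      injective f & f @: [set: 'rV[K]_d] = A].
  apply: (ind #|A| 0%N (fun=> 0)) => [u v|a u|u v _||]; rewrite ?addr0 ?sc0 //.
  - by apply/rowP=> -[].
  - by apply/subsetP=> _ /imsetP[u _ ->].
  by rewrite leq_addr.
elim: m => [|m IHm] d f fD fZ fI sfA cA.
  by exists d, f; split=> //; apply/eqP; rewrite eqEcard sfA.
have [sAf|/subsetPn[v Av nv]] := boolP (A \subset f @: [set: 'rV[K]_d]).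
  by exists d, f; split=> //; apply/eqP; rewrite eqEsubset sfA.
have f0 : f 0 = 0 by apply: (addrI (f 0)); rewrite -fD !addr0.
have fN u : f (- u) = - f u by apply: (addrI (f u)); rewrite -fD !subrr f0.
pose l (u : 'rV[K]_(1 + d)) := u 0 (lshift d 0).
have lD u w : l (u + w) = l u + l w by rewrite /l mxE.
have lZ a u : l (a *: u) = a * l u by rewrite /l mxE.
have lN u : l (- u) = - l u by rewrite /l mxE.
have scNl a w : sc (- a) w = - sc a w.
  by apply: (addrI (sc a w)); rewrite -scDl !subrr sc0l.
pose g (u : 'rV[K]_(1 + d)) := sc (l u) v + f (rsubmx u).
have gD : {morph g : u w / u + w}.
  by move=> u w; rewrite /g lD linearD /= scDl fD addrACA.
have gZ a u : g (a *: u) = sc a (g u) by rewrite /g lZ linearZ /= fZ scA scD.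
have gI : injective g.
  move=> u w e; have : g (u - w) = 0.
    by apply/eqP; rewrite gD -(scaleN1r w) gZ scNl sc1 e subrr.
  rewrite /g; set c := l _; set r := rsubmx _ => {}e.
  have c0 : c = 0.
    apply: contraNeq nv => c0; apply/imsetP; exists (- c^-1 *: r); rewrite // fZ.
    have -> : f r = - sc c v by apply/eqP; rewrite -addr_eq0 addrC e.
    by rewrite scN scNl opprK -scA mulVf // sc1.
  move: e; rewrite c0 sc0l add0r -f0 => /fI r0.
  apply/eqP; rewrite -subr_eq0 -[u - w]hsubmxK -/r r0; apply/eqP/rowP=> i.
  rewrite !mxE; case: splitP => k _; rewrite ?mxE //.
  by rewrite -[RHS]c0 /c /l !mxE (ord1 k).
apply: (IHm (1 + d)%N g) => //.
- apply/subsetP=> _ /imsetP[u _ ->]; rewrite AD ?AZ //.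
  by apply: (subsetP sfA); apply: imset_f.
rewrite card_imset // cardsT card_mx mul1n; move: cA.
rewrite (card_imset _ fI) cardsT card_mx mul1n => cA.
apply: leq_trans cA _; rewrite addSnnS leq_add2l ltn_exp2l ?finNzRing_gt1 //.
Qed.
End Basis.

(** A splitting field of the product of all [X ^+ 2 - t * X + 1]. *)
Lemma split_ext (F : finFieldType) : exists (E : finFieldType) (f : {rmorphism F -> E}),
  forall t : F, exists a : E, a ^+ 2 - f t * a + 1 = 0.
Proof.
pose Q (t : F) : {poly F} := 'X^2 - t *: 'X + 1.
have sQ t : size (Q t) = 3.
  rewrite /Q -addrA size_polyDl size_polyXn // (leq_ltn_trans (size_polyD _ _)) //.
  by rewrite gtn_max size_polyN size_poly1 andbT (leq_ltn_trans (size_scale_leq _ _)) ?size_polyX.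
have P0 : \prod_t Q t != 0.
  by apply/prodf_neq0=> t _; rewrite -size_poly_eq0 sQ.
have [L [rs eP _]] := FinSplittingFieldFor P0.
pose E : finFieldType := finvect_type L.
pose f : {rmorphism F -> E} := in_alg (finvect_type L).
exists E, f => t.
have : map_poly f (Q t) %| \prod_(z <- rs) ('X - z%:P).
  rewrite -(eqp_dvdr _ eP); rewrite dvdp_map.
  by rewrite (bigD1 t) //= dvdp_mulr.
move/dvdp_prod_XsubC=> [m em].
have [z zm] : exists z, z \in mask m rs.
  have := eqp_size em; rewrite size_prod_XsubC size_map_poly sQ => -[].
  by case: (mask m rs) => // z s _; exists z; rewrite mem_head.
exists z; have : root (map_poly f (Q t)) z by rewrite (eqp_root em) root_prod_XsubC.
rewrite /Q rmorphD /= rmorphB /= map_polyZ /= map_polyX map_polyXn rmorph1.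
by rewrite /root !hornerE => /eqP.
Qed.

(** * Descent from an extension *)

Section Transfer.
Variables (F E : finFieldType) (f : {rmorphism F -> E}).
Hypothesis splitE : forall t : F, exists a : E, a ^+ 2 - f t * a + 1 = 0.
Implicit Types (x y : m2 F) (P Q : option F).

Lemma act2_map Q x : act2 (omap f Q) (map2 f x) = omap f (act2 Q x).
Proof.
have clsf (u v : F) : cls (f u, f v) = omap f (cls (u, v)).
  rewrite /cls /= fmorph_eq0; case: eqVneq => //= u0.
  by rewrite rmorphM fmorphV.
rewrite /act2 -clsf; case: x => [[[a b] c] d].
by case: Q => [z|] /=; rewrite !rmorphD !rmorphM ?rmorph1 ?rmorph0.
Qed.

Lemma rho_map Q x : det2 x != 0 -> rho (map2 f x) (omap f Q) = omap f (rho x Q).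
Proof. by move=> dx; rewrite !rhoE ?det_map2 ?fmorph_eq0 // act2_map. Qed.

Lemma omap_inj : injective (omap f).
Proof. by move=> [a|] [b|] //= [/fmorph_inj->]. Qed.

Definition SLmap : {set {perm option E}} := 
  [set rho (map2 f x) | x in [set x : m2 F | det2 x == 1]].

Fact SLmap_group_set : group_set SLmap.
Proof.
apply/group_setP; split=> [|_ _ /imsetP[x + ->] /imsetP[y + ->]].
  apply/imsetP; exists (one2 F); first by rewrite inE det21.
  by rewrite -(rho1 E) /one2 /= rmorph0 rmorph1.
rewrite !inE => /eqP dx /eqP dy; rewrite -rhoM ?det_map2 ?dx ?dy ?rmorph1 ?oner_eq0 //.
by apply/imsetP; exists (mul2 x y); rewrite ?map2M // inE det2M dx dy mulr1.
Qed.
Canonical SLmap_group := Group SLmap_group_set.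

Lemma SLmap_split g : g \in SLmap -> (0 < #|fixpts g|)%N.
Proof.
case/imsetP=> x; rewrite inE => /eqP dx ->.
have dfx : det2 (map2 f x) = 1 by rewrite det_map2 dx rmorph1.
have [a ea] := splitE (tr2 x).
have [P EP] : exists P : option E, eigen P a (map2 f x).
  by apply: char_eig; rewrite ?dfx ?oner_eq0 // tr_map2.
by apply/card_gt0P; exists P; rewrite inE (eig_fix _ EP) ?dfx ?oner_eq0.
Qed.

Definition sub2 (x y : m2 F) : m2 F :=
  let: (a, b, c, d) := x in let: (a', b', c', d') := y in
  (a - a', b - b', c - c', d - d').

Lemma vmul_sub2 (w : E * E) x y :
  vmul w (map2 f (sub2 x y)) =
  ((vmul w (map2 f x)).1 - (vmul w (map2 f y)).1, (vmul w (map2 f x)).2 - (vmul w (map2 f y)).2).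
Proof.
case: x y => [[[a b] c] d] [[[a' b'] c'] d'] /=; rewrite !rmorphB.
by congr (_, _); ring.
Qed.

(** A common eigenvector over the extension spans the kernel of a commutator,
   so it is defined over the small field. *)
Lemma fixed_descends (X : {set m2 F}) x y (P : option E) : {in X, forall z, det2 z = 1} ->
  x \in X -> y \in X -> mul2 x y <> mul2 y x ->
  (forall z, z \in X -> rho (map2 f z) P = P) ->
  exists Q, forall z, z \in X -> rho z Q = Q.
Proof.
move=> dX Xx Xy nc fixP.
have eigP z : z \in X -> exists a, eigen P a (map2 f z).
  by move=> Xz; apply: fix_eig (fixP z Xz); rewrite det_map2 dX // rmorph1 oner_eq0.
(* [N] is not zero and kills the common eigenvector, so its kernel is a line,
   which can be computed over [F] *)
pose N := sub2 (mul2 x y) (mul2 y x).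
have EN : eigen P 0 (map2 f N).
  have [[a Ea] [b Eb]] := (eigP x Xx, eigP y Xy).
  rewrite /eigen vmul_sub2 !map2M !vmulM Ea Eb !vmulZ Ea Eb !vscA (mulrC b).
  by rewrite !subrr /vscale !mul0r.
have N0 : N <> (0, 0, 0, 0).
  move=> e; apply: nc; move: e; rewrite /N.
  case: (mul2 x y) (mul2 y x) => [[[a b] c] d] [[[a' b'] c'] d'] /= [].
  move=> /eqP + /eqP + /eqP + /eqP; rewrite !subr_eq0.
  by move=> /eqP-> /eqP-> /eqP-> /eqP->.
have dN : det2 N = 0.
  apply/eqP; rewrite -(fmorph_eq0 f) -det_map2.
  have := eig_char EN; rewrite expr0n mulr0 subr0 add0r => ->.
  exact: eqxx.
have [v v0 vN] : exists2 v : F * F, v <> (0, 0) & vmul v N = (0, 0).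
  move: N0 dN; case: (N) => [[[a b] c] d] /= N0 dN.
  have bc : b * c = a * d by apply/eqP; rewrite eq_sym -subr_eq0 dN.
  have [/eqP|/eqP nz] := eqVneq (c, - a) (0, 0).
    rewrite xpair_eqE oppr_eq0 => /andP[/eqP c0 /eqP a0].
    exists (d, - b).
      by case=> d0 /eqP; rewrite oppr_eq0 => /eqP b0; apply: N0; rewrite a0 b0 c0 d0.
    by rewrite a0 c0 /=; congr (_, _); ring.
  by exists (c, - a) => //=; rewrite mulNr (mulrC c b) bc; congr (_, _); ring.
have [s s0 ev] := clsE v0; pose Q := cls v.
have EQ : eigen (omap f Q) 0 (map2 f N).
  have vN' : vmul (pt Q) N = (0, 0).
    have := congr1 (vscale s^-1) vN; rewrite ev vmulZ vscA mulVf // vsc1 => ->.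
    by rewrite /vscale /= mulr0.
  rewrite /eigen; have -> : pt (omap f Q) = (f (pt Q).1, f (pt Q).2).
    by case: (Q) => [z|] /=; rewrite ?rmorph0 ?rmorph1.
  rewrite (_ : vmul _ _ = (f (vmul (pt Q) N).1, f (vmul (pt Q) N).2)).
    by rewrite vN' /vscale /= !mul0r rmorph0.
  by case: (N) => [[[a b] c] d] /=; rewrite !rmorphD !rmorphM.
have eP : P = omap f Q.
  apply/eqP; apply: contraT => nPQ; case: N0.
  have := eig_scalar nPQ EN EQ; case: (N) => [[[a b] c] d] /=.
  rewrite !mul0r => -[] /eqP + /eqP + /eqP + /eqP.
  by rewrite !fmorph_eq0 => /eqP-> /eqP-> /eqP-> /eqP->.
exists Q => z Xz; have := fixP z Xz.
by rewrite eP rho_map ?dX ?oner_eq0 // => /omap_inj.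
Qed.
End Transfer.

Section TraceSubfield.
Variables (F E K : finFieldType) (f : {rmorphism F -> E}) (h : {rmorphism K -> E}).

(** If the traces of products of elements of order three over [K] lie in [F],
   so does [K]: the [-1 - a ^+ 2] are among these traces, and every element is a sum
   of two squares. *)
Lemma trace_subfield :
  (forall x y, x \in tri K -> y \in tri K -> exists t, f t = h (tr2 (mul2 x y))) ->
  forall a, exists t, f t = h a.
Proof.
move=> tr a.
have sq b : exists t, f t = h (b ^+ 2).
  have [||t et] := tr (0, 1, -1, -1) (b, b ^+ 2 + b + 1, -1, -1 - b).
  - by apply/triP; split=> /=; ring.
  - by apply/triP; split=> /=; ring.
  exists (- 1 - t); rewrite rmorphB rmorphN1 et -(rmorphN1 h) -rmorphB; congr (h _).
  by rewrite /=; ring.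
have [s [t <-]] := two_squares a (oner_neq0 K) (oner_neq0 K).
have [[s' es] [t' et]] := (sq s, sq t).
by exists (s' + t'); rewrite !mul1r !rmorphD /= es et.
Qed.

(** [F] is a vector space over the image of [K]. *)
Lemma card_subfield : (forall a, exists t, f t = h a) -> exists k, #|F| = (#|K| ^ k)%N.
Proof.
move=> /fin_all_exists[κ hκ]; have f_inj := fmorph_inj f.
have κD a b : κ (a + b) = κ a + κ b by apply: f_inj; rewrite rmorphD !hκ rmorphD.
have κM a b : κ (a * b) = κ a * κ b by apply: f_inj; rewrite rmorphM !hκ rmorphM.
have κ1 : κ 1 = 1 by apply: f_inj; rewrite hκ !rmorph1.
have [|||||||k [g [_ _ gI gT]]] := @subspace_basis K F (fun a v => κ a * v) _ _ _ _ [set: F].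
- by move=> a u v; rewrite mulrDr.
- by move=> a b v; rewrite κD mulrDl.
- by move=> a b v; rewrite κM mulrA.
- by move=> v; rewrite κ1 mul1r.
- by rewrite inE.
- by move=> *; rewrite inE.
- by move=> a v _; rewrite in_setT.
exists k; move: gT => /(congr1 (fun A : {set F} => #|A|)).
by rewrite card_imset // !cardsT card_mx mul1n.
Qed.
End TraceSubfield.

Lemma order5_dvd (E : fieldType) (b : E) m : b ^+ 5 = 1 -> b != 1 -> b ^+ m = 1 -> (5 %| m)%N.
Proof.
move=> b5 b1 bm; have [k pk dk] := prim_order_exists (isT : (0 < 5)%N) b5.
have : k \in divisors 5 by rewrite -dvdn_divisors.
rewrite /= !inE => /orP[]/eqP ek; subst k.
  by have := prim_expr_order pk; rewrite expr1 => e; rewrite e eqxx in b1.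
by rewrite (prim_order_dvd pk) bm.
Qed.

Lemma dvd5_sq (q : nat) : (0 < q)%N -> (5 %| q.-1)%N || (5 %| q.+1)%N -> (5 %| q ^ 2 - 1)%N.
Proof.
move=> q0 h; rewrite (_ : (q ^ 2 - 1)%N = (q.-1 * q.+1)%N).
  by case/orP: h => h; [rewrite dvdn_mulr | rewrite dvdn_mull].
by rewrite -(exp1n 2) subn_sqr subn1 addn1.
Qed.

(** The Frobenius of [F] fixes [b + b^-1], so it maps [b] to [b] or to [b^-1]. *)
Lemma order5_card (F E : finFieldType) (f : {rmorphism F -> E}) (p n : nat) (b : E) (t : F) :
  p \in [pchar E] -> #|F| = (p ^ n)%N -> b ^+ 5 = 1 -> b != 1 ->
  b + b^-1 = f t -> (5 %| #|F| ^ 2 - 1)%N.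
Proof.
move=> cE cF b5 b1 bt; have q0 : (0 < #|F|)%N by apply: ltnW; apply: finNzRing_gt1.
have b0 : b != 0 by apply: contra_eq_neq b5 => ->; rewrite expr0n eq_sym oner_eq0.
have fr : b ^+ #|F| + b^-1 ^+ #|F| = b + b^-1.
  have pn : [pchar E].-nat #|F|.
    by rewrite cF pnatX (pi_pnat _ cE) ?pnat_id ?(pcharf_prime cE).
  by rewrite -exprDn_pchar // bt -rmorphXn expf_card.
have fr' : (b ^+ #|F| - b) * (b ^+ #|F| - b^-1) = 0.
  have x0 : b ^+ #|F| != 0 by rewrite expf_neq0.
  transitivity (b ^+ #|F| * (b ^+ #|F| + (b ^+ #|F|)^-1 - (b + b^-1))).
    by field; rewrite x0 b0.
  by rewrite -exprVn fr subrr mulr0.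
apply: dvd5_sq => //; apply/orP; move/eqP: fr'; rewrite mulf_eq0 !subr_eq0.
case/orP=> /eqP e; [left|right]; apply: (order5_dvd b5 b1).
  by apply: (mulfI b0); rewrite -exprS prednK // e mulr1.
by rewrite exprS e mulfV.
Qed.

(** * Classification over the given field *)

Section IrreducibleF.
Variables (F : finFieldType) (p n : nat) (X : {set m2 F}).
Hypotheses (p_pr : prime p) (p_neq3 : p != 3%N) (cardF : #|F| = (p ^ n)%N).
Hypothesis sX : X \subset tri F.
Hypothesis clX : {in X &, forall x y, op2 x y \in X}.
Variables (x0 y0 : m2 F).
Hypotheses (Xx0 : x0 \in X) (Xy0 : y0 \in X) (ncxy : mul2 x0 y0 <> mul2 y0 x0).
Hypothesis irrF : ~ exists Q, forall z, z \in X -> rho z Q = Q.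

(** [irreducible_rack] applies over the extension of [split_ext]. The eigenvalues of
   an element of order 5 give the arithmetic condition of the second case. *)
Theorem irreducible_types :
  [\/ p != 2%N /\
      (rack_isomorphic (@op2 F) X (@conj_op _) (cycle123 1 ^: 'Alt_('I_4)) \/
       rack_isomorphic (@op2 F) X (@conj_op _)
         ((cycle123 1 ^: 'Alt_('I_4)) :|: ((cycle123 1)^-1%g ^: 'Alt_('I_4)))),
      (5 %| #|F| ^ 2 - 1)%N /\
      rack_isomorphic (@op2 F) X (@conj_op _) (cycle123 2 ^: 'Alt_('I_5)) |
      exists (K : finFieldType) (k : nat),
       [/\ (4 <= #|K|)%N, #|F| = (#|K| ^ k)%N &
           rack_isomorphic (@op2 F) X (@op2 K) (tri K)]].
Proof.
have [E [f splitE]] := split_ext F.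
have charF := card_finPcharP cardF p_pr.
have charE : p \in [pchar E] by rewrite (fmorph_pchar f).
pose XE := map2 f @: X.
have sXE : XE \subset tri E.
  by apply/subsetP=> _ /imsetP[x Xx ->]; rewrite map2_tri (subsetP sX).
have clXE : {in XE &, forall x y, op2 x y \in XE}.
  by move=> _ _ /imsetP[x Xx ->] /imsetP[y Xy ->]; rewrite -map2_op imset_f ?clX.
pose rX := [set rho x | x in XE].
have sGSL : <<rX>> \subset SLmap f.
  rewrite gen_subG; apply/subsetP=> _ /imsetP[_ /imsetP[x Xx ->] ->].
  by apply: imset_f; rewrite inE (X_det sX Xx).
have splitG : {in <<rX>>, forall g, (0 < #|fixpts g|)%N}.
  by move=> g /(subsetP sGSL); apply: SLmap_split.
have irrE P : exists2 x, x \in XE & rho x P != P.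
  have [/existsP[x /andP[Xx nx]]|/existsPn H] :=
    boolP [exists x, (x \in XE) && (rho x P != P)]; first by exists x.
  have dX : {in X, forall z, det2 z = 1} by move=> z; apply: X_det.
  case: irrF; apply: (fixed_descends (f := f) dX Xx0 Xy0 ncxy (P := P)).
  move=> z Xz; apply/eqP; have := H (map2 f z).
  by rewrite (imset_f (map2 f) Xz) /= => /negbNE.
have isoE : rack_isomorphic (@op2 F) X (@op2 E) XE by apply: map2_rack_iso.
have isoR : rack_isomorphic (@op2 F) X (@conj_op _) rX.
  by apply: rack_iso_trans isoE _; apply: rho_rack_iso.
have [[_ p2 [iso|iso]]|[c60 p5 iso]|[K [h [N [K4 dN eX]]]]] :=
    irreducible_rack p_pr p_neq3 charE sXE clXE splitG irrE.
- by constructor 1; split=> //; left; apply: rack_iso_trans isoR iso.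
- by constructor 1; split=> //; right; apply: rack_iso_trans isoR iso.
- constructor 2; split; last exact: rack_iso_trans isoR iso.
  have d5 : (5 %| #|<<rX>>%G|)%N by rewrite c60.
  have [g Gg og] := Cauchy (isT : prime 5) d5.
  have /imsetP[M] := subsetP sGSL g Gg; rewrite inE => /eqP dM eg.
  have /card_gt0P[P] := splitG g Gg; rewrite inE => /eqP gP.
  have dfM : det2 (map2 f M) = 1 by rewrite det_map2 dM rmorph1.
  have [a Ea] : exists a, eigen P a (map2 f M).
    by apply: fix_eig; rewrite ?dfM ?oner_eq0 // -eg.
  have a0 := eig_neq0 (det1_neq0 dfM) Ea.
  have [y [dy ey Ey]] := eigX 5 dfM Ea.
  have a10 : (a ^+ 2) ^+ 5 = 1.
    apply/eqP; rewrite -exprM mulnC exprM -(unE dy Ey) -ey -eg -og expg_order.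
    by rewrite /unip perm1 !eqxx.
  have a2 : a ^+ 2 != 1.
    rewrite -(unE dfM Ea) -eg; apply/negP=> /(un_expp charE (subsetP (irr_sGSL sXE) g Gg)).
    move/eqP; rewrite -order_dvdn og dvdn_prime2 // => /eqP e5.
    by rewrite -e5 in p5.
  apply: (@order5_card _ _ f p n (a ^+ 2) (tr2 M ^+ 2 - 2%:R)) => //.
  have ta : f (tr2 M) = a + a^-1.
    have := eig_char Ea; rewrite dfM tr_map2 => e; apply: (mulIf a0).
    by rewrite mulrDl mulVf // -expr2; apply/eqP; rewrite -subr_eq0 -oppr_eq0 -[0]e; apply/eqP; ring.
  by rewrite rmorphB rmorphXn rmorph_nat /= ta; field.
constructor 3; exists K.
have dX x : x \in X -> det2 x = 1 by apply: X_det.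
have [k ck] : exists k, #|F| = (#|K| ^ k)%N.
  apply: (@card_subfield F E K f h); apply: trace_subfield => x y Tx Ty.
  have mem z : z \in tri K -> exists2 w, w \in X & map2 h z = conj2 N (map2 f w).
    move=> Tz; have : map2 h z \in conj2 N @: XE by rewrite eX imset_f.
    by case/imsetP=> _ /imsetP[w Xw ->] ->; exists w.
  have [[v Xv ev] [w Xw ew]] := (mem x Tx, mem y Ty).
  exists (tr2 (mul2 v w)).
  by rewrite -!tr_map2 !map2M ev ew -conj2M // tr_conj2.
exists k; split=> //; apply: rack_iso_trans isoE _.
have isoC : rack_isomorphic (@op2 E) XE (@op2 E) (conj2 N @: XE).
  exists (conj2 N); split=> // [x y _ _|x y _ _]; first exact: conj2_inj.
  exact: conj2_op.
apply: rack_iso_trans isoC _; rewrite eX.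
apply: (@rack_iso_sym _ _ _ _ _ _ (one2 K)); last exact: map2_rack_iso.
by move=> x y /triP[tx dx] Ty; apply: op2_tri.
Qed.
End IrreducibleF.

(** * Triangular matrices and semidirect products *)

Section Affine.
Variable F : finFieldType.
Implicit Types (a b c d z : F).

(** The entry [a * c] makes [affM] the law of a semidirect product, because [c ^- 2]
   equals [c] for a cube root of unity. *)
Definition aff a c : m2 F := (c^-1, a * c, 0, c).

Lemma cube_neq0 c : c ^+ 3 = 1 -> c != 0.
Proof. by move=> c3; apply: contra_eq_neq c3 => ->; rewrite expr0n eq_sym oner_eq0. Qed.

Lemma affM a b c d : c ^+ 3 = 1 -> d != 0 ->
  mul2 (aff a c) (aff b d) = aff (a + c * b) (c * d).
Proof.
move=> c3 d0; have c0 := cube_neq0 c3; have cV : c^-1 = c ^+ 2.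
  by apply: (mulfI c0); rewrite mulfV // -exprS c3.
by rewrite /aff /=; congr (_, _, _, _); rewrite ?invfM ?cV; ring.
Qed.

Lemma det_aff a c : c != 0 -> det2 (aff a c) = 1.
Proof. by move=> c0; rewrite /= mulr0 subr0 mulVf. Qed.

Lemma affV a c : c ^+ 3 = 1 -> inv2 (aff a c) = aff (- (c^-1 * a)) c^-1.
Proof.
move=> c3; have c0 := cube_neq0 c3; have cV : c^-1 = c ^+ 2.
  by apply: (mulfI c0); rewrite mulfV // -exprS c3.
rewrite /aff /= invrK; congr (_, _, _, _); try ring.
rewrite cV; transitivity (- (a * (c * c ^+ 3))); last by ring.
by rewrite c3; ring.
Qed.

Lemma aff_op a b c d : c ^+ 3 = 1 -> d ^+ 3 = 1 ->
  op2 (aff a c) (aff b d) = aff ((1 - d) * a + c * b) d.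
Proof.
move=> c3 d3; have c0 := cube_neq0 c3; have d0 := cube_neq0 d3.
have cd3 : (c * d) ^+ 3 = 1 by rewrite exprMn c3 d3 mulr1.
rewrite /op2 affV // !affM ?invr_eq0 //; congr (aff _ _); last by field.
by field.
Qed.

Lemma prim_cube c : c ^+ 3 = 1 -> c != 1 -> c ^+ 2 + c + 1 = 0.
Proof.
move=> c3 c1; apply: (mulfI (_ : c - 1 != 0)); first by rewrite subr_eq0.
by rewrite mulr0; transitivity (c ^+ 3 - 1); [ring | rewrite c3 subrr].
Qed.

Lemma aff_tri a c : c ^+ 3 = 1 -> c != 1 -> aff a c \in tri F.
Proof.
move=> c3 c1; have c0 := cube_neq0 c3; apply/triP; split; last exact: det_aff.
apply: (mulIf c0); rewrite /= mulrDl mulVf //; apply/eqP.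
by rewrite -subr_eq0 -(prim_cube c3 c1); apply/eqP; ring.
Qed.

Lemma aff_inj a b c d : c != 0 -> aff a c = aff b d -> a = b /\ c = d.
Proof. by move=> c0 [_ + cd]; rewrite -cd => /(mulIf c0). Qed.

Lemma tri_aff x : x \in tri F -> rho x None = None -> 
  exists a c, [/\ x = aff a c, c ^+ 3 = 1 & c ^+ 2 + c + 1 = 0].
Proof.
move=> /triP[tx dx]; rewrite rho_None ?dx ?oner_eq0 //.
case: x tx dx => [[[a b] c] d] /= tx dx; rewrite /cls /=; case: eqP => // c0 _.
subst c; rewrite mulr0 subr0 in dx.
have d0 : d != 0 by apply: contra_eq_neq dx => ->; rewrite mulr0 eq_sym oner_eq0.
have aE : a = d^-1 by apply: (mulIf d0); rewrite dx mulVf.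
have e : d ^+ 2 + d + 1 = 0.
  apply: (mulfI (invr_neq0 d0)); rewrite mulr0.
  by transitivity (d^-1 + d + 1); [field | rewrite -aE tx; ring].
exists (b / d), d; split=> //; first by rewrite /aff divfK // aE.
by transitivity ((d ^+ 2 + d + 1) * (d - 1) + 1); [ring | rewrite e; ring].
Qed.
End Affine.

Section SdEmbed.
Variables (F : finFieldType) (C3 : {group {unit F}}) (z : {unit F}).
Variable A : finLmodType (subfield C3).
Variable ψ : A -> F.
Hypotheses (cC : #|C3| = 3%N) (Cz : z \in C3) (oz : #[z]%g = 3%N).
Hypotheses (ψD : {morph ψ : u v / u + v})
  (ψZ : forall k u, ψ (k *: u) = val k * ψ u) (ψI : injective ψ).

Definition sd_aff (x : sdprodq A) : m2 F := aff (ψ (sd_vec x)) (val (sgval (sd_unit x))).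

Lemma C3_cube c : c \in C3 -> (val c : F) ^+ 3 = 1.
Proof.
move=> Cc; have := expg_cardG Cc; rewrite cC => /(congr1 val) /= <-.
by rewrite FinRing.val_unitX.
Qed.

Lemma sd_cube (x : sdprodq A) : (val (sgval (sd_unit x)) : F) ^+ 3 = 1.
Proof. by apply: C3_cube; apply: subgP. Qed.

Lemma sd_affM x y : sd_aff (x * y)%g = mul2 (sd_aff x) (sd_aff y).
Proof.
rewrite /sd_aff affM ?sd_cube // ?(cube_neq0 (sd_cube y)) //.
by rewrite /= ψD ψZ.
Qed.

Lemma sd_aff1 : sd_aff 1%g = one2 F.
Proof.
have ψ0 : ψ 0 = 0 by apply: (addrI (ψ 0)); rewrite -ψD !addr0.
by rewrite /sd_aff /aff /= ψ0 mul0r invr1.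
Qed.

Lemma sd_affV x : sd_aff x^-1%g = inv2 (sd_aff x).
Proof.
have dx y : det2 (sd_aff y) = 1 by apply: det_aff; apply: cube_neq0 (sd_cube y).
rewrite -[LHS]mul21 -(scal12 (one2 F)) -(dx x) -mul2V mul2A -sd_affM mulVg sd_aff1.
by rewrite mul12.
Qed.

Lemma sd_aff_op x y : sd_aff (conj_op x y) = op2 (sd_aff x) (sd_aff y).
Proof. by rewrite /conj_op /op2 !sd_affM sd_affV. Qed.

Lemma sd_aff_inj : injective sd_aff.
Proof.
case=> [u c] [v d] /aff_inj[|/= /ψI -> /val_inj/val_inj -> //].
exact: cube_neq0 (sd_cube (SDPair u c)).
Qed.

Lemma sd_aff_iso (S : {set {unit F}}) :
  rack_isomorphic (@conj_op _) (sd_subset A S) (@op2 F) (sd_aff @: sd_subset A S).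
Proof.
exists sd_aff; split=> // [x y _ _|x y _ _]; first exact: sd_aff_inj.
exact: sd_aff_op.
Qed.

Lemma sd_subset_closed (S : {set {unit F}}) :
  {in sd_subset A S &, forall x y, conj_op x y \in sd_subset A S}.
Proof.
move=> x y _; rewrite !inE => Sy.
suff -> : sd_unit (conj_op x y) = sd_unit y by [].
case: x y {Sy} => [u c] [v d]; apply: val_inj; apply: val_inj => /=.
by rewrite mulrAC divff ?mul1r // -unitfE; exact: (valP (sgval c)).
Qed.

Lemma sd_aff_imset (S : {set {unit F}}) x : S \subset C3 ->
  reflect (exists a c, c \in S /\ x = aff (ψ a) (val c)) (x \in sd_aff @: sd_subset A S).
Proof.
move=> sSC; apply: (iffP imsetP) => [[[u c] + ->]|[a [c [Sc ->]]]].
  by rewrite inE => Sc; exists u, (sgval c).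
exists (SDPair a (subg C3 c)); last by rewrite /sd_aff /= subgK ?(subsetP sSC).
by rewrite inE /= subgK ?(subsetP sSC).
Qed.

Lemma sd_aff_tri (S : {set {unit F}}) : S \subset C3 -> 1%g \notin S ->
  sd_aff @: sd_subset A S \subset tri F.
Proof.
move=> sSC S1; apply/subsetP=> x /(sd_aff_imset _ sSC)[a [c [Sc ->]]].
apply: aff_tri; first by apply: C3_cube; apply: (subsetP sSC).
by apply: contra S1 => /eqP c1; rewrite (_ : 1%g = c) //; apply: val_inj; rewrite /= c1.
Qed.
End SdEmbed.

Lemma two_points (F : finFieldType) (P R : option F) : P != R -> exists N : m2 F,
  [/\ det2 N != 0, rho N None = P & rho N (Some 0) = R].
Proof.
move=> nPR; have /crs_pt k : R != P by rewrite eq_sym.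
have dN : det2 ((pt R).1, (pt R).2, (pt P).1, (pt P).2) != 0 by rewrite /= -/(cross _ _).
exists ((pt R).1, (pt R).2, (pt P).1, (pt P).2); split=> //.
  by rewrite rho_None // -surjective_pairing clsK.
by rewrite rho_Some // !mul0r !addr0 -surjective_pairing clsK.
Qed.

Section Borel.
Variables (F : finFieldType) (X : {set m2 F}) (P : option F) (x0 y0 : m2 F).
Hypothesis F3 : 3%:R != 0 :> F.
Hypothesis sX : X \subset tri F.
Hypothesis clX : {in X &, forall x y, op2 x y \in X}.
Hypothesis fixP : forall x, x \in X -> rho x P = P.
Hypotheses (Xx0 : x0 \in X) (Xy0 : y0 \in X) (ncxy : mul2 x0 y0 <> mul2 y0 x0).

(** The eigenvalues of [x0] are the two primitive cube roots of unity. *)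
Lemma second_fixed : exists2 R, R != P & rho x0 R = R.
Proof.
have [tx dx] := triP _ (subsetP sX x0 Xx0).
have [a Ea] := fix_eig (det1_neq0 dx) (fixP Xx0).
have a0 := eig_neq0 (det1_neq0 dx) Ea.
have ea : a ^+ 2 + a + 1 = 0.
  by have := eig_char Ea; rewrite dx tx => <-; ring.
have [R ER] : exists R, eigen R a^-1 x0.
  apply: char_eig; rewrite ?dx ?oner_eq0 // tx.
  apply: (mulfI (expf_neq0 2 a0)); rewrite mulr0 -[RHS]ea; field; exact: a0.
exists R; last exact: eig_fix (det1_neq0 dx) ER.
apply: contra_neq F3 => eR; rewrite eR /eigen in ER.
have e : a^-1 = a.
  move: ER; rewrite Ea; case: (P) => [t|]; rewrite /vscale /= => -[].
    by rewrite !mulr1 => /esym.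
  by rewrite !mulr1 => _ /esym.
have a2 : a ^+ 2 = 1 by rewrite expr2 -{1}e mulVf.
have aE : a = - 2%:R by apply/eqP; rewrite -addr_eq0 -ea a2; apply/eqP; ring.
by apply: (addIr 1); rewrite add0r -[in RHS]a2 aE; ring.
Qed.

(** In coordinates that put the common fixed point at infinity and another fixed
   point of [x0] at 0, [X] consists of matrices [aff a ζ], for [a] in a set [A], and
   [aff b ζ^-1], for [b] in a set [B]. Conjugations among them show that [A] is
   stable under [1 - ζ] and [ζ], then under addition, and that [B] is empty or
   equal to [A]. *)
Theorem borel_types : exists (C3 : {group {unit F}}) (z : {unit F}) (A : finLmodType (subfield C3)),
  [/\ C3 \subset squares F, #|C3| = 3%N, z \in C3 /\ #[z]%g = 3%N, (1 < #|A| <= #|F|)%N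
    & rack_isomorphic (@op2 F) X (@conj_op _) (sd_subset A [set z; z^-1%g]) \/
      rack_isomorphic (@op2 F) X (@conj_op _) (sd_subset A [set z])].
Proof.
have [R nRP fixR] := second_fixed.
have nPR : P != R by rewrite eq_sym.
have [N [dN N0 N1]] := two_points nPR.
pose X' := conj2 N @: X.
have dX x : x \in X -> det2 x = 1 by apply: X_det.
have sX' : X' \subset tri F.
  by apply/subsetP=> _ /imsetP[x Xx ->]; rewrite conj2_tri // (subsetP sX).
have clX' : {in X' &, forall x y, op2 x y \in X'}.
  by move=> _ _ /imsetP[x Xx ->] /imsetP[y Xy ->]; rewrite -conj2_op // imset_f ?clX.
have fxN x : x \in X' -> rho x None = None.
  case/imsetP=> y Xy ->; rewrite rho_conj2 // ?(dX y Xy) ?oner_eq0 //.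
  by rewrite conjgE invgK !permM N0 fixP // -N0 permK.
have [ζ ex0 [ζ3 eζ]] : exists2 ζ, conj2 N x0 = aff 0 ζ & ζ ^+ 3 = 1 /\ ζ ^+ 2 + ζ + 1 = 0.
  have Xx0' : conj2 N x0 \in X' by apply: imset_f.
  have [a [c [e c3 ec]]] := tri_aff (subsetP sX' _ Xx0') (fxN _ Xx0').
  exists c => //; rewrite e; congr (aff _ _).
  have : rho (conj2 N x0) (Some 0) = Some 0.
    rewrite rho_conj2 // ?(dX x0 Xx0) ?oner_eq0 //.
    by rewrite conjgE invgK !permM N1 fixR // -N1 permK.
  have c0 := cube_neq0 c3.
  rewrite e rho_Some ?det_aff ?oner_eq0 // /aff !mul0r !addr0 /cls /= invr_eq0 (negPf c0).
  by case=> /eqP; rewrite invrK !mulf_eq0 (negPf c0) !orbF => /eqP.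
have ζ0 := cube_neq0 ζ3.
have ζ1 : ζ != 1.
  by apply: contra_neq F3 => e; rewrite -eζ e; ring.
have ζV3 : ζ^-1 ^+ 3 = 1 by rewrite exprVn ζ3 invr1.
have ζVE : ζ^-1 = - 1 - ζ.
  apply: (mulfI ζ0); rewrite mulfV //; apply/eqP; rewrite -subr_eq0 -eζ; apply/eqP; ring.
have ζVn : ζ^-1 != ζ.
  apply: contra_neq ζ1 => e; have z2 : ζ ^+ 2 = 1 by rewrite expr2 -{1}e mulVf.
  by rewrite -ζ3 exprS z2 mulr1.
have X'E x : x \in X' -> exists a, x = aff a ζ \/ x = aff a ζ^-1.
  move=> Xx; have [a [c [-> c3 ec]]] := tri_aff (subsetP sX' _ Xx) (fxN _ Xx).
  have : (c - ζ) * (c - ζ^-1) = 0.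
    rewrite ζVE -[RHS](subrr 0) -{1}ec -eζ; ring.
  by move/eqP; rewrite mulf_eq0 !subr_eq0 => /orP[]/eqP->; exists a; [left|right].
pose A := [set a | aff a ζ \in X']; pose B := [set b | aff b ζ^-1 \in X'].
have A0 : 0 \in A by rewrite inE -ex0 imset_f.
have opAA a b : a \in A -> b \in A -> (1 - ζ) * a + ζ * b \in A.
  by rewrite !inE => Aa Ab; rewrite -aff_op // clX'.
have opAB a b : a \in A -> b \in B -> (1 - ζ^-1) * a + ζ * b \in B.
  by rewrite !inE => Aa Bb; rewrite -aff_op // clX'.
have opBA a b : a \in A -> b \in B -> (1 - ζ) * b + ζ^-1 * a \in A.
  by rewrite !inE => Aa Bb; rewrite -aff_op // clX'.
have AZ b : b \in A -> ζ * b \in A by move=> Ab; rewrite -[_ * b]add0r -(mulr0 (1 - ζ)) opAA.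
have AY a : a \in A -> (1 - ζ) * a \in A.
  by move=> Aa; rewrite -[_ * a]addr0 -(mulr0 ζ) opAA.
have surj r : r != 0 -> (forall a, a \in A -> r * a \in A) ->
    forall a, a \in A -> exists2 b, b \in A & a = r * b.
  move=> r0 rA a; have e : [set r * b | b in A] = A.
    apply/eqP; rewrite eqEcard (card_imset _ (mulfI r0)) leqnn andbT.
    by apply/subsetP=> _ /imsetP[b Ab ->]; apply: rA.
  by rewrite -{1}e; case/imsetP=> b Ab ->; exists b.
have z1n : 1 - ζ != 0 by rewrite subr_eq0 eq_sym.
have AD : {in A &, forall u v, u + v \in A}.
  move=> u v Au Av; have [a Aa ->] := surj _ z1n AY u Au.
  by have [b Ab ->] := surj _ ζ0 AZ v Av; apply: opAA.
have AN u : u \in A -> - u \in A.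
  move=> Au; have -> : - u = ζ * u + ζ * (ζ * u).
    by rewrite -[LHS]add0r -(mul0r u) -eζ; ring.
  by rewrite AD ?AZ.
have zu : ζ \is a GRing.unit by rewrite unitfE.
pose z : {unit F} := FinRing.unit F zu.
have z3 : (z ^+ 3 = 1)%g by apply: val_inj; rewrite FinRing.val_unitX.
have oz : #[z]%g = 3%N.
  by apply: nt_prime_order => //; apply: contra ζ1 => /eqP/(congr1 val)/= ->.
pose C3 := <[z]>%G.
have Cz : z \in C3 by apply: cycle_id.
have zVz : (z^-1 = z ^+ 2)%g by apply: (mulgI z); rewrite mulgV -expgS z3.
have CP c : c \in C3 -> [\/ c = 1%g, c = z | c = z^-1%g].
  move=> /cyclePmin[i + ->]; rewrite oz; case: i => [|[|[|]]] // _.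
  - by constructor 1.
  - by constructor 2.
  by constructor 3; rewrite zVz.
pose R' := [set r | [forall a in A, r * a \in A]].
have RP r : reflect {in A, forall a, r * a \in A} (r \in R') by rewrite inE; apply: forall_inP.
have subR : is_subfield R'.
  apply/and3P; split; first by apply/RP=> a; rewrite mul1r.
    apply/forall_inP=> r /RP Rr; apply/forall_inP=> t /RP Rt; apply/RP=> a Aa.
    by rewrite mulrBl AD ?AN ?Rr ?Rt.
  apply/forall_inP=> r /RP Rr; apply/forall_inP=> t /RP Rt; apply/RP=> a Aa.
  rewrite -mulrA; apply: Rr; have [->|t0] := eqVneq t 0; first by rewrite invr0 mul0r.
  by have [b Ab ->] := surj t t0 Rt a Aa; rewrite mulKf.
have genR k : k \in gen_subfield C3 -> k \in R'.
  apply/subsetP/bigcap_inf; rewrite subR /=; apply/forall_inP=> c /CP[]->; apply/RP=> a Aa.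
  - by rewrite mul1r.
  - exact: AZ.
  by rewrite /= ζVE mulrBl mulN1r AD ?AN ?AZ.
have scA (k : subfield C3) : {in A, forall v, val k * v \in A}.
  by move=> v Av; apply: (RP _ _) => //; apply: genR; case: k.
have [||||d [ψ [ψD ψZ ψI ψA]]] :=
  @subspace_basis (subfield C3) F (fun k v => val k * v) _ _ _ _ A A0 AD scA.
- by move=> a u v; rewrite mulrDr.
- by move=> a b v; rewrite /= mulrDl.
- by move=> a b v; rewrite /= mulrA.
- by move=> v; rewrite /= mul1r.
pose A' : finLmodType (subfield C3) := 'rV[subfield C3]_d.
have AP a : reflect (exists u, a = ψ u) (a \in A).
  rewrite -ψA; apply: (iffP imsetP) => [[u _ ->]|[u ->]]; first by exists u.
  by exists u; rewrite ?inE.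
have cA : #|A'| = #|A| by rewrite -ψA card_imset // cardsT.
have nA : (1 < #|A|)%N.
  rewrite ltnNge; apply/negP=> cA1; have A_0 a : a \in A -> a = 0.
    have <- : [set 0] = A by apply/eqP; rewrite eqEcard sub1set A0 cards1.
    by move/set1P.
  have c0 x : x \in X' -> x = aff 0 ζ \/ x = aff 0 ζ^-1.
    move=> Xx; have [a [e|e]] := X'E x Xx.
      by left; rewrite e (A_0 a) // inE -e.
    right; rewrite e; congr (aff _ _); have Bb : a \in B by rewrite inE -e.
    have := A_0 _ (opBA 0 a A0 Bb); rewrite mulr0 addr0 => /eqP.
    by rewrite mulf_eq0 (negPf z1n) => /eqP.
  apply: ncxy; apply: (conj2_inj dN); rewrite !conj2M //.
  have [|] := c0 (conj2 N x0) (imset_f _ Xx0) => ->;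
    have [|] := c0 (conj2 N y0) (imset_f _ Xy0) => ->;
    by rewrite /aff /=; congr (_, _, _, _); ring.
have iso : rack_isomorphic (@op2 F) X (@op2 F) X'.
  exists (conj2 N); split=> // [x y _ _|x y _ _]; first exact: conj2_inj.
  exact: conj2_op.
have cC : #|C3| = 3%N by rewrite -oz.
exists C3, z, A'; split=> //.
- apply/subsetP=> c Cc; apply/imsetP; exists (c ^+ 2)%g => //.
  have c3 : (c ^+ 3 = 1)%g by rewrite -cC expg_cardG.
  by rewrite -expgM (expgS c 3) c3 mulg1.
- by rewrite cA nA max_card.
have fin (S : {set {unit F}}) : S \subset C3 -> (X' = sd_aff ψ @: sd_subset A' S) ->
    rack_isomorphic (@op2 F) X (@conj_op _) (sd_subset A' S).
  move=> sS eX; apply: rack_iso_trans iso _; rewrite eX.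
  apply: (@rack_iso_sym _ _ _ _ _ _ 1%g); last exact: sd_aff_iso.
  exact: sd_subset_closed.
have sz : [set z] \subset C3 by rewrite sub1set.
have szz : [set z; z^-1%g] \subset C3 by rewrite subUset !sub1set groupV Cz.
have [B0|[b0 Bb0]] := set_0Vmem B.
  right; apply: fin => //; apply/setP=> x; apply/idP/(sd_aff_imset _ _ sz).
    move=> Xx; have [a [e|e]] := X'E x Xx; last first.
      by have := in_set0 a; rewrite -B0 inE -e Xx.
    have /AP[u eu] : a \in A by rewrite inE -e.
    by exists u, z; rewrite inE eqxx e eu.
  by case=> u [c [/set1P -> ->]]; have : ψ u \in A; [apply/AP; exists u | rewrite inE].
(* both classes occur, and then their translation parts coincide *)
have BA : B \subset A.
  apply/subsetP=> b Bb; have := opBA 0 b A0 Bb; rewrite mulr0 addr0.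
  by case/(surj _ z1n AY)=> a Aa /(mulfI z1n) ->.
have eB : B = A.
  apply/eqP; rewrite eqEcard BA /=.
  have zV1 : 1 - ζ^-1 != 0.
    by rewrite subr_eq0 eq_sym; apply: contra ζ1 => /eqP e; rewrite -[ζ]invrK e invr1.
  rewrite -(card_imset _ (mulfI zV1)) -(card_imset _ (addIr (ζ * b0))) -imset_comp.
  by apply/subset_leq_card/subsetP=> _ /imsetP[a Aa ->] /=; apply: opAB.
left; apply: fin => //; apply/setP=> x; apply/idP/(sd_aff_imset _ _ szz).
  move=> Xx; have [a [e|e]] := X'E x Xx.
    have /AP[u eu] : a \in A by rewrite inE -e.
    by exists u, z; rewrite !inE eqxx e eu.
  have /AP[u eu] : a \in A by rewrite -eB inE -e.
  by exists u, z^-1%g; rewrite !inE eqxx orbT e eu.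
have Aψ u : ψ u \in A by apply/AP; exists u.
case=> u [c [/set2P[->|->] ->]].
  by have := Aψ u; rewrite inE.
by have := Aψ u; rewrite -eB inE.
Qed.
End Borel.

(** * All subracks of the class *)

Section Commuting.
Variable F : finFieldType.
Hypothesis F3 : 3%:R != 0 :> F.

(** The centralizer of the companion matrix [C] consists of its polynomials
   [s + t * C], and only [C] and [C^-1] among them have trace -1 and
   determinant 1. *)
Lemma commuting_tri (x y : m2 F) : x \in tri F -> y \in tri F ->
  mul2 x y = mul2 y x -> x = y \/ x = inv2 y.
Proof.
move=> Tx Ty cxy; have [M dM eM] := tri_companion F3 Ty.
have dM0 : det2 M != 0 by rewrite dM oner_eq0.
pose C : m2 F := (0, 1, -1, -1).
have cy : conj2 M y = C by rewrite /conj2 dM invr1 scal12 eM -mul2A mul2V dM scal12 mul21.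
have : mul2 (conj2 M x) C = mul2 C (conj2 M x).
  by rewrite -cy -!conj2M // cxy.
have : conj2 M x \in tri F by rewrite conj2_tri.
suff key u : u \in tri F -> mul2 u C = mul2 C u -> u = C \/ u = inv2 C.
  move=> Tu /(key _ Tu); rewrite -cy -conj2V //.
  by case=> /(conj2_inj dM0); [left | right].
case: u => [[[a b] c] d] /tri_bc[-> bc] [].
rewrite !mulr0 !mulr1 !mulrN1 !mul0r !mul1r !mulN1r !add0r => e1 e2 e3 e4.
have ec : c = - b by rewrite e1; ring.
have eb : b = 2%:R * a + 1.
  by apply: (addIr (a - b)); rewrite addrCA subrr addr0 e2; ring.
have : 3%:R * (a * (a + 1)) = 0.
  have := bc; rewrite ec eb => e.
  transitivity (- ((2%:R * a + 1) * - (2%:R * a + 1)) + (- a ^+ 2 - a - 1)); first by ring.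
  by rewrite -e; ring.
move/eqP; rewrite !mulf_eq0 (negPf F3) /= addr_eq0 => /orP[]/eqP ea.
  by left; rewrite ec eb ea /C; congr (_, _, _, _); ring.
by right; rewrite ec eb ea /C /=; congr (_, _, _, _); ring.
Qed.
End Commuting.

Section CardTri.
Variable K : finFieldType.

(** An element of [tri K] with non-zero lower left entry is determined by its first
   column. *)
Let big (u : K * K) : m2 K := (u.1, (- u.1 ^+ 2 - u.1 - 1) / u.2, u.2, -1 - u.1).
Let bigS := [set big u | u in setX [set: K] [set~ 0]].

Lemma card_tri_big : #|bigS| = (#|K| * #|K|.-1)%N.
Proof.
rewrite card_imset; last by move=> [a c] [a' c'] [-> _ ->].
rewrite cardsX cardsT; congr (_ * _)%N.
by rewrite cardsC1.
Qed.

Lemma tri_big : bigS \subset tri K.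
Proof.
apply/subsetP=> _ /imsetP[[a c] /setXP[_ ac] ->]; have c0 := ac; rewrite in_setC1 /= in c0.
by apply/triP; split=> /=; [ring | rewrite divfK //; ring].
Qed.

Lemma card_tri_ge : (#|K| * #|K|.-1 <= #|tri K|)%N.
Proof. by rewrite -card_tri_big subset_leq_card ?tri_big. Qed.

Lemma card_tri_split (c : K) : c ^+ 3 = 1 -> c != 1 -> (#|K| * #|K|.+1 <= #|tri K|)%N.
Proof.
move=> c3 c1; have c0 := cube_neq0 c3.
have cV3 : c^-1 ^+ 3 = 1 by rewrite exprVn c3 invr1.
have cV1 : c^-1 != 1 by rewrite invr_eq1.
have ccV : c != c^-1.
  apply: contra_neq c1 => e; have c2 : c ^+ 2 = 1 by rewrite expr2 {2}e mulfV.
  by rewrite -c3 exprS c2 mulr1.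
pose S d := [set aff a d | a : K].
have cS d : d ^+ 3 = 1 -> #|S d| = #|K|.
  by move=> d3; rewrite card_imset // => a b /(aff_inj (cube_neq0 d3))[].
have disj : [disjoint S c & S c^-1].
  apply/pred0P=> x; apply/negP=> /andP[/imsetP[a _ ->] /imsetP[b _ e]].
  by have [_ /eqP] := aff_inj c0 e; rewrite (negPf ccV).
have disj2 : [disjoint bigS & S c :|: S c^-1].
  apply/pred0P=> x; apply/negP=> /andP[/imsetP[[a d] /setXP[_ d0] ->]].
  rewrite in_setC1 in d0; move=> /setUP[]/imsetP[b _ [_ _ e _]];
  by move: d0; rewrite /= e eqxx.
have : (#|bigS :|: (S c :|: S c^-1)| <= #|tri K|)%N.
  apply: subset_leq_card; rewrite !subUset tri_big /=; apply/andP; split;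
  by apply/subsetP=> _ /imsetP[a _ ->]; apply: aff_tri.
apply: leq_trans; rewrite cardsU disjoint_setI0 // cards0 subn0.
rewrite cardsU [S c :&: _]disjoint_setI0 // cards0 subn0 !cS // card_tri_big.
by rewrite addnn -muln2 -mulnDr; have := finNzRing_gt1 K; case: #|K| => // k _; rewrite addn2.
Qed.
End CardTri.

(** The centralizer of a 3-cycle contains its three powers. *)
Lemma class_Alt5_le20 : (#|cycle123 2 ^: 'Alt_('I_5)| <= 20)%N.
Proof.
have cA : #|'Alt_('I_5)| = 60%N.
  have : (2 * #|'Alt_('I_5)| = 120)%N by rewrite card_Alt card_ord.
  by lia.
set c := cycle123 2; have Ac : c \in 'Alt_('I_5) := cycle123_Alt 2.
rewrite -index_cent1 -(leq_pmul2l (cardG_gt0 ('C_('Alt_('I_5))[c])%G)).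
rewrite Lagrange ?subsetIl // cA (_ : 60 = 3 * 20)%N // leq_mul2r /=.
apply: leq_trans (_ : #[c]%g <= _)%N; first by rewrite order_cycle123.
rewrite orderE subset_leq_card // cycle_subG inE Ac; exact: cent1id.
Qed.

Section F4.
Variable K : finFieldType.
Hypothesis K4 : #|K| = 4%N.

Lemma card4_cube : exists2 c : K, c ^+ 3 = 1 & c != 1.
Proof.
have d3 : (3 %| #|[set: {unit K}]%G|)%N by rewrite card_finField_unit K4.
have [u _ ou] := Cauchy (isT : prime 3) d3.
exists (val u); first by rewrite -FinRing.val_unitX -ou expg_order.
apply: contra_eq_neq ou => u1; rewrite (_ : u = 1%g) ?order1 //.
exact: val_inj.
Qed.

Lemma card4_char2 : 2 \in [pchar K].
Proof. exact: (card_finPcharP (K4 : #|K| = (2 ^ 2)%N) isT). Qed.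

Lemma card4_3neq0 : 3%:R != 0 :> K.
Proof. by rewrite -(dvdn_pcharf card4_char2). Qed.

(** [SL2 K] acts on the five points of the projective line. Matrices of [tri K] act by
   3-cycles, faithfully, and both sides have twenty elements. *)
Lemma tri_card4 : rack_isomorphic (@op2 K) (tri K) (@conj_op _) (cycle123 2 ^: 'Alt_('I_5)).
Proof.
pose rX := [set rho x | x in tri K].
apply: rack_iso_trans (rho_rack_iso (subxx _)) _; rewrite -/rX.
have c5 : #|[set: option K]| = 5%N by rewrite cardsT card_option K4.
have actT : [acts [set: {perm option K}], on [set: option K] | 'P].
  by apply/actsP=> g _ P; rewrite !inE.
have [f [h [inj_h hS hP fE]]] := act_Sn actT c5.
have fM : {in <<rX>> &, {morph f : x y / x * y}}%g.
  move=> x y _ _ /=; apply/permP=> i; apply: inj_h.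
  by rewrite permM !fE ?inE // actM.
have fI : {in <<rX>>, forall g, f g = 1%g -> g = 1%g}.
  move=> g _ fg1; apply/permP=> P; have [i ->] := hP P (in_setT P).
  by rewrite perm1 -[g _]/('P%act (h i) g) -fE ?inE // fg1 perm1.
suff <- : f @: rX = cycle123 2 ^: 'Alt_('I_5) by apply: rack_iso_image fM fI.
have rX3 : {in rX, forall x, (x ^+ 3 = 1)%g}.
  by move=> _ /imsetP[x Tx ->]; apply: rho_tri3.
have sub : f @: rX \subset cycle123 2 ^: 'Alt_('I_5).
  apply/subsetP=> s Xs; apply: ord3_Alt5.
    exact: rack_image_ord3 rX3 fM _ Xs.
  case/imsetP: Xs => g Xg ->; have /imsetP[x Tx eg] := Xg.
  apply: contra (rho_tri_neq1 card4_3neq0 Tx) => /eqP/fI; rewrite -eg => -> //.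
  exact: mem_gen.
apply/eqP; rewrite eqEcard sub; apply: leq_trans class_Alt5_le20 _.
have fX : {in rX &, injective f}.
  move=> x y Xx Xy; apply: (f_injG (X := rX) fM fI); exact: mem_gen.
rewrite card_in_imset // card_in_imset; last exact: rho_tri_inj.
by have [c c3 c1] := card4_cube; have := card_tri_split c3 c1; rewrite K4.
Qed.
End F4.

Lemma dvd5_pow4 k : (5 %| (4 ^ k) ^ 2 - 1)%N.
Proof.
rewrite -expnM mulnC expnM; elim: k => [|k IHk]; first by [].
by rewrite expnS; move: IHk; have := expn_gt0 (4 ^ 2) k; move: ((4 ^ 2) ^ k)%N => m; lia.
Qed.

Section TriTypes.
Variables (F : finFieldType) (p n : nat) (X : {set m2 F}).
Hypotheses (p_pr : prime p) (p_neq3 : p != 3%N) (cardF : #|F| = (p ^ n)%N).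
Hypothesis sX : X \subset tri F.
Hypothesis clX : {in X &, forall x y, op2 x y \in X}.
Hypothesis X0 : X != set0.

Lemma char3 : 3%:R != 0 :> F.
Proof. exact: char_3neq0 p_pr p_neq3 (card_finPcharP cardF p_pr). Qed.

(** A field of four elements is listed under the alternating group of degree 5, by
   [tri_card4]. *)
Theorem tri_rack_types :
  #|X| = 1%N \/
  (exists2 y, y \in X & X = [set y; inv2 y]) \/
  (odd #|F| /\
    (rack_isomorphic (@op2 F) X (@conj_op _) (cycle123 1 ^: 'Alt_('I_4)) \/
     rack_isomorphic (@op2 F) X (@conj_op _)
         ((cycle123 1 ^: 'Alt_('I_4)) :|: ((cycle123 1)^-1%g ^: 'Alt_('I_4))))) \/
  ((5 %| #|F| ^ 2 - 1)%N /\
      rack_isomorphic (@op2 F) X (@conj_op _) (cycle123 2 ^: 'Alt_('I_5))) \/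
  (exists (C3 : {group {unit F}}) (z : {unit F}) (A : finLmodType (subfield C3)),
  [/\ C3 \subset squares F, #|C3| = 3%N, z \in C3 /\ #[z]%g = 3%N, (1 < #|A| <= #|F|)%N
    & rack_isomorphic (@op2 F) X (@conj_op _) (sd_subset A [set z; z^-1%g]) \/
      rack_isomorphic (@op2 F) X (@conj_op _) (sd_subset A [set z])]) \/
  (exists (K : finFieldType) (k : nat),
       [/\ (4 < #|K|)%N, #|F| = (#|K| ^ k)%N &
           rack_isomorphic (@op2 F) X (@op2 K) (tri K)]).
Proof.
have F3 := char3.
have [/forall_inP com|] := boolP [forall x in X, forall y in X, mul2 x y == mul2 y x].
  have [y Xy] := set0Pn _ X0.
  have sub : X \subset [set y; inv2 y].
    apply/subsetP=> x Xx; have /forall_inP/(_ y Xy)/eqP c := com x Xx.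
    have [||->|->] := commuting_tri F3 _ _ c; rewrite ?(subsetP sX) // !inE eqxx ?orbT //.
  have [Xi|Xi] := boolP (inv2 y \in X).
    right; left; exists y => //; apply/eqP; rewrite eqEsubset sub.
    by apply/subsetP=> x /set2P[]->.
  left; suff -> : X = [set y] by rewrite cards1.
  apply/setP=> x; apply/idP/set1P=> [Xx|->//].
  by have /set2P[//|e] := subsetP sub x Xx; rewrite -e Xx in Xi.
case/forall_inPn=> x0 Xx0 /forall_inPn[y0 Xy0 /eqP nc]; right; right.
have [/existsP[Q /forall_inP fQ]|nQ] := boolP [exists Q, [forall z in X, rho z Q == Q]].
  do 2!right; left; apply: (@borel_types F X Q x0 y0) => //.
  by move=> x Xx; apply/eqP/fQ.
have irrF : ~ exists Q, forall z, z \in X -> rho z Q = Q.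
  case=> Q fQ; case/existsP: nQ; exists Q; apply/forall_inP=> z Xz.
  by rewrite fQ.
have [[p2 iso]|[d5 iso]|[K [k [K4 cF iso]]]] :=
   irreducible_types p_pr p_neq3 cardF sX clX Xx0 Xy0 nc irrF.
- left; split=> //; rewrite cardF oddX; apply/orP; right.
  by have [|//] := even_prime p_pr => e; rewrite e in p2.
- by right; left.
have [K5|K5] := leqP #|K| 4; last by do 3!right; exists K, k.
have eK : #|K| = 4%N by apply/eqP; rewrite eqn_leq K5.
right; left; split; first by rewrite cF eK dvd5_pow4.
exact: rack_iso_trans iso (tri_card4 eK).
Qed.
End TriTypes.

(** * Elements of order three of PSL2 *)

Section Interface.
Variable F : finFieldType.
Implicit Types (x y : m2 F) (g h : {'GL_2[F]}).

Definition mx2 x : 'M[F]_2 :=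
  \matrix_(i < 2, j < 2) let: (a, b, c, d) := x in
    if i == 0 then if j == 0 then a else b else if j == 0 then c else d.
Definition quad (M : 'M[F]_2) : m2 F := (M 0 0, M 0 1, M 1 0, M 1 1).

Lemma mx2K : cancel mx2 quad.
Proof. by case=> [[[a b] c] d]; rewrite /quad !mxE. Qed.

Lemma quadK : cancel quad mx2.
Proof.
move=> M; apply/matrixP=> i j; rewrite mxE.
case: i => [[|[|//]] li]; case: j => [[|[|//]] lj] /=; congr (M _ _); exact: val_inj.
Qed.

Lemma quadM (M N : 'M[F]_2) : quad (M *m N) = mul2 (quad M) (quad N).
Proof. by rewrite /quad !mxE !big_ord_recl !big_ord0 !addr0 (_ : lift _ _ = 1) //; apply: val_inj. Qed.

Lemma det_quad (M : 'M[F]_2) : \det M = det2 (quad M).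
Proof.
rewrite (expand_det_row _ 0) !big_ord_recl big_ord0 addr0 (_ : lift 0 0 = 1); last exact: val_inj.
rewrite /cofactor !det_mx11 !mxE /= expr0 expr1 mul1r mulN1r mulrN.
by congr (_ * M _ _ - _ * M _ _); apply: val_inj.
Qed.

Lemma row_quad (v : 'rV[F]_2) (M : 'M[F]_2) :
  (((v *m M) 0 0), ((v *m M) 0 1)) = vmul (v 0 0, v 0 1) (quad M).
Proof. by rewrite !mxE !big_ord_recl !big_ord0 !addr0 (_ : lift _ _ = 1) //; apply: val_inj. Qed.

Definition gl x : {'GL_2[F]} := insubd (1%g : {'GL_2[F]}) (mx2 x).

Lemma glE x : det2 x = 1 -> GLval (gl x) = mx2 x.
Proof. by move=> dx; rewrite /gl val_insubd unitmxE det_quad mx2K dx unitr1. Qed.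

Lemma quad_gl x : det2 x = 1 -> quad (GLval (gl x)) = x.
Proof. by move=> dx; rewrite glE // mx2K. Qed.

Lemma quad_inj g h : quad (GLval g) = quad (GLval h) -> g = h.
Proof. by move/(can_inj quadK) => e; apply: val_inj. Qed.

Lemma quad_GLM g h : quad (GLval (g * h)%g) = mul2 (quad (GLval g)) (quad (GLval h)).
Proof. by rewrite GL_MxE quadM. Qed.

Lemma SL2E g : (g \in SL2 F) = (det2 (quad (GLval g)) == 1).
Proof. by rewrite inE det_quad. Qed.

Lemma gl_SL2 x : det2 x = 1 -> gl x \in SL2 F.
Proof. by move=> dx; rewrite SL2E quad_gl // dx. Qed.

Lemma glM x y : det2 x = 1 -> det2 y = 1 -> gl (mul2 x y) = (gl x * gl y)%g.
Proof.
by move=> dx dy; apply: quad_inj; rewrite quad_GLM !quad_gl // det2M dx dy mulr1.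
Qed.

Lemma gl_quad g : g \in SL2 F -> gl (quad (GLval g)) = g.
Proof. by rewrite SL2E => /eqP dg; apply: quad_inj; rewrite quad_gl. Qed.

Lemma scal_commute a x : mul2 (scal2 a (one2 F)) x = mul2 x (scal2 a (one2 F)).
Proof. by rewrite scal2M scal2Mr mul12 mul21. Qed.

Lemma gl_center x : det2 x = 1 ->
  (gl x \in 'Z(SL2 F)) <-> exists a, x = scal2 a (one2 F).
Proof.
move=> dx; split=> [/SL2_center_scalar[a _ e]|[a e]].
  exists a; rewrite -(quad_gl dx) e /quad !mxE /= !mulr0 !mulr1.
  by rewrite !mulr1n !mulr0n.
apply/centerP; split=> [|g Sg]; first exact: gl_SL2.
by apply: quad_inj; rewrite !quad_GLM quad_gl // e scal_commute.
Qed.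

Local Notation Z := ('Z(SL2 F))%g.

(** Meaningful for matrices of determinant 1. *)
Definition psl x : coset_of Z := coset Z (gl x).

Lemma SL2_normZ g : g \in SL2 F -> g \in 'N(Z)%g.
Proof. exact: (subsetP (normal_norm (center_normal (SL2_group F)))). Qed.

Lemma gl_normZ x : det2 x = 1 -> gl x \in 'N(Z)%g.
Proof. by move=> dx; rewrite SL2_normZ ?gl_SL2. Qed.

Lemma psl_PSL2 x : det2 x = 1 -> psl x \in PSL2 F.
Proof. by move=> dx; apply: mem_quotient; apply: gl_SL2. Qed.

Lemma PSL2P (u : coset_of Z) : u \in PSL2 F -> exists2 x, det2 x = 1 & u = psl x.
Proof.
case/morphimP=> g _ Sg ->; exists (quad (GLval g)); last by rewrite /psl gl_quad.
by move: Sg; rewrite SL2E => /eqP.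
Qed.

Lemma pslM x y : det2 x = 1 -> det2 y = 1 -> psl (mul2 x y) = (psl x * psl y)%g.
Proof. by move=> dx dy; rewrite /psl glM // morphM ?gl_normZ. Qed.

Lemma psl_eq1 x : det2 x = 1 -> (psl x = 1%g) <-> exists a, x = scal2 a (one2 F).
Proof.
move=> dx; rewrite -gl_center // /psl; split=> [e|]; last exact: coset_id.
by rewrite coset_idr // gl_normZ.
Qed.

Lemma psl1 : psl (one2 F) = 1%g.
Proof. by apply/psl_eq1; [rewrite det21 | exists 1; rewrite scal12]. Qed.

Lemma pslV x : det2 x = 1 -> psl (inv2 x) = (psl x)^-1%g.
Proof.
move=> dx; apply/eqP; rewrite eq_mulgV1 invgK -pslM ?det2V // mulV2 dx scal12.
by rewrite psl1.
Qed.

Lemma psl_op x y : det2 x = 1 -> det2 y = 1 -> psl (op2 x y) = conj_op (psl x) (psl y).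
Proof. by move=> dx dy; rewrite /op2 /conj_op !pslM ?pslV ?det2M ?det2V ?dx ?dy ?mulr1. Qed.

Hypothesis F3 : 3%:R != 0 :> F.

Lemma psl_tri_inj : {in tri F &, injective psl}.
Proof.
move=> x y /triP[tx dx] /triP[ty dy] e.
have dxy : det2 (mul2 x (inv2 y)) = 1 by rewrite det2M det2V dx dy mulr1.
have [a ea] : exists a, mul2 x (inv2 y) = scal2 a (one2 F).
  by apply/psl_eq1; rewrite // pslM ?pslV ?det2V // e mulgV.
have ex : x = scal2 a y.
  by rewrite -[x]mul21 -(scal12 (one2 F)) -dy -mulV2 mul2A ea scal2M mul12.
have a1 : a = 1 by apply: oppr_inj; rewrite -[RHS]tx ex tr2Z ty mulrN1.
by rewrite ex a1 scal12.
Qed.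

Lemma order_psl_tri x : x \in tri F -> #[psl x]%g = 3%N.
Proof.
move=> Tx; have [_ dx] := triP _ Tx; apply: nt_prime_order => //.
  by rewrite !expgS expg0 mulg1 -!pslM ?det2M ?dx ?mulr1 // tri_cube // psl1.
by apply/eqP=> /(psl_eq1 dx)[a e]; case: (@tri_not_scalar F F3 a); rewrite -e.
Qed.

(** An element of order three lifts to [x] with [x ^+ 3] scalar. As [x] is not
   scalar, Cayley-Hamilton forces [tr2 x ^+ 2 = 1], and [-x] lifts it as well. *)
Lemma order3E : order3 F = psl @: tri F.
Proof.
apply/setP=> u; apply/idP/imsetP=> [|[x Tx ->]]; last first.
  by rewrite inE order_psl_tri // psl_PSL2 //; case/triP: Tx.
rewrite inE => /andP[/PSL2P[x dx ->]] /eqP o3.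
have [a ea] : exists a, mul2 x (mul2 x x) = scal2 a (one2 F).
  apply/psl_eq1; first by rewrite !det2M dx !mulr1.
  rewrite !pslM ?det2M ?dx ?mulr1 //.
  by have := expg_order (psl x); rewrite o3 !expgS expg0 mulg1.
have nx : ~ exists a, x = scal2 a (one2 F).
  by move/(psl_eq1 dx) => e; move: o3; rewrite e order1.
have CH : (tr2 x ^+ 2 - 1 = 0).
  case: x dx nx ea {o3} => [[[s b] c] d] /= dx nx [e1 e2 e3 e4].
  have [//|t0] := eqVneq ((s + d) ^+ 2 - 1) 0; case: nx.
  have bt : b * ((s + d) ^+ 2 - (s * d - b * c)) = 0 by rewrite -[RHS](mulr0 a) -e2; ring.
  have ct : c * ((s + d) ^+ 2 - (s * d - b * c)) = 0 by rewrite -[RHS](mulr0 a) -e3; ring.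
  have st : (s - d) * ((s + d) ^+ 2 - (s * d - b * c)) = 0.
    by rewrite -(subrr (a * 1)) -{1}e1 -e4; ring.
  move: bt ct st => /eqP + /eqP + /eqP; rewrite dx !mulf_eq0 !(negPf t0) !orbF.
  move=> /eqP-> /eqP-> /eqP e; exists s; rewrite mulr1 mulr0; congr (_, _, _, _).
  by apply/esym/eqP; rewrite -subr_eq0; apply/eqP.
move/eqP: CH; rewrite subr_eq0 sqrf_eq1 => /orP[]/eqP tx; last by exists x => //; apply/triP.
have d1 : det2 (scal2 (-1) (one2 F)) = 1 by rewrite det2Z det21; ring.
have dN : det2 (scal2 (-1) x) = 1 by rewrite det2Z dx; ring.
exists (scal2 (-1) x); first by apply/triP; rewrite tr2Z tx mulr1.
rewrite -[x in RHS]mul12 -scal2M pslM //.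
by rewrite (proj2 (psl_eq1 d1)) ?mul1g //; exists (-1).
Qed.

Lemma psl_rack_iso (X : {set m2 F}) : X \subset tri F ->
  rack_isomorphic (@op2 F) X (@conj_op _) (psl @: X).
Proof.
move=> sX; exists psl; split=> // [x y Xx Xy|x y Xx Xy].
  by apply: psl_tri_inj; apply: (subsetP sX).
by apply: psl_op; [case/triP: (subsetP sX x Xx) | case/triP: (subsetP sX y Xy)].
Qed.

Lemma order3_class : order3 F \in classes (PSL2 F).
Proof.
have T0 : (0, 1, -1, -1) \in tri F by apply/triP; split=> /=; ring.
have [_ d0] := triP _ T0.
apply/imsetP; exists (psl (0, 1, -1, -1)); first by apply: psl_PSL2.
rewrite order3E; apply/setP=> u; apply/imsetP/imsetP=> [[x Tx ->]|[_ /PSL2P[M dM ->] ->]].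
  have [M dM eM] := tri_conj F3 Tx T0; have [_ dx] := triP _ Tx.
  exists (psl M); first exact: psl_PSL2.
  by apply: (mulgI (psl M)); rewrite -conjgC -!pslM // eM.
exists (op2 (inv2 M) (0, 1, -1, -1)); first by apply: op2_tri; rewrite ?det2V.
by rewrite psl_op ?det2V // pslV // conj_opE invgK.
Qed.

Lemma order3_neq1 : order3 F != [set 1%g].
Proof. by apply/eqP=> /setP/(_ 1%g); rewrite set11 inE order1 andbF. Qed.

Definition line P : {set 'rV[F]_2} := rowg (\row_j (if j == 0 then (pt P).1 else (pt P).2)).

Let row (v : F * F) : 'rV[F]_2 := \row_j (if j == 0 then v.1 else v.2).

Let rowE (v : 'rV[F]_2) : v = row (v 0 0, v 0 1).
Proof.
apply/rowP=> j; rewrite mxE; case: j => [[|[|//]] lj] /=; congr (v _ _); exact: val_inj.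
Qed.

Let row_inj : injective row.
Proof. by move=> [a b] [c d] /rowP e; have := e 0; have := e 1; rewrite !mxE /= => -> ->. Qed.

Let rowZ s v : row (vscale s v) = s *: row v.
Proof. by apply/rowP=> j; rewrite !mxE; case: ifP. Qed.

Let row_neq0 v : v <> (0, 0) -> row v != 0.
Proof.
by move=> nz; apply/eqP=> e; apply: nz; apply: row_inj; rewrite e; apply/rowP=> j; rewrite !mxE if_same.
Qed.

Let rowM v x : row v *m mx2 x = row (vmul v x).
Proof. by rewrite [LHS]rowE row_quad mx2K !mxE -surjective_pairing. Qed.

Let rowg_row v : v <> (0, 0) -> rowg (row v) = line (cls v).
Proof.
move=> nz; have [s s0 e] := clsE nz; rewrite {1}e rowZ.
by apply: eq_rowg; apply: eqmx_scale.
Qed.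

Lemma line_inj : injective line.
Proof.
move=> P Q e; have : row (pt P) \in line Q by rewrite -e mem_rowg.
rewrite mem_rowg => /sub_rVP[s]; rewrite -rowZ => /row_inj eP.
rewrite -(clsK P) -(clsK Q) eP clsZ //.
by apply/eqP=> s0; apply: (@pt_neq0 _ P); rewrite eP s0 /vscale !mul0r.
Qed.

Lemma proj_lineE : proj_line F = [set line P | P : option F].
Proof.
apply/setP=> L; apply/imsetP/imsetP=> [[v v0 ->]|[P _ ->]].
  exists (cls (v 0 0, v 0 1)); rewrite // {1}[v]rowE rowg_row // => e.
  move: v0; rewrite inE [v]rowE e => /eqP[]; by apply/rowP=> j; rewrite !mxE if_same.
by exists (row (pt P)); rewrite // inE row_neq0 //; apply: pt_neq0.
Qed.

Lemma proj_act_line x P : det2 x = 1 -> proj_act F (line P) (psl x) = line (rho x P).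
Proof.
move=> dx; have dx0 := det1_neq0 dx.
rewrite proj_actE ?gl_SL2 // ?proj_lineE ?imset_f // glE //.
rewrite rhoE // /act2 -rowg_row; last by move/(vmul_eq0 dx0); apply: pt_neq0.
apply/setP=> v; rewrite mem_rowg; apply/imsetP/sub_rVP=> [[w + ->]|[s ->]].
  by rewrite mem_rowg => /sub_rVP[s ->]; exists s; rewrite -scalemxAl rowM.
by exists (s *: row (pt P)); rewrite ?mem_rowg ?scalemx_sub // -scalemxAl rowM.
Qed.

Lemma card_proj_fix x : det2 x = 1 -> #|proj_fix (psl x)| = #|fixpts (rho x)|.
Proof.
move=> dx; rewrite -(card_imset _ line_inj); apply: eq_card => L.
have fixE P : (proj_act F (line P) (psl x) == line P) = (rho x P == P).
  by rewrite proj_act_line // (inj_eq line_inj).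
apply/setIP/imsetP=> [[+ /afix1P fL]|[P + ->]].
  rewrite proj_lineE => /imsetP[P _ eL]; exists P => //.
  by rewrite inE -fixE -eL fL.
by rewrite inE -fixE proj_lineE imset_f // => /eqP fP; split=> //; apply/afix1P.
Qed.

(** An eigenvalue [a] of [x] is a root of [a ^+ 2 + a + 1]; if it is in [F], so is the
   other one. Whether there is one does not depend on [x]. *)
Lemma order3_semisimple : semisimple_class (order3 F).
Proof.
split; [exact: order3_class | exact: order3_neq1 | rewrite order3E].
have [/existsP[a /eqP ea]|na] := boolP [exists a : F, a ^+ 2 + a + 1 == 0].
  left=> _ /imsetP[x Tx ->]; have [tx dx] := triP _ Tx.
  rewrite card_proj_fix //; apply/eqP; rewrite eqn_leq SLperm_fix_le2 ?mem_SLperm ?rho_tri_neq1 //=.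
  have [P EP] : exists P, eigen P a x.
    by apply: char_eig; rewrite ?dx ?oner_eq0 // tx -[RHS]ea; ring.
  have fP := eig_fix (det1_neq0 dx) EP.
  have [|||R nRP fR] := @second_fixed F [set x] P x F3; rewrite ?sub1set ?set11 //.
    by move=> y /set1P->.
  rewrite (cardD1 P) (cardD1 R) !inE /= fP fR !eqxx nRP //.
right=> _ /imsetP[x Tx ->]; have [tx dx] := triP _ Tx.
rewrite card_proj_fix //; apply: eq_card0 => P; rewrite inE; apply/negbTE/eqP=> fP.
have [a Ea] := fix_eig (det1_neq0 dx) fP; case/existsP: na; exists a.
by have := eig_char Ea; rewrite dx tx => <-; apply/eqP; ring.
Qed.
End Interface.

(** * Embeddings of finite fields and of the semidirect products *)

(** A field [L] generated over [K] by [g] maps to [F] when [r] satisfies the relations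
   of [g]. An element of [L] is sent to the value at [r] of a polynomial that
   represents it, chosen arbitrarily. *)
Section Specialize.
Variables (K L F : fieldType) (i : {rmorphism K -> L}) (j : {rmorphism K -> F}).
Variables (g : L) (r : F).
Hypothesis gen_g : forall x, exists P : {poly K}, (map_poly i P).[g] == x.
Hypothesis rel_r : forall P : {poly K}, (map_poly i P).[g] = 0 -> (map_poly j P).[r] = 0.

Definition specialize x : F := (map_poly j (xchoose (gen_g x))).[r].

Lemma specializeE P : specialize (map_poly i P).[g] = (map_poly j P).[r].
Proof.
apply/eqP; rewrite -subr_eq0 -hornerN -hornerD -rmorphN -rmorphD; apply/eqP/rel_r.
by rewrite rmorphD rmorphN hornerD hornerN (eqP (xchooseP (gen_g _))) subrr.
Qed.

Fact specialize_zmod : zmod_morphism specialize.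
Proof.
move=> x y; have [P /eqP <-] := gen_g x; have [Q /eqP <-] := gen_g y.
by rewrite -hornerN -hornerD -rmorphN -rmorphD !specializeE rmorphD rmorphN hornerD hornerN.
Qed.
Fact specialize_monoid : monoid_morphism specialize.
Proof.
split.
  have {1}-> : 1 = (map_poly i 1).[g] by rewrite rmorph1 hornerC.
  by rewrite specializeE rmorph1 hornerC.
move=> x y; have [P /eqP <-] := gen_g x; have [Q /eqP <-] := gen_g y.
by rewrite -hornerM -rmorphM !specializeE rmorphM hornerM.
Qed.
HB.instance Definition _ := GRing.isZmodMorphism.Build L F specialize specialize_zmod.
HB.instance Definition _ := GRing.isMonoidMorphism.Build L F specialize specialize_monoid.

Lemma specialize_morph : exists f : {rmorphism L -> F}, f g = r.
Proof.
exists specialize; have {1}-> : g = (map_poly i 'X).[g] by rewrite map_polyX hornerX.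
by rewrite /= specializeE map_polyX hornerX.
Qed.
End Specialize.

(** The minimal polynomial of a generator of [F0^*] divides [X^q - X], which splits in [F]. *)
Lemma finField_embed (F0 F : finFieldType) k :
  #|F| = (#|F0| ^ k)%N -> exists f : {rmorphism F0 -> F}, True.
Proof.
move=> cF; have [p p_pr ch0] := finPcharP F0.
have ch : p \in [pchar F].
  apply: (@card_finPcharP F p (logn p #|F0| * k)) => //.
  by rewrite cF (card_pprimeChar ch0) expnM pfactorK.
pose L : fieldExtType 'F_p := pPrimeCharType ch0.
pose i : {rmorphism 'F_p -> L} := in_alg L.
pose F' : fieldType := pPrimeCharType ch.
pose j : {rmorphism 'F_p -> F'} := in_alg (pPrimeCharType ch).
have /cyclicP[u eu] : cyclic [set: {unit F0}] by apply: field_unit_group_cyclic.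
pose g : L := val u.
have [m em] : exists m : {poly 'F_p}, minPoly 1 g = map_poly i m.
  by apply/polyOver1P; apply: minPolyOver.
have dm (P : {poly 'F_p}) : (map_poly i P).[g] = 0 -> m %| P.
  move=> P0; rewrite -(dvdp_map i) -em; apply: minPoly_dvdp; last exact/eqP.
  by apply/polyOver1P; exists P.
have gq : g ^+ #|F| = g.
  rewrite cF; elim: k {cF} => [|k IHk]; first by rewrite expn0 expr1.
  by rewrite expnSr exprM IHk; apply: expf_card.
have [r mr] : exists r, root (map_poly j m) r.
  have : map_poly j m %| 'X^#|F| - 'X.
    have -> : 'X^#|F| - 'X = map_poly j  ('X^#|F| - 'X).
      by rewrite rmorphB /= map_polyXn map_polyX.
    rewrite dvdp_map; apply: dm.
    by rewrite rmorphB /= map_polyXn map_polyX !hornerE gq subrr.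
  rewrite finField_genPoly -(big_map (fun x => x) xpredT (fun x => 'X - x%:P)).
  case/dvdp_prod_XsubC=> s es.
  have : size (map_poly j m) != 1%N.
    rewrite size_map_poly -(size_map_poly i) -em; apply/eqP=> /eqP/size_poly1P[c c0 ec].
    by have := root_minPoly 1 g; rewrite ec rootC (negPf c0).
  rewrite (eqp_size es) size_prod_XsubC; case: mask es => // r s' es _.
  by exists r; rewrite (eqp_root es) root_prod_XsubC mem_head.
have [||f _] := @specialize_morph _ _ _ i j g r; last by exists f.
- move=> x; have [->|x0] := eqVneq x 0; first by exists 0; rewrite rmorph0 hornerC.
  have ux : (x : F0) \is a GRing.unit by rewrite unitfE.
  have /cycleP[l el] : FinRing.unit F0 ux \in <[u]>%g by rewrite -eu inE.
  exists 'X^l; rewrite map_polyXn hornerXn.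
  by have := congr1 val el; rewrite FinRing.val_unitX => <-.
move=> P /dm; rewrite -(dvdp_map j) => /dvdpP[Q ->].
by rewrite hornerM (eqP mr) mulr0.
Qed.

Section BorelExists.
Variables (F : finFieldType) (C3 : {group {unit F}}) (z : {unit F}).
Variable A : finLmodType (subfield C3).
Hypotheses (cC : #|C3| = 3%N) (Cz : z \in C3) (oz : #[z]%g = 3%N).
Hypothesis cA : (#|A| <= #|F|)%N.

(** Two vector spaces over [subfield C3], compared by their dimensions. *)
Lemma embed_lmod : exists ψ : A -> F, [/\ {morph ψ : u v / u + v},
  forall k u, ψ (k *: u) = val k * ψ u & injective ψ].
Proof.
pose K : finFieldType := subfield C3.
have [|||||||d [f [fD fZ fI fT]]] :=
  @subspace_basis K A (fun k v => k *: v) _ _ _ _ [set: A].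
- by move=> a u v; rewrite scalerDr.
- by move=> a b v; rewrite scalerDl.
- by move=> a b v; rewrite scalerA.
- by move=> v; rewrite scale1r.
- by rewrite inE.
- by move=> u v; rewrite !inE.
- by move=> a u; rewrite !inE.
have [|||||||e [h [hD hZ hI hT]]] :=
  @subspace_basis K F (fun k v => val k * v) _ _ _ _ [set: F].
- by move=> a u v; rewrite mulrDr.
- by move=> a b v; rewrite /= mulrDl.
- by move=> a b v; rewrite /= mulrA.
- by move=> v; rewrite /= mul1r.
- by rewrite inE.
- by move=> u v; rewrite !inE.
- by move=> a u; rewrite !inE.
have de : (d <= e)%N.
  have cf : #|A| = (#|K| ^ d)%N by rewrite -cardsT -fT card_imset // cardsT card_mx mul1n.
  have ch : #|F| = (#|K| ^ e)%N by rewrite -cardsT -hT card_imset // cardsT card_mx mul1n.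
  by move: cA; rewrite cf ch leq_exp2l // finNzRing_gt1.
have fS a : exists u, f u == a.
  by have /imsetP[u _ ->] : a \in f @: setT; [rewrite fT inE | exists u].
pose s a := xchoose (fS a); have sK a : f (s a) = a := (eqP (xchooseP (fS a))).
exists (fun a => h (s a *m pid_mx d)); split=> [a b|k a|a b].
- by rewrite -hD -mulmxDl; congr (h (_ *m _)); apply: fI; rewrite fD !sK.
- by rewrite -hZ scalemxAl; congr (h (_ *m _)); apply: fI; rewrite fZ !sK.
move/hI/(congr1 (fun M => M *m (pid_mx d : 'M_(e, d)))) => /=; rewrite -!mulmxA pid_mx_id // pid_mx_1 !mulmx1.
by move=> e'; rewrite -(sK a) e' sK.
Qed.

Lemma borel_exists (S : {set {unit F}}) : S \subset C3 -> 1%g \notin S -> 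
  exists Y : {set m2 F}, [/\ Y \subset tri F, {in Y &, forall x y, op2 x y \in Y}
    & rack_isomorphic (@op2 F) Y (@conj_op _) (sd_subset A S)].
Proof.
move=> sS S1; have [ψ [ψD ψZ ψI]] := embed_lmod.
exists (sd_aff ψ @: sd_subset A S); split; first exact: sd_aff_tri.
  move=> _ _ /imsetP[x Sx ->] /imsetP[y Sy ->].
  by rewrite -(sd_aff_op cC) // imset_f ?sd_subset_closed.
apply: (@rack_iso_sym _ _ _ _ _ _ 1%g); last exact: sd_aff_iso.
exact: sd_subset_closed.
Qed.
End BorelExists.

(** * Quaternions, cube and dodecahedron *)

Section Quaternions.
Variables (F : finFieldType) (α β h : F).
Hypotheses (αβ : α ^+ 2 + β ^+ 2 = -1) (h2 : 2%:R * h = 1).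

(** Matrices of the quaternions: the images of [i], [j] and [k] are
   [(0, 1, -1, 0)], [(α, β, β, -α)] and [(β, -α, -α, -β)]. *)
Definition quat t a b c : m2 F :=
  (t + (b * α + c * β), a + (b * β - c * α), - a + (b * β - c * α), t - (b * α + c * β)).

Lemma quatM t a b c t' a' b' c' : mul2 (quat t a b c) (quat t' a' b' c') =
  quat (t * t' - (a * a' + b * b' + c * c')) (t * a' + a * t' + (b * c' - c * b'))
       (t * b' + b * t' + (c * a' - a * c')) (t * c' + c * t' + (a * b' - b * a')).
Proof.
rewrite /quat /mul2; congr (_, _, _, _).
- transitivity (t * t' - a * a' + (b * b' + c * c') * (α ^+ 2 + β ^+ 2)
    + (t * b' + b * t' + (c * a' - a * c')) * α + (t * c' + c * t' + (a * b' - b * a')) * β).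
    by ring.
  by rewrite αβ; ring.
- transitivity (t * a' + a * t' - (b * c' - c * b') * (α ^+ 2 + β ^+ 2)
    + ((t * b' + b * t' + (c * a' - a * c')) * β - (t * c' + c * t' + (a * b' - b * a')) * α)).
    by ring.
  by rewrite αβ; ring.
- transitivity (- (t * a' + a * t') + (b * c' - c * b') * (α ^+ 2 + β ^+ 2)
    + ((t * b' + b * t' + (c * a' - a * c')) * β - (t * c' + c * t' + (a * b' - b * a')) * α)).
    by ring.
  by rewrite αβ; ring.
transitivity (t * t' - a * a' + (b * b' + c * c') * (α ^+ 2 + β ^+ 2)
    - ((t * b' + b * t' + (c * a' - a * c')) * α + (t * c' + c * t' + (a * b' - b * a')) * β)).
  by ring.
by rewrite αβ; ring.
Qed.

Lemma quatV t a b c : inv2 (quat t a b c) = quat t (- a) (- b) (- c).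
Proof. by rewrite /quat /=; congr (_, _, _, _); ring. Qed.

Lemma quatZ s t a b c : scal2 s (quat t a b c) = quat (s * t) (s * a) (s * b) (s * c).
Proof. by rewrite /quat /=; congr (_, _, _, _); ring. Qed.

Lemma det_quat t a b c : det2 (quat t a b c) = t ^+ 2 + a ^+ 2 + b ^+ 2 + c ^+ 2.
Proof.
transitivity (t ^+ 2 + a ^+ 2 - (b ^+ 2 + c ^+ 2) * (α ^+ 2 + β ^+ 2)).
  by rewrite /quat /=; ring.
by rewrite αβ; ring.
Qed.

Lemma two_neq0 : 2%:R != 0 :> F.
Proof. by apply/eqP=> e; move: h2; rewrite e mul0r => /esym/eqP; rewrite oner_eq0. Qed.

Lemma half_neq0 : h != 0.
Proof. by apply/eqP=> e; move: h2; rewrite e mulr0 => /esym/eqP; rewrite oner_eq0. Qed.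

Definition qv (v : F * F * F) : m2 F :=
  let: (a, b, c) := v in quat (- h) (h * a) (h * b) (h * c).

Lemma quat_inj t a b c t' a' b' c' : quat t a b c = quat t' a' b' c' ->
  [/\ t = t', a = a', b = b' & c = c'].
Proof.
case=> e1 e2 e3 e4; have n2 := two_neq0.
have sum (x y x' y' : F) : x + y = x' + y' -> x - y = x' - y' -> x = x' /\ y = y'.
  move=> s d; split; apply: (mulfI n2).
    transitivity ((x + y) + (x - y)); first by ring.
    by rewrite s d; ring.
  transitivity ((x + y) - (x - y)); first by ring.
  by rewrite s d; ring.
have [-> u] := sum _ _ _ _ e1 e4.
have s1 : b * β - c * α + a = b' * β - c' * α + a' by rewrite addrC e2 addrC.
have s2 : b * β - c * α - a = b' * β - c' * α - a' by rewrite addrC e3 addrC.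
have [v ->] := sum _ _ _ _ s1 s2.
have bc : forall x y, (x * α + y * β) * α + (x * β - y * α) * β = - x.
  by move=> x y; transitivity (x * (α ^+ 2 + β ^+ 2)); [ring | rewrite αβ; ring].
have cb : forall x y, (x * α + y * β) * β - (x * β - y * α) * α = - y.
  by move=> x y; transitivity (y * (α ^+ 2 + β ^+ 2)); [ring | rewrite αβ; ring].
split=> //; apply: oppr_inj; first by rewrite -(bc b c) -(bc b' c') u v.
by rewrite -(cb b c) -(cb b' c') u v.
Qed.

Lemma qv_inj : injective qv.
Proof.
move=> [[a b] c] [[a' b'] c'] /quat_inj[_] /(mulfI half_neq0)-> /(mulfI half_neq0)->.
by move/(mulfI half_neq0)->.
Qed.

Definition norm3 (v : F * F * F) := let: (a, b, c) := v in a ^+ 2 + b ^+ 2 + c ^+ 2 == 3%:R.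

Lemma qv_tri v : norm3 v -> qv v \in tri F.
Proof.
case: v => [[a b] c] /eqP n; apply/triP; split.
  by rewrite /qv /quat /=; transitivity (- (2%:R * h)); [ring | rewrite h2].
rewrite /qv det_quat; transitivity (h ^+ 2 * (1 + (a ^+ 2 + b ^+ 2 + c ^+ 2))); first by ring.
by rewrite n; transitivity ((2%:R * h) ^+ 2); [ring | rewrite h2 expr1n].
Qed.

(** Conjugation by [qv v] is the rotation of angle [±2π/3] with axis [v]. *)
Lemma qv_op v w u : norm3 v ->
    (let: (a, b, c) := v in let: (a', b', c') := w in let: (x, y, z) := u in
     let s := a * a' + b * b' + c * c' in
     [/\ x + x = s * a - a' - (b * c' - c * b'), y + y = s * b - b' - (c * a' - a * c')
       & z + z = s * c - c' - (a * b' - b * a')]) ->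
  op2 (qv v) (qv w) = qv u.
Proof.
case: v w u => [[a b] c] [[a' b'] c'] [[x y] z] /eqP n [ex ey ez].
have h3 r : h * h * h * (2%:R * (r + r)) = h * r.
  by transitivity ((2%:R * h) ^+ 2 * (h * r)); [ring | rewrite h2 expr1n mul1r].
rewrite /qv /op2 quatV !quatM; congr quat.
- transitivity (- (h * h * h * (1 + (a ^+ 2 + b ^+ 2 + c ^+ 2)))); first by ring.
  by rewrite n -[h in RHS]mulr1 -(h3 1); ring.
- rewrite -(h3 x) ex; transitivity (h * h * h * ((1 - (a ^+ 2 + b ^+ 2 + c ^+ 2)) * a' + 2%:R * ((a * a' + b * b' + c * c') * a - (b * c' - c * b')))); first by ring.
  by rewrite n; ring.
- rewrite -(h3 y) ey; transitivity (h * h * h * ((1 - (a ^+ 2 + b ^+ 2 + c ^+ 2)) * b' + 2%:R * ((a * a' + b * b' + c * c') * b - (c * a' - a * c')))); first by ring.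
  by rewrite n; ring.
rewrite -(h3 z) ez; transitivity (h * h * h * ((1 - (a ^+ 2 + b ^+ 2 + c ^+ 2)) * c' + 2%:R * ((a * a' + b * b' + c * c') * c - (a * b' - b * a')))); first by ring.
by rewrite n; ring.
Qed.

Let v1 : F * F * F := (1, 1, 1).
Let v2 : F * F * F := (1, -1, -1).
Let v3 : F * F * F := (-1, 1, -1).

Lemma qv_12 : mul2 (inv2 (qv v1)) (qv v2) = quat 0 0 0 1.
Proof.
rewrite /qv quatV quatM; congr quat; first [ring |
  transitivity ((2%:R * h) ^+ 2); [ring | by rewrite h2 expr1n]].
Qed.

Lemma qv_13 : mul2 (inv2 (qv v1)) (qv v3) = quat 0 1 0 0.
Proof.
rewrite /qv quatV quatM; congr quat; first [ring |
  transitivity ((2%:R * h) ^+ 2); [ring | by rewrite h2 expr1n]].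
Qed.

(** A fixed point would be a common eigenvector of the quaternions [k] and [i], which
   anticommute and are invertible. *)
Lemma qv_no_fix P : rho (qv v1) P = P -> rho (qv v2) P = P -> rho (qv v3) P = P -> False.
Proof.
have n v : v \in [:: v1; v2; v3] -> det2 (qv v) = 1.
  rewrite !inE => v123; suff /qv_tri/triP[] : norm3 v by [].
  by case/or3P: v123 => /eqP->; apply/eqP; ring.
have d1 := n v1 (mem_head _ _); have d2 := n v2 ltac:(by rewrite !inE eqxx orbT).
have d3 := n v3 ltac:(by rewrite !inE eqxx !orbT).
move=> /(fix_eig (det1_neq0 d1))[a Ea] /(fix_eig (det1_neq0 d2))[b Eb].
move=> /(fix_eig (det1_neq0 d3))[c Ec].
have Ek := eigM (eigV d1 Ea) Eb; rewrite qv_12 in Ek.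
have Ei := eigM (eigV d1 Ea) Ec; rewrite qv_13 in Ei.
have E1 := eigM Ek Ei; have E2 := eigM Ei Ek.
have : mul2 (quat 0 1 0 0) (quat 0 0 0 1) = scal2 (-1) (mul2 (quat 0 0 0 1) (quat 0 1 0 0)).
  by rewrite !quatM quatZ; congr quat; ring.
move=> e; move: E2; rewrite e /eigen vmulZr E1 vscA.
rewrite [X in _ = vscale X _ -> _]mulrC; set s := (a^-1 * b) * (a^-1 * c).
have a0 := eig_neq0 (det1_neq0 d1) Ea; have b0 := eig_neq0 (det1_neq0 d2) Eb.
have c0 := eig_neq0 (det1_neq0 d3) Ec.
have s0 : s != 0 by rewrite /s !mulf_neq0 ?invr_eq0.
have n2 := two_neq0.
suff : -1 * s <> s by case: (P) => [t|] ne; rewrite /vscale /= => -[]; rewrite !mulr1 //.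
by move/eqP; rewrite mulN1r -subr_eq0 -opprD oppr_eq0 -mulr2n -mulr_natl mulf_eq0 (negPf n2) (negPf s0).
Qed.
End Quaternions.

(** Pairs [(m, n)] stand for [m + n * φ], where [φ ^+ 2 = e * (φ + 1)]. *)
Section QuadraticIntegers.
Variable e : int.

Definition zmul (x y : int * int) : int * int :=
  (x.1 * y.1 + e * (x.2 * y.2), x.1 * y.2 + x.2 * y.1 + e * (x.2 * y.2)).
Definition zadd (x y : int * int) : int * int := (x.1 + y.1, x.2 + y.2).
Definition zsub (x y : int * int) : int * int := (x.1 - y.1, x.2 - y.2).
Definition zvec := ((int * int) * (int * int) * (int * int))%type.
Definition zdot (v w : zvec) :=
  zadd (zadd (zmul v.1.1 w.1.1) (zmul v.1.2 w.1.2)) (zmul v.2 w.2).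

(** Tests that [u] is the image of [w] under the rotation of [qv_op] with axis [v]; it
   is stated for twice the vectors, which avoids denominators. *)
Definition zrot (v w u : zvec) : bool :=
  let f a a' b c b' c' x :=
    zadd x x == zsub (zsub (zmul (zdot v w) a) a') (zsub (zmul b c') (zmul c b')) in
  [&& f v.1.1 w.1.1 v.1.2 v.2 w.1.2 w.2 u.1.1, f v.1.2 w.1.2 v.2 v.1.1 w.2 w.1.1 u.1.2
    & f v.2 w.2 v.1.1 v.1.2 w.1.1 w.1.2 u.2].

Definition zclosed (s : seq zvec) :=
  all (fun v => (zdot v v == (3%:Z, 0)) && all (fun w => has (zrot v w) s) s) s.
End QuadraticIntegers.

Definition zsc (m : int) : int * int := (m, 0).
(** The vertices of a cube and, below, the other vertices of a regular dodecahedron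
   inscribed in the same sphere of squared radius 3. The vertices of a cube do not
   involve [φ], so that [e] and [φ] can be taken to be 0 for them. *)
Definition cube_vertices : seq zvec :=
  [:: (zsc 1, zsc 1, zsc 1); (zsc 1, zsc (-1), zsc (-1)); (zsc (-1), zsc 1, zsc (-1));
      (zsc (-1), zsc (-1), zsc 1); (zsc (-1), zsc (-1), zsc (-1)); (zsc (-1), zsc 1, zsc 1);
      (zsc 1, zsc (-1), zsc 1); (zsc 1, zsc 1, zsc (-1))].
Definition golden_rectangles : seq zvec :=
  flatten [seq [:: (zsc 0, x, y); (x, y, zsc 0); (y, zsc 0, x)] |
    x <- [:: (-1, 1); (1, -1)], y <- [:: (0, 1); (0, -1)]].
Definition dodecahedron := cube_vertices ++ golden_rectangles.

Lemma cube_closed : zclosed 0 cube_vertices. Proof. by vm_compute. Qed.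
Lemma dodecahedron_closed : zclosed 1 dodecahedron. Proof. by vm_compute. Qed.

Section SubRack.
Variables (S T : finType) (opS : S -> S -> S) (opT : T -> T -> T).

Lemma rack_iso_sub (X : {set S}) (Y W : {set T}) : W \subset Y ->
    {in X &, forall x y, opS x y \in X} -> {in W &, forall x y, opT x y \in W} ->
    rack_isomorphic opS X opT Y ->
  exists X' : {set S}, [/\ X' \subset X, {in X' &, forall x y, opS x y \in X'}
    & rack_isomorphic opS X' opT W].
Proof.
move=> sWY clX clW [f [fI fX fM]]; exists [set x in X | f x \in W]; split.
- by apply/subsetP=> x; rewrite inE => /andP[].
- move=> x y; rewrite !inE => /andP[Xx Wx] /andP[Xy Wy].
  by rewrite clX // fM // clW.
exists f; split=> [x y|| x y].
- by rewrite !inE => /andP[Xx _] /andP[Xy _]; apply: fI.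
- apply/setP=> w; apply/imsetP/idP=> [[x + ->]|Ww]; first by rewrite inE => /andP[].
  have := subsetP sWY w Ww; rewrite -fX => /imsetP[x Xx ew].
  by exists x; rewrite // inE Xx -ew.
by rewrite !inE => /andP[Xx _] /andP[Xy _]; apply: fM.
Qed.

Lemma rack_iso_card (X : {set S}) (Y : {set T}) : rack_isomorphic opS X opT Y -> #|X| = #|Y|.
Proof. by case=> f [fI <- _]; rewrite card_in_imset. Qed.
End SubRack.

Section Sizes.
Let c4 := cycle123 1.

Lemma card_class_Alt4 : (#|c4 ^: 'Alt_('I_4)| <= 4)%N.
Proof.
have cA : #|'Alt_('I_4)| = 12%N.
  have : (2 * #|'Alt_('I_4)| = 24)%N by rewrite card_Alt card_ord.
  by lia.
have Ac : c4 \in 'Alt_('I_4) := cycle123_Alt 1.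
rewrite -index_cent1 -(leq_pmul2l (cardG_gt0 ('C_('Alt_('I_4))[c4])%G)).
rewrite Lagrange ?subsetIl // cA (_ : 12 = 3 * 4)%N // leq_mul2r /=.
apply: leq_trans (_ : #[c4]%g <= _)%N; first by rewrite order_cycle123.
rewrite orderE subset_leq_card // cycle_subG inE Ac; exact: cent1id.
Qed.

Lemma card_classes_Alt4 : (#|(c4 ^: 'Alt_('I_4)) :|: (c4^-1%g ^: 'Alt_('I_4))| <= 8)%N.
Proof.
rewrite cardsU (leq_trans (leq_subr _ _)) // (rack_iso_card class_inv_iso).
by rewrite (_ : 8 = 4 + 4)%N // leq_add ?card_class_Alt4.
Qed.

Lemma card_class_Alt5 : #|cycle123 2 ^: 'Alt_('I_5)| = 20%N.
Proof.
have [K _ cK] := pPrimePowerField (isT : prime 2) (isT : (0 < 2)%N).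
apply/eqP; rewrite eqn_leq class_Alt5_le20.
have [c c3 c1] := card4_cube cK.
by have := card_tri_split c3 c1; rewrite (rack_iso_card (tri_card4 cK)) cK.
Qed.

(** The embedding fixes the last point. *)
Lemma Alt4_sub_Alt5 : exists W : {set {perm 'I_5}},
  [/\ W \subset cycle123 2 ^: 'Alt_('I_5), {in W &, forall x y, conj_op x y \in W}
    & W ~=r (c4 ^: 'Alt_('I_4)) :|: (c4^-1%g ^: 'Alt_('I_4))].
Proof.
pose f (s : {perm 'I_4}) : {perm 'I_5} := lift_perm ord_max ord_max s.
have fM s t : f (s * t)%g = (f s * f t)%g by rewrite lift_permM.
have f1 : f 1%g = 1%g by apply: lift_perm1.
have fI : injective f.
  move=> s t e; apply/permP=> i; apply: (@lift_inj _ ord_max).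
  by rewrite -!(lift_perm_lift ord_max) -/(f s) e.
set U := _ :|: _.
have U3 s : s \in U -> (s ^+ 3 = 1)%g /\ s != 1%g.
  have c3 : (c4 ^+ 3 = 1)%g by apply/eqP; rewrite -order_dvdn order_cycle123.
  have c1 : c4 != 1%g by rewrite -order_eq1 order_cycle123.
  by case/setUP=> /imsetP[t _ ->]; rewrite conjg_eq1 -conjXg ?invg_eq1 ?expVgn c3 ?invg1 conj1g.
have UA s : s \in U -> s \in 'Alt_('I_4).
  by case/setUP=> /imsetP[t At ->]; rewrite groupJ ?groupV ?cycle123_Alt.
have clU : {in U &, forall s t, conj_op s t \in U}.
  move=> s t /UA As /setUP Ut; rewrite conj_opE; apply/setUP.
  by case: Ut => /imsetP[u Au ->]; [left | right]; rewrite -conjgM imset_f // groupM ?groupV.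
have fop s t : conj_op (f s) (f t) = f (conj_op s t).
  rewrite /conj_op !fM; congr (_ * _)%g.
  by apply/eqP; rewrite eq_invg_mul -fM mulgV f1.
exists (f @: U); split.
- apply/subsetP=> _ /imsetP[s /U3[s3 s1] ->]; apply: ord3_Alt5.
    by rewrite -f1 -s3 !expgS expg0 !mulg1 -!fM.
  by rewrite -f1 (inj_eq fI).
- by move=> _ _ /imsetP[s Us ->] /imsetP[t Ut ->]; rewrite fop imset_f ?clU.
apply: (@rack_iso_sym _ _ _ _ _ _ 1%g) => //.
by exists f; split=> [s t _ _ /fI||s t _ _] //; rewrite fop.
Qed.
End Sizes.

(** The racks of the matrices [qv v], for a list of vectors [v] closed under the
   rotations that they define. *)
Section VectorRack.
Variables (F : finFieldType) (α β h φ : F) (e : int).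
Hypotheses (αβ : α ^+ 2 + β ^+ 2 = -1) (h2 : 2%:R * h = 1) (φE : φ ^+ 2 = e%:~R * (φ + 1)).

Definition zev (x : int * int) : F := x.1%:~R + x.2%:~R * φ.
Definition zev3 (v : zvec) := (zev v.1.1, zev v.1.2, zev v.2).
Definition vrack (s : seq zvec) : {set m2 F} := [set x in [seq qv α β h (zev3 v) | v <- s]].

Lemma zevD x y : zev (zadd x y) = zev x + zev y.
Proof. by rewrite /zev /= !rmorphD; ring. Qed.
Lemma zevB x y : zev (zsub x y) = zev x - zev y.
Proof. by rewrite /zev /= !rmorphB; ring. Qed.
Lemma zevM x y : zev (zmul e x y) = zev x * zev y.
Proof.
rewrite /zev /= !rmorphD !rmorphM /=.
transitivity (x.1%:~R * y.1%:~R + (x.1%:~R * y.2%:~R + x.2%:~R * y.1%:~R) * φ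
   + (x.2%:~R * y.2%:~R) * (e%:~R * (φ + 1))); first by ring.
by rewrite -φE; ring.
Qed.

Lemma vrackP s x : reflect (exists2 v, v \in s & x = qv α β h (zev3 v)) (x \in vrack s).
Proof. by rewrite inE; apply: mapP. Qed.

Variable s : seq zvec.
Hypothesis cls : zclosed e s.

Lemma zev_norm v : v \in s -> norm3 (zev3 v).
Proof.
move=> sv; have /andP[/eqP n _] := allP cls v sv.
rewrite /norm3 /= !expr2 -!zevM -!zevD -/(zdot e v v) n /zev /=.
by rewrite mul0r addr0.
Qed.

Lemma vrack_tri : vrack s \subset tri F.
Proof. by apply/subsetP=> _ /vrackP[v sv ->]; apply: qv_tri => //; apply: zev_norm. Qed.

Lemma vrack_closed : {in vrack s &, forall x y, op2 x y \in vrack s}.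
Proof.
move=> _ _ /vrackP[v sv ->] /vrackP[w sw ->].
have /andP[_ /allP/(_ w sw)/hasP[u su r]] := allP cls v sv.
rewrite (@qv_op _ _ _ _ αβ h2 _ _ (zev3 u)) ?zev_norm //; last first.
  by case/and3P: r => /eqP r1 /eqP r2 /eqP r3; split;
    rewrite -!zevM -!zevD -!zevM -!zevB; congr zev.
by apply/vrackP; exists u.
Qed.

Lemma card_vrack : (#|vrack s| <= size s)%N.
Proof. by rewrite cardsE -(size_map (fun v => qv α β h (zev3 v))) card_size. Qed.

Lemma card_vrack_ge t : {subset t <= s} -> uniq (map zev3 t) -> (size t <= #|vrack s|)%N.
Proof.
move=> ts ut; rewrite -(size_map zev3) -(size_map (qv α β h)).
have uq : uniq [seq qv α β h v | v <- [seq zev3 v | v <- t]] by rewrite map_inj_uniq //; apply: qv_inj.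
rewrite -(card_uniqP uq); apply: subset_leq_card; apply/subsetP=> x.
by rewrite -map_comp => /mapP[v tv ->]; apply/vrackP; exists v; rewrite // ts.
Qed.

Variables (p n : nat).
Hypotheses (p_pr : prime p) (p_neq3 : p != 3%N) (cardF : #|F| = (p ^ n)%N).
Hypothesis cube_s : {subset cube_vertices <= s}.

(** Only a lower bound for the cardinal of the rack is needed, so a few vectors
   suffice. *)
Lemma uniq5 : uniq (map zev3 (take 5 cube_vertices)).
Proof.
have n1 : (1 == -1 :> F) = false.
  by apply/eqP=> /eqP; rewrite eq_sym -subr_eq0 -opprD oppr_eq0 -mulr2n (negPf (two_neq0 h2)).
have n1' : (-1 == 1 :> F) = false by rewrite eq_sym.
by rewrite /= /zev3 /zev /= !mul0r !addr0 !inE !xpair_eqE !eqxx !n1 !n1'.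
Qed.

Lemma vrack_types :
  [\/ p != 2%N /\
      (rack_isomorphic (@op2 F) (vrack s) (@conj_op _) (cycle123 1 ^: 'Alt_('I_4)) \/
       rack_isomorphic (@op2 F) (vrack s) (@conj_op _)
         ((cycle123 1 ^: 'Alt_('I_4)) :|: ((cycle123 1)^-1%g ^: 'Alt_('I_4)))),
      (5 %| #|F| ^ 2 - 1)%N /\
      rack_isomorphic (@op2 F) (vrack s) (@conj_op _) (cycle123 2 ^: 'Alt_('I_5)) |
      exists (K : finFieldType) (k : nat),
       [/\ (4 <= #|K|)%N, #|F| = (#|K| ^ k)%N &
           rack_isomorphic (@op2 F) (vrack s) (@op2 K) (tri K)]].
Proof.
have m v : v \in cube_vertices -> qv α β h (zev3 v) \in vrack s.
  by move=> cv; apply/vrackP; exists v => //; apply: cube_s.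
pose v1 : zvec := (zsc 1, zsc 1, zsc 1); pose v2 : zvec := (zsc 1, zsc (-1), zsc (-1)).
pose v3 : zvec := (zsc (-1), zsc 1, zsc (-1)).
have ev1 : zev3 v1 = (1, 1, 1) by rewrite /zev3 /zev /= !mul0r !addr0.
have ev2 : zev3 v2 = (1, -1, -1) by rewrite /zev3 /zev /= !mul0r !addr0.
have ev3 : zev3 v3 = (-1, 1, -1) by rewrite /zev3 /zev /= !mul0r !addr0.
have m1 := m v1 isT; have m2 := m v2 isT; have m3 := m v3 isT.
have F3 : 3%:R != 0 :> F by apply: (char3 p_pr p_neq3 cardF).
apply: (irreducible_types p_pr p_neq3 cardF vrack_tri vrack_closed m1 m2).
  have u := uniq5.
  case/(commuting_tri F3 (subsetP vrack_tri _ m1) (subsetP vrack_tri _ m2)) => [/(qv_inj αβ h2) e12|].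
    by move: u; rewrite /= -/v1 -/v2 -e12 inE eqxx.
  rewrite ev1 ev2 /qv quatV => /(quat_inj αβ h2)[_ /eqP]; rewrite -subr_eq0 opprK !mulr1.
  by rewrite -mulr2n -mulr_natl h2 oner_eq0.
case=> Q fQ; apply: (@qv_no_fix _ _ _ _ αβ h2 Q); [rewrite -ev1 | rewrite -ev2 | rewrite -ev3];
exact: fQ.
Qed.
End VectorRack.

(** * Existence of the subracks *)

Fact prime_pow_coprime5 p n : prime p -> (0 < n)%N -> (5 %| (p ^ n) ^ 2 - 1)%N -> p != 5%N.
Proof.
move=> p_pr n0 d; apply/eqP=> p5; have d5 : (5 %| (p ^ n) ^ 2)%N.
  by rewrite p5 !dvdn_exp.
have : (5 %| 1)%N.
  rewrite -(dvdn_addr 1 d) subnK //.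
  by rewrite !expn_gt0 prime_gt0.
by [].
Qed.

Fact dvd5_pow2 n : (5 %| (2 ^ n) ^ 2 - 1)%N -> exists k, (2 ^ n = 4 ^ k)%N.
Proof.
have -> : (2 ^ n = 2 ^ odd n * 4 ^ n./2)%N.
  by rewrite -[LHS]/(2 ^ n)%N -{1}(odd_double_half n) expnD -mul2n expnM.
case: (odd n) => [|_]; last by exists n./2; rewrite mul1n.
have d5 := dvd5_pow4 n./2; rewrite expnMn (_ : ((2 ^ true) ^ 2)%N = 4%N) //; move: d5.
have : (0 < (4 ^ n./2) ^ 2)%N by rewrite !expn_gt0.
by move: ((4 ^ n./2) ^ 2)%N => m; lia.
Qed.

(** The golden ratio is [- (ζ + ζ^-1)], where [ζ] is a fifth root of unity of the
   quadratic extension: this element is fixed by the Frobenius of [F]. *)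
Lemma golden_ratio (F : finFieldType) : (5 %| #|F| ^ 2 - 1)%N ->
  exists φ : F, φ ^+ 2 = φ + 1.
Proof.
move=> d5; have [p p_pr ch] := finPcharP F.
have cF : #|F| = (p ^ logn p #|F|)%N := card_pprimeChar ch.
set n := logn p #|F| in cF.
have n0 : (0 < n)%N.
  by rewrite lt0n; apply/eqP=> e; have := finNzRing_gt1 F; rewrite cF e.
have n20 : (0 < n * 2)%N by rewrite muln_gt0 n0.
have [E chE cE] := pPrimePowerField p_pr n20.
have cEF : #|E| = (#|F| ^ 2)%N by rewrite cE cF expnM.
have [f _] := finField_embed cEF.
have d5' : (5 %| #|[set: {unit E}]%G|)%N by rewrite card_finField_unit cEF -subn1.
have [u _ ou] := Cauchy (isT : prime 5) d5'.
pose ζ : E := val u.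
have ζ5 : ζ ^+ 5 = 1 by rewrite -FinRing.val_unitX -ou expg_order.
have ζ1 : ζ != 1.
  by apply: contra_eq_neq ou => u1; rewrite (_ : u = 1%g) ?order1 //; apply: val_inj.
have ζ0 : ζ != 0 by rewrite -unitfE; apply: (valP u).
have ζE : ζ ^+ 4 + ζ ^+ 3 + ζ ^+ 2 + ζ + 1 = 0.
  apply: (mulfI (_ : ζ - 1 != 0)); first by rewrite subr_eq0.
  by transitivity (ζ ^+ 5 - 1); [ring | rewrite ζ5 subrr mulr0].
pose τ := ζ + ζ^-1.
have τE : τ ^+ 2 + τ - 1 = 0.
  by apply: (mulfI (expf_neq0 2 ζ0)); rewrite mulr0 -ζE /τ; field.
have τq : τ ^+ #|F| = τ.
  have q0 : (0 < #|F|)%N by apply: ltnW (finNzRing_gt1 F).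
  have pch : p.-nat #|F| by rewrite cF pnatX pnat_id ?orbT.
  have frob : (ζ + ζ^-1) ^+ #|F| = ζ ^+ #|F| + (ζ ^+ #|F|)^-1.
    rewrite -exprVn cF; elim: n {cF n0 n20 cE pch} => [|k IHk]; first by rewrite !expr1.
    by rewrite expnSr !exprM IHk -!(pFrobenius_autE chE) rmorphD.
  rewrite /τ frob; move: d5.
  have -> : (#|F| ^ 2 - 1 = #|F|.-1 * #|F|.+1)%N.
    by rewrite -(exp1n 2) subn_sqr subn1 addn1.
  rewrite Euclid_dvdM //.
  case/orP=> /dvdnP[k ek].
    have -> : ζ ^+ #|F| = ζ by rewrite -(prednK q0) ek exprS mulnC exprM ζ5 expr1n mulr1.
    by [].
  have -> : ζ ^+ #|F| = ζ^-1.
    by apply: (mulfI ζ0); rewrite -exprS ek mulnC exprM ζ5 expr1n mulfV.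
  by rewrite invrK addrC.
have [t et] : exists t, f t = τ.
  have : root (map_poly f ('X^#|F| - 'X)) τ.
    by rewrite rmorphB /= map_polyXn map_polyX /root !hornerE τq subrr.
  rewrite finField_genPoly rmorph_prod /= /root horner_prod.
  case/prodf_eq0=> t _; rewrite rmorphB /= map_polyX map_polyC !hornerE subr_eq0.
  by move/eqP->; exists t.
exists (- t); apply: (fmorph_inj f); rewrite rmorphD rmorphXn rmorphN rmorph1 et.
by apply/eqP; rewrite -subr_eq0 -τE; apply/eqP; ring.
Qed.

Definition tri_occurs (F : finFieldType) (hT : finGroupType) (Y : {set hT}) :=
  exists X : {set m2 F}, [/\ X \subset tri F, {in X &, forall x y, op2 x y \in X}
    & rack_isomorphic (@op2 F) X (@conj_op _) Y].

Lemma tri_occurs_sub (F : finFieldType) (hT : finGroupType) (Y W : {set hT}) :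
  W \subset Y -> {in W &, forall x y, conj_op x y \in W} -> tri_occurs F Y -> tri_occurs F W.
Proof.
move=> sWY clW [X [sX clX iso]].
have [X' [sX' clX' iso']] := rack_iso_sub sWY clX clW iso.
by exists X'; split=> //; apply: subset_trans sX' sX.
Qed.

Lemma conj_class_closed (gT : finGroupType) (G : {group gT}) c : c \in G ->
  {in c ^: G &, forall x y, conj_op x y \in c ^: G}%g.
Proof.
move=> Gc _ _ /imsetP[g Gg ->] /imsetP[k Gk ->]; rewrite conj_opE -conjgM.
by apply: imset_f; rewrite groupM ?groupV ?groupJ.
Qed.

Lemma tri_occurs_Alt4 (F : finFieldType) :
  tri_occurs F ((cycle123 1 ^: 'Alt_('I_4)) :|: ((cycle123 1)^-1 ^: 'Alt_('I_4)))%g ->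
  tri_occurs F (cycle123 1 ^: 'Alt_('I_4))%g.
Proof.
by apply: tri_occurs_sub; [apply: subsetUl | apply: conj_class_closed; apply: cycle123_Alt].
Qed.

Section Exists.
Variables (F : finFieldType) (p n : nat).
Hypotheses (p_pr : prime p) (p_neq3 : p != 3%N) (n0 : (0 < n)%N) (cardF : #|F| = (p ^ n)%N).

Lemma quaternion_basis : p != 2%N -> exists αβh : F * F * F,
  αβh.1.1 ^+ 2 + αβh.1.2 ^+ 2 = -1 /\ 2%:R * αβh.2 = 1.
Proof.
move=> p2; have ch := card_finPcharP cardF p_pr.
have n2 : 2%:R != 0 :> F.
  rewrite -(dvdn_pcharf ch); apply: contra p2 => /(dvdn_leq (isT : (0 < 2)%N)) p2.
  by rewrite eqn_leq p2 prime_gt1.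
have [α [β ab]] := two_squares (-1) (oner_neq0 F) (oner_neq0 F).
exists (α, β, 2%:R^-1); split=> /=; first by rewrite -ab !mul1r.
by rewrite mulfV.
Qed.

(** The rack has between 5 and 8 elements; a class of 3-cycles of ['Alt_('I_4)] has at
   most 4, that of ['Alt_('I_5)] has 20, and [tri K] at least 12. *)
Lemma Alt4_odd : p != 2%N ->
  tri_occurs F ((cycle123 1 ^: 'Alt_('I_4)) :|: ((cycle123 1)^-1 ^: 'Alt_('I_4)))%g.
Proof.
move=> /quaternion_basis[[[α β] h] /= [αβ h2]].
have φE : (0 : F) ^+ 2 = (0 : int)%:~R * (0 + 1) by rewrite mul0r expr0n.
have cl := cube_closed; have le8 := card_vrack α β h 0%R cube_vertices.
rewrite (_ : size cube_vertices = 8%N) in le8; last by vm_compute.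
have ge5 : (5 <= #|vrack α β h 0%R cube_vertices|)%N.
  by apply: (card_vrack_ge αβ h2 (t := take 5 cube_vertices)) => [v /mem_take//|]; apply: uniq5 _ h2.
exists (vrack α β h 0%R cube_vertices); split.
- by have := vrack_tri αβ h2 φE cl.
- by have := vrack_closed αβ h2 φE cl.
have [[_ [iso|iso]]|[_ iso]|[K [k [K4 _ iso]]]] :=
  vrack_types αβ h2 φE cl p_pr p_neq3 cardF (fun _ => id).
- by move: ge5; rewrite (rack_iso_card iso) leqNgt ltnS card_class_Alt4.
- exact: iso.
- by move: le8; rewrite (rack_iso_card iso) card_class_Alt5.
move: le8; rewrite (rack_iso_card iso) => /(leq_trans (card_tri_ge K)) {cl ge5 iso}.
rewrite leqNgt; case/negP; apply: (@leq_trans (4 * 3)) => //.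
by rewrite leq_mul // -ltnS (ltn_predK K4).
Qed.

(** The rack has between 9 and 20 elements, whereas the classes of ['Alt_('I_4)] have
   at most 8 in all, and [tri K] at least 30 unless [K] has 4 or 5 elements, which
   the characteristic excludes. *)
Lemma Alt5_odd : p != 2%N -> (5 %| #|F| ^ 2 - 1)%N -> tri_occurs F (cycle123 2 ^: 'Alt_('I_5))%g.
Proof.
move=> p2 d5; have [φ φE'] := golden_ratio d5.
have [[[α β] h] /= [αβ h2]] := quaternion_basis p2.
have φE : φ ^+ 2 = (1 : int)%:~R * (φ + 1) by rewrite mul1r.
have cl := dodecahedron_closed; have le20 := card_vrack α β h φ dodecahedron.
rewrite (_ : size dodecahedron = 20%N) in le20; last by vm_compute.
have n2 := two_neq0 h2.
have n1 : (1 == -1 :> F) = false.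
  by apply/eqP=> /eqP; rewrite eq_sym -subr_eq0 -opprD oppr_eq0 -mulr2n (negPf n2).
have n1' : (-1 == 1 :> F) = false by rewrite eq_sym.
have n01 : (0 == 1 :> F) = false by rewrite eq_sym oner_eq0.
have n01' : (0 == -1 :> F) = false by rewrite eq_sym oppr_eq0 oner_eq0.
have ge9 : (9 <= #|vrack α β h φ dodecahedron|)%N.
  apply: (card_vrack_ge αβ h2 (t := take 9 dodecahedron)) => [v /mem_take//|].
  rewrite /= /zev3 /zev /= !mul0r !addr0 !inE !xpair_eqE !eqxx !n1 !n1'.
  by rewrite ![_ == 0]eq_sym !n01 !n01'.
exists (vrack α β h φ dodecahedron); split.
- by have := vrack_tri αβ h2 φE cl.
- by have := vrack_closed αβ h2 φE cl.
have cs : {subset cube_vertices <= dodecahedron} by move=> v; rewrite mem_cat => ->.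
have [[_ [iso|iso]]|[_ iso]|[K [k [K4 cK iso]]]] :=
  vrack_types αβ h2 φE cl p_pr p_neq3 cardF cs; last 1 first.
- have p5 : p != 5%N by apply: prime_pow_coprime5 p_pr n0 _; rewrite -cardF.
  move: le20; rewrite (rack_iso_card iso) => /(leq_trans (card_tri_ge K)) {cl cs ge9 iso}le20.
  have dK r : prime r -> (r %| #|K|)%N -> (r == p).
    move=> r_pr rK; have : (r %| p ^ n)%N.
      rewrite -cardF cK; case: k cK => [|k] cK; last by rewrite expnS dvdn_mulr.
      by have := finNzRing_gt1 F; rewrite cK.
    by rewrite Euclid_dvdX // => /andP[+ _]; rewrite dvdn_prime2.
  have K6 : (#|K| < 6)%N.
    rewrite ltnNge; apply: contraTN le20 => K6; rewrite -ltnNge.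
    by apply: (@leq_trans (6 * 5)) => //; rewrite leq_mul // -ltnS (ltn_predK K6).
  case: (ltngtP #|K| 5) => [K5|/(leq_trans K6)|K5]; last 2 first.
  - by rewrite ltnn.
  - by have := dK 5%N isT; rewrite K5 eq_sym (negPf p5) => /(_ isT).
  have eK : #|K| = 4%N by apply/eqP; rewrite eqn_leq K4 -ltnS K5.
  by have := dK 2%N isT; rewrite eK eq_sym (negPf p2) => /(_ isT).
- by move: ge9; rewrite (rack_iso_card iso) => /leq_trans/(_ card_class_Alt4).
- by move: ge9; rewrite (rack_iso_card iso) => /leq_trans/(_ card_classes_Alt4).
- exact: iso.
Qed.

Lemma Alt5_pow4 k : #|F| = (4 ^ k)%N -> tri_occurs F (cycle123 2 ^: 'Alt_('I_5))%g.
Proof.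
move=> cF; have [K _ cK] := pPrimePowerField (isT : prime 2) (isT : (0 < 2)%N).
have [f _] : exists f : {rmorphism K -> F}, True by apply: (finField_embed (k := k)); rewrite cK.
have clT : {in tri K &, forall x y, op2 x y \in tri K}.
  by move=> x y /triP[_ dx] Ty; apply: op2_tri.
exists (map2 f @: tri K); split.
- by apply/subsetP=> _ /imsetP[x Tx ->]; rewrite map2_tri.
- by move=> _ _ /imsetP[x Tx ->] /imsetP[y Ty ->]; rewrite -map2_op imset_f // clT.
apply: (rack_iso_trans _ (tri_card4 cK)).
apply: (@rack_iso_sym _ _ _ _ _ _ (one2 K)) => //; exact: map2_rack_iso.
Qed.

Lemma tri_occurs_Alt5 : (5 %| #|F| ^ 2 - 1)%N -> tri_occurs F (cycle123 2 ^: 'Alt_('I_5))%g.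
Proof.
have [p2 d5|p2] := eqVneq p 2%N; last exact: Alt5_odd.
have cF : #|F| = (2 ^ n)%N by rewrite cardF p2.
by move: d5; rewrite cF => /dvd5_pow2[k ek]; apply: (@Alt5_pow4 k); rewrite cF.
Qed.

Lemma tri_occurs_Alt4s : odd #|F| \/ (exists k, #|F| = 4 ^ k)%N ->
  tri_occurs F ((cycle123 1 ^: 'Alt_('I_4)) :|: ((cycle123 1)^-1 ^: 'Alt_('I_4)))%g.
Proof.
case=> [oF|[k cF]].
  by apply: Alt4_odd; apply: contraTneq oF => p2; rewrite cardF p2 oddX orbF -lt0n n0.
have [W [sW clW iso]] := Alt4_sub_Alt5.
have [X [sX clX isoX]] := tri_occurs_sub sW clW (Alt5_pow4 cF).
by exists X; split=> //; apply: rack_iso_trans isoX iso.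
Qed.

Lemma tri_occurs_subfield (K : finFieldType) k : #|F| = (#|K| ^ k)%N ->
  3%:R != 0 :> K -> tri_occurs F (order3 K).
Proof.
move=> cF K3; have [f _] := finField_embed cF.
have clT : {in tri K &, forall x y, op2 x y \in tri K}.
  by move=> x y /triP[_ dx] Ty; apply: op2_tri.
exists (map2 f @: tri K); split.
- by apply/subsetP=> _ /imsetP[x Tx ->]; rewrite map2_tri.
- by move=> _ _ /imsetP[x Tx ->] /imsetP[y Ty ->]; rewrite -map2_op imset_f // clT.
rewrite (order3E K3); apply: (rack_iso_trans _ (psl_rack_iso (subxx _))).
apply: (@rack_iso_sym _ _ _ _ _ _ (one2 K)) => //; exact: map2_rack_iso.
Qed.
End Exists.

(** * From matrices back to PSL2 *)

Section Transport.
Variable F : finFieldType.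
Hypothesis F3 : 3%:R != 0 :> F.

Lemma subrack_lift (X : {set coset_of 'Z(SL2 F)%g}) : subrack (@conj_op _) (order3 F) X ->
  exists X' : {set m2 F}, [/\ X' \subset tri F, {in X' &, forall x y, op2 x y \in X'},
    X' != set0 & X = @psl F @: X'].
Proof.
rewrite order3E // => -[sX X0 clX]; pose X' := [set x in tri F | psl x \in X].
have sX' : X' \subset tri F by apply/subsetP=> x /setIdP[].
have eX : X = @psl F @: X'.
  apply/setP=> u; apply/idP/imsetP=> [Xu|[x + ->]]; last by rewrite inE => /andP[].
  have /imsetP[x Tx eu] := subsetP sX u Xu.
  by exists x; rewrite // inE Tx -eu.
exists X'; split=> //.
  move=> x y /setIdP[Tx Xx] /setIdP[Ty Xy]; apply/setIdP.
  have [_ dx] := triP _ Tx; have [_ dy] := triP _ Ty.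
  by rewrite op2_tri // psl_op // clX.
by apply: contra_neq X0 => X'0; rewrite eX X'0 imset0.
Qed.

Lemma psl_iso_sym (X : {set m2 F}) : X \subset tri F ->
    {in X &, forall x y, op2 x y \in X} ->
  rack_isomorphic (@conj_op _) (@psl F @: X) (@op2 F) X.
Proof. by move=> sX clX; apply: (@rack_iso_sym _ _ _ _ _ _ (one2 F)) (psl_rack_iso sX). Qed.

Lemma tri_occurs_in (hT : finGroupType) (Y : {set hT}) : Y != set0 ->
  tri_occurs F Y -> occurs_in (order3 F) Y.
Proof.
move=> Y0 [X [sX clX iso]]; exists (@psl F @: X); last exact: rack_iso_trans (psl_iso_sym sX clX) iso.
split; first by rewrite order3E // imsetS.
  rewrite -card_gt0 card_in_imset ?(rack_iso_card iso) ?card_gt0 //.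
  by move=> x y Xx Xy; apply: psl_tri_inj; apply: (subsetP sX).
move=> _ _ /imsetP[x Xx ->] /imsetP[y Xy ->].
have [_ dx] := triP _ (subsetP sX x Xx); have [_ dy] := triP _ (subsetP sX y Xy).
by rewrite -psl_op // imset_f // clX.
Qed.
End Transport.

Local Close Scope ring_scope.

Theorem proposition5p17 (p n q : nat) (F : finFieldType)
    (p_pr : prime p) (p_neq3 : p != 3) (n_gt0 : (0 < n)%N)
    (q_def : q = (p ^ n)%N) (card_F : #|F| = q) :
  let O := order3 F in
  (* the class of elements of order three *)
  (O \in classes (PSL2 F) /\ semisimple_class O) /\
  (* every subrack is of one of the types (1)-(6) *)
  (forall X : {set coset_of 'Z(SL2 F)}, subrack (@conj_op _) O X ->
    (* (1) *)
    #|X| = 1%N \/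
    (* (2) *)
    (exists2 y, y \in O & X = [set y; y^-1]) \/
    (* (3) *)
    ((odd q \/ exists k, q = (4 ^ k)%N) /\
     (X ~=r cycle123 1 ^: 'Alt_('I_4) \/
      X ~=r (cycle123 1 ^: 'Alt_('I_4)) :|: ((cycle123 1)^-1 ^: 'Alt_('I_4)))) \/
    (* (4) *)
    (5 %| (q ^ 2 - 1)%N /\ X ~=r cycle123 2 ^: 'Alt_('I_5)) \/
    (* (5) *)
    (3 %| (q - 1)%N /\
     exists (C3 : {group {unit F}}) (z : {unit F}) (A : finLmodType (subfield C3)),
       [/\ C3 \subset squares F, #|C3| = 3, z \in C3 /\ #[z] = 3,
           (1 < #|A| <= q)%N
         & X ~=r sd_subset A [set z; z^-1] \/ X ~=r sd_subset A [set z]]) \/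
    (* (6) *)
    (exists (q0 k : nat) (F0 : finFieldType),
       [/\ (4 < q0)%N, q = (q0 ^ k)%N, #|F0| = q0 & X ~=r order3 F0])) /\
  (* each type occurs *)
  [/\ forall y, y \in O -> subrack (@conj_op _) O [set y],
      forall y, y \in O -> subrack (@conj_op _) O [set y; y^-1],
      odd q \/ (exists k, q = (4 ^ k)%N) ->
        occurs_in O (cycle123 1 ^: 'Alt_('I_4)) /\
        occurs_in O
          ((cycle123 1 ^: 'Alt_('I_4)) :|: ((cycle123 1)^-1 ^: 'Alt_('I_4)))
    & [/\ 5 %| (q ^ 2 - 1)%N -> occurs_in O (cycle123 2 ^: 'Alt_('I_5)),
          3 %| (q - 1)%N ->
            forall (C3 : {group {unit F}}) (z : {unit F})
                   (A : finLmodType (subfield C3)),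
              C3 \subset squares F -> #|C3| = 3 -> z \in C3 -> #[z] = 3 ->
              (1 < #|A| <= q)%N ->
              occurs_in O (sd_subset A [set z; z^-1]) /\
              occurs_in O (sd_subset A [set z])
        & forall (q0 k : nat) (F0 : finFieldType),
            (4 < q0)%N -> q = (q0 ^ k)%N -> #|F0| = q0 ->
            occurs_in O (order3 F0)]].
Proof.
move=> O; have cF : #|F| = (p ^ n)%N by rewrite card_F.
have F3 : (3%:R != 0 :> F)%R := char3 p_pr p_neq3 cF.
split; first by split; [apply: order3_class | apply: order3_semisimple].
split=> [X /(subrack_lift F3)[X' [sX' clX' X'0 eX]]|].
  have iso := psl_iso_sym sX' clX'; rewrite -eX in iso.
  have [c1|[[y Xy e]|[[oF isoA]|[[d5 isoA]|[|]]]]] := tri_rack_types p_pr p_neq3 cF sX' clX' X'0.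
  - by left; rewrite (rack_iso_card iso).
  - right; left; have Ty := subsetP sX' y Xy; have [_ dy] := triP _ Ty.
    exists (psl y); first by rewrite /O order3E // imset_f.
    by rewrite eX e imsetU1 imset_set1 pslV.
  - do 2!right; left; rewrite -card_F; split; first by left.
    by case: isoA => isoA; [left | right]; apply: rack_iso_trans iso isoA.
  - do 3!right; left; rewrite -card_F; split=> //; exact: rack_iso_trans iso isoA.
  - case=> C3 [z [A [sC cC zz cA isoA]]]; do 4!right; left; split.
      by rewrite -card_F subn1 -card_finField_unit -cC cardSg ?subsetT.
    exists C3, z, A; split; rewrite -?card_F //.
    by case: isoA => isoA; [left | right]; apply: rack_iso_trans iso isoA.
  case=> K [k [K4 cK isoA]]; do 5!right; exists #|K|, k, K; split; rewrite -?card_F //.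
  have [f _] := finField_embed cK.
  have K3 : (3%:R != 0 :> K)%R by rewrite -(fmorph_eq0 f) rmorph_nat.
  rewrite order3E //; apply: rack_iso_trans iso (rack_iso_trans isoA _).
  exact: psl_rack_iso.
have conj1 (y : coset_of 'Z(SL2 F)) : conj_op y y = y by rewrite /conj_op mulgK.
split=> [y Oy|y Oy|h|].
- split; first by rewrite sub1set.
    by apply/set0Pn; exists y; rewrite inE.
  by move=> _ _ /set1P-> /set1P->; rewrite conj1 inE.
- split.
  + rewrite subUset !sub1set Oy; move: Oy; rewrite !inE => /andP[Py oy].
    by rewrite groupV Py orderV.
  + by apply/set0Pn; exists y; rewrite !inE eqxx.
  have c1 : conj_op y y^-1 = y^-1 by rewrite /conj_op mulgV mul1g.
  have c2 : conj_op y^-1 y = y by rewrite /conj_op mulVg mul1g invgK.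
  by move=> _ _ /set2P[]-> /set2P[]->; rewrite ?conj1 ?c1 ?c2 !inE eqxx ?orbT.
- have t4 : tri_occurs F ((cycle123 1 ^: 'Alt_('I_4)) :|: ((cycle123 1)^-1 ^: 'Alt_('I_4))).
    by apply: (tri_occurs_Alt4s p_pr p_neq3 n_gt0 cF); rewrite card_F.
  have c0 : cycle123 1 \in cycle123 1 ^: 'Alt_('I_4) := class_refl _ _.
  split; apply: tri_occurs_in => //.
  + by apply/set0Pn; exists (cycle123 1).
  + exact: tri_occurs_Alt4.
  by apply/set0Pn; exists (cycle123 1); rewrite inE c0.
split=> [d5|d3 C3 z A sC cC Cz oz /andP[_ cA]|q0 k F0 q05 eq cF0].
- apply: tri_occurs_in => //.
    by apply/set0Pn; exists (cycle123 2); apply: class_refl.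
  by apply: (tri_occurs_Alt5 p_pr p_neq3 n_gt0 cF); rewrite card_F.
- have sd (S : {set {unit F}}) : S \subset C3 -> 1 \notin S -> z \in S -> occurs_in O (sd_subset A S).
    move=> sS S1 Sz; apply: tri_occurs_in => //.
      by apply/set0Pn; exists (SDPair 0%R (subg C3 z)); rewrite inE /= subgK.
    by apply: borel_exists; rewrite ?card_F.
  have z1 : 1 != z by rewrite eq_sym -order_eq1 oz.
  have zV1 : 1 != z^-1 by rewrite eq_sym invg_eq1 eq_sym.
  split; apply: sd; rewrite ?sub1set ?subUset ?sub1set ?groupV ?Cz //.
  + by rewrite !inE negb_or z1.
  + by rewrite !inE eqxx.
  + by rewrite inE.
  by rewrite inE.
have cK : #|F| = (#|F0| ^ k)%N by rewrite card_F cF0.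
have [f _] := finField_embed cK.
have K3 : (3%:R != 0 :> F0)%R by rewrite -(fmorph_eq0 f) rmorph_nat.
apply: tri_occurs_in => //; last exact: tri_occurs_subfield cK K3.
apply/eqP=> o0; have /imsetP[x _ ex] := order3_class K3.
by have := class_refl (PSL2_group F0) x; rewrite -ex o0 inE.
Qed.
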